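(* For every non-empty index $\boldsymbol{k}=(k_1,\ldots,k_r)$, the following equality holds in $(\mathcal{Z}/\zeta(2)\mathcal{Z})[[t]]$: \begin{align*} &\sum_{i=1}^r \sum_{j=0}^{k_i-2} \zeta_{\widehat{\mathcal{S}}}(j+1,k_{i+1},\ldots,k_r,k_1,\ldots,k_{i-1},k_i-j)\\ &=\sum_{i=1}^r \sum_{j=0}^\infty\left(\zeta_{\widehat{\mathcal{S}}}(k_i+j+1,k_{i+1},\ldots,k_r,k_1,\ldots,k_{i-1})+\zeta_{\widehat{\mathcal{S}}}(j+1,k_{i+1},\ldots,k_r,k_1,\ldots,k_i)\right)t^j\\ &\quad+\sum_{i=1}^r \zeta_{\widehat{\mathcal{S}}}(k_{i+1},\ldots,k_r,k_1,\ldots,k_{i-1},k_i+1). \end{align*}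
   Context: An index is a tuple $\boldsymbol{k}=(k_1,\dots,k_r)$ of positive integers ($r\ge 0$; $r=0$ gives the empty index $\varnothing$). It is admissible if it is empty or $k_r\ge 2$. For admissible $\boldsymbol{k}$, $\zeta(k_1,\dots,k_r)=\sum_{1\le n_1<\cdots<n_r}\frac{1}{n_1^{k_1}\cdots n_r^{k_r}}$, $\zeta(\varnothing)=1$. $\mathcal{Z}\subset\mathbb{R}$ is the $\mathbb{Q}$-linear span of $1$ and all multiple zeta values; it is a $\mathbb{Q}$-algebra. Empty sums are $0$; for $i=r$ the string $k_{i+1},\dots,k_r$ is empty, and for $i=1$ the string $k_1,\dots,k_{i-1}$ is empty. Let $\mathfrak{H}=\mathbb{Q}\langle x,y\rangle$, $\mathfrak{H}^1=\mathbb{Q}+y\mathfrak{H}\supset\mathfrak{H}^0=\mathbb{Q}+y\mathfrak{H}x$, $z_k=yx^{k-1}$, $z_{\boldsymbol{k}}=z_{k_1}\cdots z_{k_r}$. Let $Z:\mathfrak{H}^0\to\mathbb{R}$ be the $\mathbb{Q}$-linear map with $Z(z_{\boldsymbol{k}})=\zeta(\boldsymbol{k})$ for admissible $\boldsymbol{k}$. The harmonic product $\ast$ on $\mathfrak{H}^1$ is the $\mathbb{Q}$-bilinear product with $w\ast1=1\ast w=w$ and $w_1z_k\ast w_2z_l=(w_1\ast w_2z_l)z_k+(w_1z_k\ast w_2)z_l+(w_1\ast w_2)z_{k+l}$. The shuffle product $\mathrm{sh}$ on $\mathfrak{H}$ is the $\mathbb{Q}$-bilinear product with $w\,\mathrm{sh}\,1=1\,\mathrm{sh}\,w=w$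 and $w_1u_1\,\mathrm{sh}\,w_2u_2=(w_1\,\mathrm{sh}\,w_2u_2)u_1+(w_1u_1\,\mathrm{sh}\,w_2)u_2$ for $u_1,u_2\in\{x,y\}$. For $\bullet\in\{\ast,\mathrm{sh}\}$, $Z$ is a homomorphism for $\bullet$ on $\mathfrak{H}^0$, $(\mathfrak{H}^1,\bullet)\cong(\mathfrak{H}^0,\bullet)[y]$, and $Z^{\bullet}:(\mathfrak{H}^1,\bullet)\to\mathbb{R}[T]$, $w\mapsto Z^\bullet(w;T)$, is the unique $\mathbb{Q}$-algebra homomorphism extending $Z$ with $Z^{\bullet}(y;T)=T$; its image lies in $\mathcal{Z}[T]$. Put $\zeta^{\bullet}(\boldsymbol{k})=Z^{\bullet}(z_{\boldsymbol{k}};0)\in\mathcal{Z}$. For $\bullet\in\{\ast,\mathrm{sh}\}$ the $t$-adic symmetric multiple zeta values are the elements of $\mathcal{Z}[[t]]$ $$\zeta^{\bullet}_{\widehat{\mathcal{S}}}(k_1,\ldots,k_r)=\sum_{i=0}^r(-1)^{k_{i+1}+\cdots+k_r}\zeta^{\bullet}(k_1,\ldots,k_i)\sum_{l_{i+1},\ldots,l_r\ge0}\ \prod_{j=i+1}^r\binom{k_j+l_j-1}{l_j}\,\zeta^{\bullet}(k_r+l_r,\ldots,k_{i+1}+l_{i+1})\,t^{l_{i+1}+\cdots+l_r}.$$ It is known (Ono–Seki–Yamamoto) that $\zeta^{\ast}_{\widehat{\mathcal{S}}}(\boldsymbol{k})\equiv\zeta^{\mathrm{sh}}_{\widehat{\mathcal{S}}}(\boldsymbol{k})$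 modulo $\zeta(2)\mathcal{Z}[[t]]$; $\zeta_{\widehat{\mathcal{S}}}(\boldsymbol{k})\in(\mathcal{Z}/\zeta(2)\mathcal{Z})[[t]]$ denotes their common reduction, taken coefficientwise. *)

(* Defs.v *)
From HB Require Import structures.
From mathcomp Require Import all_boot all_order all_algebra.
From mathcomp Require Import finmap.
From mathcomp Require Import all_classical all_reals all_analysis.
(* the notations of monalg cannot coexist with those of MathComp-Analysis *)
From mathcomp Require Export -(notations) monalg.

Set Implicit Arguments.
Unset Strict Implicit.
Unset Printing Implicit Defensive.

Import Order.TTheory GRing.Theory Num.Theory.
Local Open Scope classical_set_scope.
Local Open Scope ring_scope.

Definition is_index (k : seq nat) : bool := all (fun a => 0 < a)%N k.

Definition admissible (k : seq nat) : bool := is_index k && (1 < last 2 k)%N.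

(* The monoid algebra over rat of the free monoid on two letters,
   where false stands for x and true for y. *)
Definition Halg := malg (fmonom bool) rat.

Definition letter (a : bool) : Halg := mkmalgU (fmu a) 1.
Definition x_ : Halg := letter false.
Definition y_ : Halg := letter true.

Definition word (w : seq bool) : Halg := \prod_(a <- w) letter a.

Definition z_ (k : nat) : Halg := y_ * x_ ^+ k.-1.
Definition zword (k : seq nat) : Halg := \prod_(a <- k) z_ a.

Definition H1 : set Halg :=
  [set p | exists (c : rat) (h : Halg), p = c%:A + y_ * h].
Definition H0 : set Halg :=
  [set p | exists (c : rat) (h : Halg), p = c%:A + y_ * h * x_].

(* [word_index w] is the index k such that the word w, when it is empty or
   starts with y, equals z_k.  The word is read from right to left, n counting
   the letters x met since the last y. *)
Fixpoint rev_word_index (n : nat) (w : seq bool) : seq nat :=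
  match w with
  | [::] => [::]
  | false :: w' => rev_word_index n.+1 w'
  | true :: w' => n.+1 :: rev_word_index 0 w'
  end.
Definition word_index (w : seq bool) : seq nat := rev (rev_word_index 0 (rev w)).

(* The defining recursions of both products peel off the last letter; they are
   structural on reversed words: [harmonic_rev u v] is the harmonic product of
   z_(rev u) and z_(rev v). *)
Fixpoint harmonic_rev (u : seq nat) : seq nat -> Halg :=
  fix aux (v : seq nat) : Halg :=
    match u, v with
    | [::], _ => zword (rev v)
    | _, [::] => zword (rev u)
    | k :: u', l :: v' =>
        harmonic_rev u' v * z_ k + aux v' * z_ l + harmonic_rev u' v' * z_ (k + l)%N
    end.

Fixpoint shuffle_rev (u : seq bool) : seq bool -> Halg :=
  fix aux (v : seq bool) : Halg :=
    match u, v with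
    | [::], _ => word (rev v)
    | _, [::] => word (rev u)
    | a :: u', b :: v' => shuffle_rev u' v * letter a + aux v' * letter b
    end.

Definition bilinear_ext (f : seq bool -> seq bool -> Halg) (p q : Halg) : Halg :=
  \sum_(u <- msupp p) \sum_(v <- msupp q)
    (mcoeff u p * mcoeff v q) *: f (fmonom_val u) (fmonom_val v).

(* Only meaningful on H1. *)
Definition harmonic_prod : Halg -> Halg -> Halg :=
  bilinear_ext (fun u v => harmonic_rev (rev (word_index u)) (rev (word_index v))).

Definition shuffle_prod : Halg -> Halg -> Halg :=
  bilinear_ext (fun u v => shuffle_rev (rev u) (rev v)).

Variant product_kind := Harmonic | Shuffle.

Definition Hprod (b : product_kind) : Halg -> Halg -> Halg :=
  match b with Harmonic => harmonic_prod | Shuffle => shuffle_prod end.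

Section MultipleZetaValues.
Variable R : realType.

(* [path ltn 0 n] says 0 < n_1 < ... < n_r. *)
Definition mzv (k : seq nat) : R :=
  fine (\esum_(n in [set n : seq nat | size n = size k /\ path ltn 0%N n])
          (\prod_(i < size k) (nth 0%N n i)%:R ^- nth 0%N k i)%:E).

Definition mzv_span : set R :=
  [set a | exists2 s : seq (rat * seq nat),
     all (fun ck => admissible ck.2) s &
     a = \sum_(ck <- s) ratr ck.1 * mzv ck.2].

Definition Zmap (p : Halg) : R :=
  \sum_(w <- msupp p) ratr (mcoeff w p) * mzv (word_index (fmonom_val w)).

Definition is_regularization (b : product_kind) (f : Halg -> {poly R}) : Prop :=
  [/\ forall (c : rat) (p q : Halg), H1 p -> H1 q ->
        f (c *: p + q) = ratr c *: f p + f q,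
      f 1 = 1,
      forall p q : Halg, H1 p -> H1 q -> f (Hprod b p q) = f p * f q,
      forall p : Halg, H0 p -> f p = (Zmap p)%:P
    & f y_ = 'X].

(* The values outside H1 are irrelevant: on H1, exactly one map satisfies
   [is_regularization b]. *)
Definition Zreg (b : product_kind) : Halg -> {poly R} :=
  xget (fun _ : Halg => 0 : {poly R}) [set f | is_regularization b f].

Definition mzv_reg (b : product_kind) (k : seq nat) : R :=
  (Zreg b (zword k)).[0].

(* A power series in t is represented by its sequence of coefficients; here
   [tail] is (k_(i+1), ..., k_r). *)
Definition smzv (b : product_kind) (k : seq nat) : nat -> R := fun n =>
  \sum_(i < (size k).+1)
    let tail := drop i k in
    (-1) ^+ sumn tail * mzv_reg b (take i k) *
    \sum_(l : {ffun 'I_(size tail) -> 'I_n.+1} | (\sum_j l j)%N == n)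
      (\prod_(j < size tail) 'C(nth 0 tail j + l j - 1, l j))%N%:R *
      mzv_reg b (rev [seq (nth 0%N tail j + l j)%N | j : 'I_(size tail)]).

(* The formal sum of A_j t^j over all j >= 0. *)
Definition tsum (A : nat -> nat -> R) : nat -> R :=
  fun n => \sum_(j < n.+1) A j (n - j)%N.

Definition eqmod_zeta2 (a b : R) : Prop :=
  [/\ mzv_span a, mzv_span b
    & exists2 c, mzv_span c & a - b = mzv [:: 2%N] * c].

(* Equality in (Z / zeta(2) Z)[[t]], where Z is [mzv_span]. *)
Definition series_eqmod_zeta2 (A B : nat -> R) : Prop :=
  forall n, eqmod_zeta2 (A n) (B n).

End MultipleZetaValues.

(* (k_(i+1), ..., k_r, k_1, ..., k_(i-1)), with i counted from 0 in the code. *)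
Definition cyc_rest (k : seq nat) (i : nat) : seq nat := drop i.+1 k ++ take i k.

(* Main.v *)
(* If no regularization exists, all values are 0 by the choice of [Zreg].
   Otherwise replace zeta by sums truncated at N.  The truncated t-adic symmetric
   sum of k is a nested sum of reciprocals of the 2N points 1, ..., N, t - N, ...,
   t - 1 modulo a power of t, so that partial fractions and rotation of the index
   prove the cyclic sum formula up to explicit boundary terms; these vanish in the
   limit unless k = (1, ..., 1) and the coefficient is that of t^0.  Divergences
   are removed by splitting off leading ones: truncated values are a convolution
   of elementary symmetric sums with convergent values, and in a symmetric sum
   this factor only contributes its product with its alternating twin, which
   involves even zeta values, all in the ideal of zeta(2).  Both regularizations
   are determined by the products with y, and the limits satisfy the same
   relations.  For k = (1, ..., 1) of length r and t^0 the formula reduces to the duality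
   zeta(1, ..., 1, 2) = zeta(r + 1) and again to even zeta values. *)

Require Import Defs.
From mathcomp Require Import all_boot all_order all_algebra finmap.
From mathcomp Require Import all_classical all_reals all_analysis.
From mathcomp Require Import zify ring lra.
Import Order.TTheory GRing.Theory Num.Theory.
Import numFieldNormedType.Exports.
Local Open Scope classical_set_scope.
Local Open Scope ring_scope.

Set Implicit Arguments.
Unset Strict Implicit.
Unset Printing Implicit Defensive.

(** * Nested sums *)

(** The position i in the definition of the symmetric value is where an increasing chain passes from
    the points 1, ..., N to t - N, ..., t - 1. The upper points are met by decreasing m, whence the
    reversed string; (t - m)^(-k) = (-1)^k (m - t)^(-k) supplies the sign and, expanded in t, the
    binomial coefficients. Modulo t^(n+1) all points and their differences are invertible. The
    obstacle is divergence: truncated values at indices with trailing ones grow like powers of log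
    N. With E_N(x) the product of the 1 + x/m over m <= N, a symmetric sum depends on E_N only
    through E_N(x) E_N(-x), which is unchanged when E_N is multiplied by exp(- x H_N). This exchange
    is exact at every N and makes all terms converge, so no asymptotic expansion enters. The
    regularizations are not constructed. At T = 0 every product with y has the value 0, and this
    alone leads from an index with trailing ones down to admissible ones. Even zeta values enter the
    ideal through the quadratic recurrence for zeta(2n), obtained by partial fractions in the
    squares, not through pi. *)

Section NestedSums.
Variable K : comNzRingType.
Implicit Types (X : nat -> K) (u v ks : seq nat) (psi : nat -> K).

(* [rnest] lists the exponents from the largest index to the smallest one,
   which is the argument of the weight [psi]. *)
Fixpoint rnest X (N : nat) u psi : K :=
  if u is k :: v then \sum_(0 <= c < N) X c ^+ k * rnest X c v psi else psi N.

(* [lnest] lists the exponents from the smallest index on; the argument of the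
   weight [psi] is one more than the largest index. *)
Fixpoint lnest X (N : nat) ks psi (a : nat) : K :=
  if ks is k :: ks' then \sum_(a <= b < N) X b ^+ k * lnest X N ks' psi b.+1
  else psi a.

Lemma eq_rnest X Y N u psi phi : (forall c, (c < N)%N -> X c = Y c) ->
  (forall c, (c <= N)%N -> psi c = phi c) ->
  rnest X N u psi = rnest Y N u phi.
Proof.
elim: u N => [|k u IHu] N eX eP /=; first exact: eP.
apply: eq_big_nat => c /andP[_ cN]; rewrite eX // (IHu c) // => d dc.
  by apply/eX/(ltn_trans dc).
by apply/eP/(leq_trans dc)/ltnW.
Qed.

Lemma rnestZ X N u z psi :
  rnest X N u (fun c => z * psi c) = z * rnest X N u psi.
Proof.
elim: u N => //= k u IHu N; rewrite mulr_sumr.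
by apply: eq_bigr => c _; rewrite IHu mulrCA.
Qed.

Lemma rnest_oppX X N u psi :
  rnest (fun c => - X c) N u psi = (-1) ^+ sumn u * rnest X N u psi.
Proof.
elim: u N => [|k u IHu] N /=; first by rewrite mul1r.
rewrite mulr_sumr; apply: eq_bigr => c _.
by rewrite IHu (exprNn (X c)) exprD mulrACA.
Qed.

Lemma eq_lnest X Y N ks psi phi a :
  (forall b, (a <= b < N)%N -> X b = Y b) ->
  (forall b, (a <= b)%N -> psi b = phi b) ->
  lnest X N ks psi a = lnest Y N ks phi a.
Proof.
elim: ks a => //= [|k ks IHks] a eqXY eqp; first exact: eqp.
apply: eq_big_nat => b /andP[ab bN].
by rewrite eqXY ?ab // (IHks b.+1) // => c; [case/andP|] => *; [apply: eqXY|apply: eqp]; lia.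
Qed.

Lemma eq_lnest_weight X N ks psi phi a : (forall b, psi b = phi b) ->
  lnest X N ks psi a = lnest X N ks phi a.
Proof. by move=> e; apply: eq_lnest. Qed.

Lemma lnestD X N ks psi phi a :
  lnest X N ks (fun b => psi b + phi b) a = lnest X N ks psi a + lnest X N ks phi a.
Proof.
elim: ks a => //= k ks IHks a; rewrite -big_split /=.
by apply: eq_bigr => b _; rewrite IHks mulrDr.
Qed.

Lemma lnestZ X N ks psi z a :
  lnest X N ks (fun b => z * psi b) a = z * lnest X N ks psi a.
Proof.
elim: ks a => //= k ks IHks a; rewrite mulr_sumr.
by apply: eq_bigr => b _; rewrite IHks mulrCA.
Qed.

Lemma lnestN X N ks psi a :
  lnest X N ks (fun b => - psi b) a = - lnest X N ks psi a.
Proof.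
under eq_lnest_weight do rewrite -mulN1r.
by rewrite lnestZ mulN1r.
Qed.

Lemma lnest0 X N ks a : lnest X N ks (fun=> 0) a = 0.
Proof.
by elim: ks a => //= k ks IHks a; rewrite big1 // => b _; rewrite IHks mulr0.
Qed.

Lemma lnest_sum (I : Type) (r : seq I) (P : pred I) X N ks (F : I -> nat -> K) a :
  lnest X N ks (fun b => \sum_(i <- r | P i) F i b) a =
  \sum_(i <- r | P i) lnest X N ks (F i) a.
Proof.
elim: r => [|i r IHr].
  by under eq_lnest_weight do rewrite big_nil; rewrite big_nil lnest0.
under eq_lnest_weight do rewrite big_cons.
by rewrite big_cons; case: (P i); rewrite ?lnestD IHr.
Qed.

Lemma lnest_rcons X N ks k psi a :
  lnest X N (rcons ks k) psi a =
  lnest X N ks (fun b => \sum_(b <= c < N) X c ^+ k * psi c.+1) a.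
Proof. by elim: ks a => //= l ks IHks a; apply: eq_bigr => b _; rewrite IHks. Qed.

Lemma triangular_exchange (F : nat -> nat -> K) a N :
  \sum_(a <= b < N) \sum_(b.+1 <= c < N) F b c =
  \sum_(a <= c < N) \sum_(a <= b < c) F b c.
Proof.
under eq_big_nat => b /andP[ab _].
  rewrite (@big_nat_widenl _ _ _ b.+1 a) 1?leqW //= big_mkcond /=; over.
rewrite exchange_big; apply: eq_big_nat => c /andP[ac cN].
by rewrite [RHS](big_nat_widen _ _ N) 1?ltnW // [RHS]big_mkcond.
Qed.

Lemma lnest_rcons_top X N ks k a :
  lnest X N (rcons ks k) (fun=> 1) a =
  \sum_(a <= c < N) X c ^+ k * lnest X c ks (fun=> 1) a.
Proof.
elim: ks a => [|l ks IHks] a //=.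
under eq_bigr => b _ do rewrite IHks mulr_sumr.
rewrite triangular_exchange; apply: eq_bigr => c _.
by rewrite mulr_sumr; apply: eq_bigr => b _; rewrite mulrCA.
Qed.

Lemma rnest_rev X N k ks psi :
  rnest X N (rev (k :: ks)) psi =
  \sum_(0 <= b < N) X b ^+ k * psi b * lnest X N ks (fun=> 1) b.+1.
Proof.
elim/last_ind: ks N => [|ks l IHks] N /=.
  by apply: eq_bigr => c _; rewrite mulr1.
rewrite -rcons_cons rev_rcons /=.
under eq_bigr do rewrite IHks mulr_sumr.
rewrite -triangular_exchange; apply: eq_bigr => b _.
by rewrite lnest_rcons_top mulr_sumr; apply: eq_bigr => c _; rewrite mulrCA.
Qed.

Lemma rnest_rev1 X N ks :
  rnest X N (rev ks) (fun=> 1) = lnest X N ks (fun=> 1) 0.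
Proof.
case: ks => // k ks; rewrite rnest_rev /=.
by apply: eq_bigr => b _; rewrite mulr1.
Qed.

(** The substitution b -> N - 1 - b turns increasing chains into decreasing ones. It serves for the
    upper half of the points, where the position grows while m in t - m falls. *)
Lemma lnest_reflect X N ks psi a : (a <= N)%N ->
  lnest X N ks psi a =
  rnest (fun c => X (N.-1 - c)%N) (N - a) ks (fun c => psi (N - c)%N).
Proof.
elim: ks a => [|k ks IHks] a aN /=; first by rewrite subKn.
rewrite -{1}[a]add0n big_addn [LHS]big_nat_rev /=.
apply: eq_big_nat => c /andP[_ cN].
have -> : (0 + (N - a) - c.+1 + a = N.-1 - c)%N by lia.
by rewrite IHks; [congr (_ * rnest _ _ _ _)|]; lia.
Qed.

(** Here i counts the summation indices below N. The case distinction is needed because the weight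
    sees one more than the largest index: this is [b] if no index reaches N, and is decided by the
    upper part otherwise. *)
Lemma lnest_split X N M ks psi a : (a <= N <= M)%N ->
  lnest X M ks psi a =
  \sum_(0 <= i < (size ks).+1)
    lnest X N (take i ks) (fun b => if i == size ks then psi b else lnest X M (drop i ks) psi N) a.
Proof.
elim: ks a => [|k ks IHks] a /andP[aN NM] /=; first by rewrite big_nat1.
rewrite big_nat_recl //= (@big_cat_nat _ _ _ N) //= addrC; congr (_ + _).
under [RHS]eq_bigr do rewrite eqSS.
rewrite exchange_big /=; apply: eq_big_nat => b /andP[ab bN].
by rewrite IHks ?bN // mulr_sumr.
Qed.

Lemma lnest_cut X N M ks psi z a : (a <= N <= M)%N ->
  (forall b, (b <= N)%N -> psi b = z) -> (forall b, (N < b)%N -> psi b = 0) ->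
  lnest X M ks psi a = z * lnest X N ks (fun=> 1) a.
Proof.
move=> + psiN psi0; elim: ks a => [|k ks IHks] a /andP[aN NM] /=.
  by rewrite psiN // mulr1.
rewrite (@big_cat_nat _ _ _ N) //= [X in _ + X]big_nat_cond.
rewrite [X in _ + X]big1 ?addr0 => [|b /andP[/andP[Nb _] _]]; last first.
  rewrite (@eq_lnest X X M ks psi (fun=> 0)) ?lnest0 ?mulr0 // => c bc.
  by rewrite psi0 // (leq_trans _ bc).
rewrite mulr_sumr; apply: eq_big_nat => b /andP[_ bN].
by rewrite IHks ?bN // mulrCA.
Qed.

Lemma lnest_const X N ks z a : lnest X N ks (fun=> z) a = z * lnest X N ks (fun=> 1) a.
Proof. by rewrite -lnestZ; apply: eq_lnest_weight => b; rewrite mulr1. Qed.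

(** The origin of the sum over i in the symmetric values: a chain in two consecutive blocks of
    points is a chain in the lower block followed by one in the upper block. *)
Lemma lnest_deconcat X N M ks a : (a <= N <= M)%N ->
  lnest X M ks (fun=> 1) a =
  \sum_(i < (size ks).+1)
    lnest X N (take i ks) (fun=> 1) a * lnest X M (drop i ks) (fun=> 1) N.
Proof.
move=> aNM; rewrite (lnest_split _ _ _ aNM) big_mkord.
apply: eq_bigr => i _; rewrite mulrC -lnest_const; apply: eq_lnest_weight => b.
by case: eqP => // ->; rewrite drop_size.
Qed.

End NestedSums.

Lemma rnest_morph (K L : comNzRingType) (f : {rmorphism K -> L}) X N u psi :
  f (rnest X N u psi) = rnest (f \o X) N u (f \o psi).
Proof.
elim: u N => [|k u IHu] N //=.
by rewrite rmorph_sum; apply: eq_bigr => c _; rewrite rmorphM rmorphXn IHu.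
Qed.

Lemma lnest_morph (K L : comNzRingType) (f : {rmorphism K -> L}) X N ks psi a :
  f (lnest X N ks psi a) = lnest (f \o X) N ks (f \o psi) a.
Proof.
elim: ks a => [|k u IHu] a //=.
by rewrite rmorph_sum; apply: eq_bigr => c _; rewrite rmorphM rmorphXn IHu.
Qed.

(** * Convolutions, leading ones and t-adic sums *)

Section Convolution.
Variable K : comNzRingType.
Implicit Types a b g h : nat -> K.

Definition convol g h (n : nat) : K := \sum_(i < n.+1) g i * h (n - i)%N.

(** Truncated polynomials lend [convol] the commutativity and associativity of their product. *)
Lemma coef_conv g h n m : (m <= n)%N ->
  convol g h m = ((\poly_(i < n.+1) g i) * (\poly_(i < n.+1) h i))`_m.
Proof.
move=> mn; rewrite coefM; apply: eq_bigr => i _.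
have im : (i <= m)%N by rewrite -ltnS.
by rewrite !coef_poly !ltnS (leq_trans im mn) (leq_trans (leq_subr _ _) mn).
Qed.

Lemma eq_conv g g' h h' n : (forall i, (i <= n)%N -> g i = g' i) ->
  (forall i, (i <= n)%N -> h i = h' i) -> convol g h n = convol g' h' n.
Proof. by move=> eg eh; apply: eq_bigr => i _; rewrite eg ?eh ?leq_subr // -ltnS. Qed.

Lemma convC g h n : convol g h n = convol h g n.
Proof. by rewrite !(@coef_conv _ _ n n) // mulrC. Qed.

Lemma convA a g h n : convol a (convol g h) n = convol (convol a g) h n.
Proof.
set P := fun g => \poly_(i < n.+1) g i.
transitivity ((P a * (P g * P h))`_n); last rewrite mulrA; rewrite coefM.
all: apply: eq_bigr => i _; have ni : (i <= n)%N by rewrite -ltnS.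
  by rewrite -coef_conv ?leq_subr // coef_poly ltnS ni.
by rewrite -coef_conv // coef_poly ltnS leq_subr.
Qed.

Lemma convDl a b g n : convol (fun k => a k + b k) g n = convol a g n + convol b g n.
Proof. by rewrite -big_split; apply: eq_bigr => i _; rewrite mulrDl. Qed.

(* Newton's identities: [a] lists the coefficients of the logarithmic
   derivative of the generating function of [g]. *)
Definition newton a g := forall n, n%:R * g n = convol a g n.

(** The logarithmic derivative of a product is the sum of those of the factors. *)
Lemma newton_conv a b g h : newton a g -> newton b h ->
  newton (fun k => a k + b k) (convol g h).
Proof.
move=> ng nh n; rewrite convDl convA.
have -> : convol (convol a g) h n = convol (fun i => i%:R * g i) h n.
  by apply: eq_conv => // i _; rewrite ng.
have -> : convol b (convol g h) n = convol g (fun i => i%:R * h i) n.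
  transitivity (convol b (convol h g) n); first by apply: eq_conv => // i _; apply: convC.
  by rewrite convA convC; apply: eq_conv => // i _; rewrite nh.
rewrite /convol mulr_sumr -big_split; apply: eq_bigr => i _ /=.
by rewrite -{1}(subnKC (ltnSE (ltn_ord i))) natrD; ring.
Qed.

Lemma newton_sign a g : newton a g ->
  newton (fun k => (-1) ^+ k * a k) (fun k => (-1) ^+ k * g k).
Proof.
move=> ng n; rewrite mulrCA ng /convol mulr_sumr; apply: eq_bigr => i _.
by rewrite -{1}(subnKC (ltnSE (ltn_ord i))) exprD; ring.
Qed.

(** The coefficients of G(x) G(-x), for G the generating function of [g]. In its logarithmic
    derivative the terms of odd degree cancel, so that only even power sums survive. *)
Definition sigma g := convol g (fun k => (-1) ^+ k * g k).

Lemma newton_sigma a g : newton a g ->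
  newton (fun k => a k + (-1) ^+ k * a k) (sigma g).
Proof. by move=> ng; apply: newton_conv => //; apply: newton_sign. Qed.

Lemma sigma0 g : sigma g 0 = g 0 * g 0.
Proof. by rewrite /sigma /convol big_ord1 expr0 mul1r. Qed.

End Convolution.

Section Strip.
Variable K : comNzRingType.
Implicit Types (F G : seq nat -> K) (u v k : seq nat) (g : nat -> K).

(* The sum of g_j F(v) over all j and v such that u is v preceded by j ones. *)
Fixpoint strip1 g F u : K :=
  g 0%N * F u +
  (if u is k :: u' then (k == 1)%N%:R * strip1 (fun j => g j.+1) F u' else 0).

Lemma eq_strip1 g h F G u : g =1 h -> F =1 G -> strip1 g F u = strip1 h G u.
Proof.
move=> + eF; elim: u g h => [|k u IHu] g h eg /=; rewrite eg eF //.
by congr (_ + _ * _); apply: IHu => j.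
Qed.

Lemma strip1D g h F u :
  strip1 (fun j => g j + h j) F u = strip1 g F u + strip1 h F u.
Proof.
elim: u g h => [|k u IHu] g h /=; first by rewrite !addr0 mulrDl.
by rewrite IHu; ring.
Qed.

Lemma strip1Z g z F u : strip1 (fun j => z * g j) F u = z * strip1 g F u.
Proof.
elim: u g => [|k u IHu] g /=; first by rewrite !addr0 mulrA.
by rewrite IHu; ring.
Qed.

Lemma strip1_comp g h F u : strip1 g (strip1 h F) u = strip1 (convol g h) F u.
Proof.
elim: u g h => [|k u IHu] g h /=; first by rewrite /convol big_ord1 !addr0 mulrA.
rewrite IHu [in RHS](eq_strip1 (g := fun j => convol g h j.+1)
  (h := fun j => g 0%N * h j.+1 + convol (fun i => g i.+1) h j) (G := F)) //; last first.
  by move=> j; rewrite /convol big_ord_recl subn0.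
by rewrite strip1D strip1Z /convol big_ord1; ring.
Qed.

Lemma strip1E g F u : strip1 g F u =
  \sum_(0 <= j < (size u).+1) (all (pred1 1%N) (take j u))%:R * g j * F (drop j u).
Proof.
elim: u g => [|k u IHu] g /=; first by rewrite big_nat1 mul1r addr0.
rewrite big_nat_recl //= mul1r IHu mulr_sumr; congr (_ + _).
by apply: eq_bigr => j _; case: eqP; rewrite /= ?(mul0r, mul1r).
Qed.

(** The coefficient of t^n in the inner sum over l_(i+1), ..., l_r of a symmetric value, one entry
    at a time. No reversal occurs because [F] takes reversed indices. *)
Fixpoint tadic v F (n : nat) : K :=
  if v is k :: v' then
    \sum_(l < n.+1) 'C(k + l - 1, l)%:R * tadic v' (fun u => F ((k + l)%N :: u)) (n - l)%N
  else (n == 0)%N%:R * F [::].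

Lemma eq_tadic F G v n : F =1 G -> tadic v F n = tadic v G n.
Proof.
elim: v F G n => [|k v IHv] F G n eF /=; first by rewrite eF.
by apply: eq_bigr => l _; congr (_ * _); apply: IHv => u.
Qed.

Lemma eq_in_tadic F G v n :
  (forall u, size u = size v -> all2 leq v u -> F u = G u) -> tadic v F n = tadic v G n.
Proof.
elim: v F G n => [|k v IHv] F G n eF /=; first by rewrite eF.
apply: eq_bigr => l _; congr (_ * _); apply: IHv => u su lu.
by apply: eF => /=; rewrite ?su // leq_addr.
Qed.

Lemma tadicD F G v n : tadic v (fun u => F u + G u) n = tadic v F n + tadic v G n.
Proof.
elim: v F G n => [|k v IHv] F G n /=; first by rewrite mulrDr.
by rewrite -big_split; apply: eq_bigr => l _; rewrite /= IHv mulrDr.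
Qed.

Lemma tadicZ z F v n : tadic v (fun u => z * F u) n = z * tadic v F n.
Proof.
elim: v F n => [|k v IHv] F n /=; first by rewrite mulrCA.
by rewrite mulr_sumr; apply: eq_bigr => l _; rewrite /= IHv mulrCA.
Qed.

Lemma tadic_sum (I : Type) (r : seq I) (F : I -> seq nat -> K) v n :
  tadic v (fun u => \sum_(i <- r) F i u) n = \sum_(i <- r) tadic v (F i) n.
Proof.
elim: r => [|i r IHr].
  rewrite big_nil (@eq_tadic _ (fun u => 0 * 0)) ?tadicZ ?mul0r // => u.
  by rewrite big_nil ?mul0r.
rewrite big_cons -IHr -tadicD; apply: eq_tadic => u; exact: big_cons.
Qed.

(** For positive entries, k + l = 1 forces k = 1 and l = 0: raising the entries creates no new ones,
    and a one that stays carries the binomial coefficient 1. Hence the ones may be stripped before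
    the entries are raised. *)
Lemma tadic_strip g F v n : all (leq 1) v ->
  tadic v (strip1 g F) n =
  \sum_(0 <= j < (size v).+1) (all (pred1 1%N) (take j v))%:R * g j * tadic (drop j v) F n.
Proof.
elim: v g F n => [|k v IHv] g F n /=.
  by rewrite big_nat1 addr0 mul1r mulrCA.
case/andP=> k0 v0; rewrite big_nat_recl //= mul1r mulr_sumr.
under eq_bigr do rewrite tadicD tadicZ mulrDr mulrCA.
rewrite big_split /=; congr (_ + _).
rewrite big_ord_recl big1 ?addr0 => [|l _]; last first.
  rewrite lift0 (_ : (_ == 1)%N = false); last lia.
  by rewrite tadicZ mulr0n mul0r mulr0.
rewrite bin0 mul1r subn0 addn0 tadicZ; case: eqP => [_|_]; last first.
  by rewrite mul0r big1 // => i _; rewrite !mul0r.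
by rewrite mul1r (IHv (fun j => g j.+1)).
Qed.

(* Indices are reversed throughout: F u stands for the value at [rev u], so that
   leading ones are the divergent ones. *)
Definition symm_sum F k (n : nat) : K :=
  \sum_(0 <= i < (size k).+1)
    (-1) ^+ sumn (drop i k) * F (rev (take i k)) * tadic (drop i k) F n.

Lemma eq_symm_sum F G k (n : nat) : F =1 G -> symm_sum F k n = symm_sum G k n.
Proof. by move=> e; apply: eq_bigr => i _; rewrite e (eq_tadic _ _ e). Qed.

Lemma triangular_exchange_leq (f : nat -> nat -> K) a N :
  \sum_(a <= b < N) \sum_(b <= c < N) f b c =
  \sum_(a <= c < N) \sum_(a <= b < c.+1) f b c.
Proof.
under eq_big_nat => b /andP[ab _].
  rewrite (@big_nat_widenl _ _ _ b a) //= big_mkcond /=; over.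
rewrite exchange_big; apply: eq_big_nat => c /andP[ac cN].
by rewrite [RHS](big_nat_widen _ _ N) // [RHS]big_mkcond.
Qed.

Lemma all_ones_join k q p s : (q <= p <= s)%N -> (s <= size k)%N ->
  all (pred1 1%N) (take (s - q) (drop q k)) =
  all (pred1 1%N) (drop q (take p k)) && all (pred1 1%N) (take (s - p) (drop p k)).
Proof.
move=> qps sk; rewrite -all_cat; congr all.
have -> : (s - q = (p - q) + (s - p))%N by lia.
rewrite takeD drop_drop take_drop; congr (_ ++ _).
  by rewrite (_ : (p - q + q = p)%N) //; lia.
by rewrite (_ : (p - q + q = p)%N) //; lia.
Qed.

(** The ones stripped from the reversed prefix and from the suffix are adjacent: they form one block
    at positions q, ..., s - 1, cut at p. Summing over the cut, with the sign (-1)^(s - p) of the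
    right part, gives [sigma g (s - q)], so that [g] enters only through G(x) G(-x). *)
Lemma symm_sum_strip g F k (n : nat) : all (leq 1) k ->
  symm_sum (strip1 g F) k n =
  \sum_(0 <= s < (size k).+1) \sum_(0 <= q < s.+1)
    (all (pred1 1%N) (take (s - q) (drop q k)))%:R * sigma g (s - q) *
    ((-1) ^+ sumn (drop s k) * F (rev (take q k)) * tadic (drop s k) F n).
Proof.
move=> k1; rewrite /symm_sum.
have left p : (p <= size k)%N -> strip1 g F (rev (take p k)) =
    \sum_(0 <= q < p.+1) (all (pred1 1%N) (drop q (take p k)))%:R * g (p - q)%N *
      F (rev (take q k)).
  move=> pk; rewrite strip1E size_rev size_takel // big_nat_rev /=.
  apply: eq_big_nat => q /andP[_ qp]; rewrite add0n subSS.
  have qp' : (q <= p)%N by [].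
  rewrite take_rev all_rev drop_rev size_takel // subKn //.
  by rewrite take_takel.
have right p : (p <= size k)%N -> tadic (drop p k) (strip1 g F) n =
    \sum_(p <= s < (size k).+1) (all (pred1 1%N) (take (s - p) (drop p k)))%:R *
      g (s - p)%N * tadic (drop s k) F n.
  move=> pk; rewrite tadic_strip; last first.
    by apply/allP => x /mem_drop xk; apply: (allP k1).
  rewrite size_drop -[X in _ = \sum_(X <= _ < _) _]add0n big_addn subSn //; apply: eq_bigr => s _.
  by rewrite addnK drop_drop.
under eq_big_nat => p /andP[_ pk].
  rewrite left // right // mulr_sumr.
  under eq_bigr do rewrite mulr_sumr mulr_suml; over.
rewrite triangular_exchange_leq; apply: eq_big_nat => s /andP[_ sk].
rewrite -triangular_exchange_leq; apply: eq_big_nat => q /andP[_ qs].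
have -> : sigma g (s - q) =
    \sum_(q <= p < s.+1) g (p - q)%N * ((-1) ^+ (s - p) * g (s - p)%N).
  rewrite /sigma /convol -[X in _ = \sum_(X <= _ < _) _]add0n big_addn subSn // big_mkord.
  by apply: eq_bigr => i _; rewrite addnK subnDA subnAC.
rewrite mulr_sumr mulr_suml; apply: eq_big_nat => p /andP[qp ps].
rewrite (@all_ones_join k q p s) ?qp //.
have [A|] := boolP (all (pred1 1%N) (take (s - p) (drop p k))); last first.
  by rewrite andbF !(mulr0n, mul0r, mulr0).
have -> : sumn (drop p k) = (s - p + sumn (drop s k))%N.
  rewrite -[drop p k](cat_take_drop (s - p)) sumn_cat drop_drop subnK //.
  by rewrite (all_pred1P _ _ A) sumn_nseq mul1n size_takel // size_drop leq_sub2r.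
by rewrite exprD andbT mulr1n; ring.
Qed.

End Strip.

(** * Cyclic sums over an abstract family of points *)

Lemma rot_cyc_rest (k : seq nat) i : (i < size k)%N ->
  rot i k = nth 0%N k i :: cyc_rest k i.
Proof. by move=> ik; rewrite /rot (drop_nth 0%N ik). Qed.

Lemma rotS_cyc_rest (k : seq nat) i : (i < size k)%N ->
  rot i.+1 k = rcons (cyc_rest k i) (nth 0%N k i).
Proof. by move=> ik; rewrite /rot (take_nth 0%N ik) -rcons_cat. Qed.

Lemma sum_rotS (K : nmodType) (k : seq nat) (F : seq nat -> K) :
  \sum_(i < size k) F (rot i.+1 k) = \sum_(i < size k) F (rot i k).
Proof.
rewrite -!(big_mkord xpredT (fun i => F (rot i k))) -(big_mkord xpredT (fun i => F (rot i.+1 k))).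
case sk: (size k) => [|m]; first by rewrite !big_nil.
rewrite big_nat_recr //= big_nat_recl //= addrC rot0 -sk rot_size.
by [].
Qed.

Section CyclicSum.
Variables (K : comNzRingType) (X Y : nat -> K) (D err : nat -> nat -> K) (t : K).
Variables (L n : nat).
(** For points x_a, read [X a] as 1/x_a, [D a c] as 1/(x_c - x_a) and [Y a] as 1/(x_a - t); [Y_eq]
    is a geometric series, cut off because t^(n+1) = 0 in the application. In [bracket], b is the
    first index of a chain and b' is one more than its last. *)
Hypothesis D_eq : forall a c, (a < c < L)%N -> X a * X c = (X a - X c) * D a c.
Hypothesis Y_eq : forall a, (a < L)%N -> Y a = \sum_(j < n.+1) t ^+ j * X a ^+ j.+1.
Hypothesis bracket : forall b b', (b < b' <= L)%N ->
  \sum_(b' <= c < L) D b c - \sum_(0 <= a < b) D a b'.-1 =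
  \sum_(0 <= a < b.+1) Y a + \sum_(b'.-1 <= c < L) X c + err b b'.

Local Notation Q ks := (lnest X L ks (fun=> 1) 0).

Definition lnest2 (w : seq nat) (phi : nat -> nat -> K) : K :=
  if w is w1 :: w' then \sum_(0 <= b < L) X b ^+ w1 * lnest X L w' (phi b) b.+1 else 0.

Lemma eq_lnest_bounded ks psi phi a : (a <= L)%N ->
  (forall b, (a <= b <= L)%N -> psi b = phi b) ->
  lnest X L ks psi a = lnest X L ks phi a.
Proof.
elim: ks a => [|k ks IHks] a aL e /=; first by rewrite e // leqnn.
apply: eq_big_nat => b /andP[ab bL]; rewrite IHks // => c /andP[bc cL].
by rewrite e // cL andbT; lia.
Qed.

Lemma partial_fraction k a c : (a < c < L)%N ->
  \sum_(j < k) X a ^+ j.+1 * X c ^+ (k - j) = (X a ^+ k - X c ^+ k) * D a c.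
Proof.
move=> acL; rewrite subrXX mulrAC -D_eq // mulr_sumr.
rewrite (reindex_inj rev_ord_inj); apply: eq_bigr => -[j jk] _ /=.
by rewrite subKn // (_ : (k.-1 - j = k - j.+1)%N) ?exprS; [ring|lia].
Qed.

(** Partial fractions in the first point a and the last point c leave the exponent k on only one of
    them. If a keeps it, c becomes a free point beyond the chain [k :: R]; if c keeps it, a becomes
    a free point before the chain [rcons R k], whose last index is [b'.-1]. *)
Lemma sum_split_block k R :
  \sum_(j < k) Q ((j.+1 :: R) ++ [:: (k - j)%N]) =
  lnest2 (k :: R) (fun b b' => \sum_(b' <= c < L) D b c) -
  lnest2 (rcons R k) (fun b b' => \sum_(0 <= a < b) D a b'.-1).
Proof.
have -> : lnest2 (rcons R k) (fun b b' => \sum_(0 <= a < b) D a b'.-1) =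
    \sum_(0 <= a < L) lnest X L (rcons R k) (fun b' => D a b'.-1) a.+1.
  case: (rcons R k) (size_rcons R k) => //= w1 w' _.
  rewrite triangular_exchange; apply: eq_big_nat => b _.
  by rewrite lnest_sum mulr_sumr.
rewrite /lnest2 -sumrB.
under eq_bigr do rewrite cats1 /=.
rewrite exchange_big; apply: eq_big_nat => a /andP[_ aL] /=.
rewrite -lnestZ lnest_rcons -[X in _ - X]mul1r -mulNr -lnestZ -lnestD.
under eq_bigr do rewrite lnest_rcons -lnestZ.
rewrite -lnest_sum; apply: eq_lnest_bounded => // b /andP[ab bL] /=.
under eq_bigr do rewrite mulr_sumr.
rewrite exchange_big /= !mulr_sumr -big_split /=.
apply: eq_big_nat => c /andP[bc cL].
under eq_bigr do rewrite mulr1.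
by rewrite partial_fraction; [ring|lia].
Qed.

Lemma lnest2D w phi psi :
  lnest2 w (fun b b' => phi b b' + psi b b') = lnest2 w phi + lnest2 w psi.
Proof.
case: w => [|w1 w] /=; first by rewrite addr0.
by rewrite -big_split; apply: eq_bigr => b _; rewrite lnestD mulrDr.
Qed.

Lemma lnest2N w phi : lnest2 w (fun b b' => - phi b b') = - lnest2 w phi.
Proof.
case: w => [|w1 w] /=; first by rewrite oppr0.
by rewrite -sumrN; apply: eq_bigr => b _; rewrite lnestN mulrN.
Qed.

Lemma eq_lnest2 w phi psi : (forall b b', (b < b' <= L)%N -> phi b b' = psi b b') ->
  lnest2 w phi = lnest2 w psi.
Proof.
move=> e; case: w => //= w1 w; apply: eq_big_nat => b /andP[_ bL].
by congr (_ * _); apply: eq_lnest_bounded => // b1 bb; apply: e.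
Qed.

(** The free point c lies beyond the last index and adds an entry 1, or equals it and raises its
    exponent. *)
Lemma lnest2_tail w k :
  lnest2 (rcons w k) (fun b b' => \sum_(b'.-1 <= c < L) X c) =
  Q (rcons (rcons w k) 1) + Q (rcons w k.+1).
Proof.
have -> psi : lnest2 (rcons w k) (fun=> psi) = lnest X L (rcons w k) psi 0.
  by case: w.
rewrite !lnest_rcons -lnestD; apply: eq_lnest_bounded => // b _.
rewrite -big_split; apply: eq_big_nat => c /andP[_ cL] /=.
under [in RHS]eq_bigr do rewrite expr1 mulr1.
by rewrite big_ltn // exprSr; ring.
Qed.

(** The free point a lies before the first index and adds an entry, or equals it and raises its
    exponent; [Y_eq] expands it in powers of t. *)
Lemma lnest2_head w1 w :
  lnest2 (w1 :: w) (fun b b' => \sum_(0 <= a < b.+1) Y a) =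
  \sum_(j < n.+1) t ^+ j * (Q (j.+1 :: w1 :: w) + Q ((w1 + j + 1)%N :: w)).
Proof.
have -> : lnest2 (w1 :: w) (fun b b' => \sum_(0 <= a < b.+1) Y a) =
    \sum_(0 <= b < L) (\sum_(0 <= a < b) Y a * (X b ^+ w1 * lnest X L w (fun=> 1) b.+1) +
      Y b * (X b ^+ w1 * lnest X L w (fun=> 1) b.+1)).
  apply: eq_big_nat => b _; rewrite lnest_const big_nat_recr //= -mulr_suml; ring.
rewrite big_split /= -(triangular_exchange (fun a b => Y a * _)).
under [X in X + _]eq_bigr do rewrite -mulr_sumr.
rewrite -big_split /=.
under [RHS]eq_bigr do rewrite mulrDr !mulr_sumr -big_split /=.
rewrite exchange_big; apply: eq_big_nat => a /andP[_ aL] /=.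
rewrite -mulrDr Y_eq // mulr_suml; apply: eq_bigr => j _.
by rewrite !exprD expr1 exprS; ring.
Qed.

(** The second half of [sum_split_block] at i belongs to the rotation by i + 1, the first half to
    the rotation by i. Summed over all i, both can be taken at the same rotation, where their
    difference is the left side of [bracket]. *)
Lemma cyclic_sum k : all (leq 1) k ->
  \sum_(i < size k) \sum_(j < (nth 0%N k i).-1)
    Q ((j.+1 :: cyc_rest k i) ++ [:: (nth 0%N k i - j)%N]) =
  \sum_(i < size k) \sum_(j < n.+1) t ^+ j *
    (Q ((nth 0%N k i + j + 1)%N :: cyc_rest k i) +
     Q ((j.+1 :: cyc_rest k i) ++ [:: nth 0%N k i])) +
  \sum_(i < size k) Q (cyc_rest k i ++ [:: (nth 0%N k i).+1]) +
  \sum_(i < size k) lnest2 (rot i k) err.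
Proof.
move=> k1.
pose F w := lnest2 w (fun b b' => \sum_(0 <= a < b) D a b'.-1).
pose G w := Q (rcons w 1).
pose H w := \sum_(j < n.+1) t ^+ j * Q (j.+1 :: w).
(* Partial fractions need j up to k_i - 1, one more than the claim. The extra term is [rot i k]
   followed by 1, that is [G (rot i k)], and it cancels against the entry 1 added by
   [lnest2_tail]. *)
suff : \sum_(i < size k) (\sum_(j < nth 0%N k i)
    Q ((j.+1 :: cyc_rest k i) ++ [:: (nth 0%N k i - j)%N]) + F (rot i.+1 k)
    - F (rot i k)) =
    \sum_(i < size k) (\sum_(j < n.+1) t ^+ j * Q ((nth 0%N k i + j + 1)%N :: cyc_rest k i)
      + H (rot i k) + (Q (cyc_rest k i ++ [:: (nth 0%N k i).+1]) + G (rot i.+1 k)) +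
      lnest2 (rot i k) err).
  rewrite sumrB !big_split /= !sum_rotS addrK -[\sum_(i < _) H _]sum_rotS => e.
  apply: (addIr (\sum_(i < size k) G (rot i k))); transitivity (
    \sum_(i < size k) \sum_(j < nth 0%N k i)
    Q ((j.+1 :: cyc_rest k i) ++ [:: (nth 0%N k i - j)%N])).
    rewrite -big_split; apply: eq_bigr => i _ /=.
    have ki : (0 < nth 0%N k i)%N by apply: (allP k1); rewrite mem_nth.
    rewrite -[in RHS](prednK ki) big_ord_recr /= prednK // rot_cyc_rest //.
    rewrite /G -cats1 /= (_ : (nth 0%N k i - (nth 0%N k i).-1 = 1)%N) ?prednK //; lia.
  rewrite e [in RHS](eq_bigr (fun i : 'I__ => \sum_(j < n.+1) t ^+ j *
      Q ((nth 0%N k i + j + 1)%N :: cyc_rest k i) + H (rot i.+1 k))); last first.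
    move=> i _; rewrite rotS_cyc_rest // /H -big_split.
    by apply: eq_bigr => j _; rewrite /= -mulrDr -cats1.
  by rewrite big_split /=; ring.
have tail : \sum_(i < size k) lnest2 (rot i k) (fun b b' => \sum_(b'.-1 <= c < L) X c) =
    \sum_(i < size k) (Q (cyc_rest k i ++ [:: (nth 0%N k i).+1]) + G (rot i.+1 k)).
  rewrite -(sum_rotS k (fun w => lnest2 w (fun b b' => \sum_(b'.-1 <= c < L) X c))); apply: eq_bigr => i _.
  by rewrite rotS_cyc_rest // lnest2_tail addrC cats1.
have body : \sum_(i < size k) (lnest2 (rot i k)
      (fun b b' => \sum_(b' <= c < L) D b c) - F (rot i k)) =
    \sum_(i < size k) (\sum_(j < n.+1) t ^+ j * Q ((nth 0%N k i + j + 1)%N :: cyc_rest k i)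
      + H (rot i k) + lnest2 (rot i k) (fun b b' => \sum_(b'.-1 <= c < L) X c) +
      lnest2 (rot i k) err).
  apply: eq_bigr => i _; rewrite /F -lnest2N -lnest2D.
  rewrite (eq_lnest2 _ bracket) !lnest2D; congr (_ + _ + _).
  rewrite rot_cyc_rest // lnest2_head /H -big_split; apply: eq_bigr => j _ /=.
  by rewrite mulrDr addrC.
rewrite [RHS]big_split [in RHS]big_split /= -tail.
rewrite !big_split /= in body *; rewrite -body.
congr (_ + _); rewrite -big_split /=; apply: eq_bigr => i _.
by rewrite sum_split_block rotS_cyc_rest // rot_cyc_rest // subrK.
Qed.

End CyclicSum.

(** * The points 1, ..., N, t - N, ..., t - 1 *)

Section TwoSidedPoints.
Variables (K : comNzRingType) (S V : nat -> K) (t : K) (N n : nat).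
Hypothesis S_inv : forall m, (0 < m)%N -> S m * m%:R = 1.
Hypothesis V_inv : forall m, (0 < m)%N -> V m * (m%:R - t) = 1.
Hypothesis t_nil : t ^+ n.+1 = 0.

(* The points are 1, ..., N followed by t - N, ..., t - 1, and [ptX], [ptD] and
   [ptY] are the inverses of the points, of their differences, and of their
   translates by -t. *)
Definition pt a : K := if (a < N)%N then a.+1%:R else t - (2 * N - a)%:R.
Definition ptX a : K := if (a < N)%N then S a.+1 else - V (2 * N - a)%N.
Definition ptY a : K := if (a < N)%N then V a.+1 else - S (2 * N - a)%N.
Definition ptD a c : K :=
  if (c < N)%N || (N <= a)%N then S (c - a)%N else - V (2 * N + a.+1 - c)%N.

Lemma ptX_inv a : (a < 2 * N)%N -> ptX a * pt a = 1.
Proof.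
rewrite /ptX /pt => aN; case: ltnP => Na; first exact: S_inv.
by rewrite mulNr -mulrN opprB V_inv // subn_gt0.
Qed.

Lemma ptY_inv a : (a < 2 * N)%N -> ptY a * (pt a - t) = 1.
Proof.
rewrite /ptY /pt => aN; case: ltnP => Na; first by rewrite V_inv.
by rewrite addrAC subrr sub0r mulrNN S_inv // subn_gt0.
Qed.

Lemma ptD_inv a c : (a < c < 2 * N)%N -> ptD a c * (pt c - pt a) = 1.
Proof.
rewrite /ptD /pt => /andP[ac cN].
have [cltN|Nc] := ltnP c N.
  rewrite (ltn_trans ac cltN) /= -[RHS](S_inv (m := c - a)) ?subn_gt0 //.
  by rewrite natrB 1?ltnW // -!natr1; ring.
have [aN|Na] /= := ltnP a N.
  rewrite -[RHS](V_inv (m := 2 * N + a.+1 - c)); last lia.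
  by rewrite !natrB ?natrD -?natr1; [ring|lia|lia].
rewrite -[RHS](S_inv (m := c - a)) ?subn_gt0 //.
by rewrite !natrB; [ring|lia|lia|lia].
Qed.

Lemma ptD_eq a c : (a < c < 2 * N)%N -> ptX a * ptX c = (ptX a - ptX c) * ptD a c.
Proof.
move=> acN; have [aN cN] : (a < 2 * N)%N /\ (c < 2 * N)%N by lia.
transitivity ((ptX a * (ptX c * pt c) - ptX c * (ptX a * pt a)) * ptD a c).
  rewrite -[LHS]mulr1 -[X in _ * X](ptD_inv acN); ring.
by rewrite !ptX_inv // !mulr1.
Qed.

Lemma ptY_eq a : (a < 2 * N)%N -> ptY a = \sum_(j < n.+1) t ^+ j * ptX a ^+ j.+1.
Proof.
move=> aN; set s := \sum_(j < _) _.
have sE : s = ptX a * \sum_(j < n.+1) (t * ptX a) ^+ j.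
  by rewrite mulr_sumr; apply: eq_bigr => j _; rewrite exprMn exprS; ring.
have e : (pt a - t) * s = 1.
  rewrite sE mulrA mulrBl [pt a * _]mulrC ptX_inv //.
  rewrite -opprB mulNr -subrX1 exprMn t_nil mul0r sub0r opprK //.
by rewrite -[LHS]mulr1 -[X in _ * X]e mulrA ptY_inv // mul1r.
Qed.

Definition preS i : K := \sum_(0 <= m < i) S m.+1.
Definition preV i : K := \sum_(0 <= m < i) V m.+1.

(** Together with [pre_unshift] and [pre_reflect], this turns every sum in [pt_bracket] into prefix
    sums, which [ring] then compares. *)
Lemma pre_shift (f : nat -> K) p q b : (p <= q)%N ->
  \sum_(p <= c < q) f (c + b).+1 =
  \sum_(0 <= m < q + b) f m.+1 - \sum_(0 <= m < p + b) f m.+1.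
Proof.
move=> pq; rewrite (@big_cat_nat _ _ _ (p + b) 0 (q + b)) ?leq_add2r //= addrAC subrr add0r.
by rewrite big_addn addnK.
Qed.

Lemma pre_unshift (f : nat -> K) p q b : (b < p <= q)%N ->
  \sum_(p <= c < q) f (c - b)%N =
  \sum_(0 <= m < q - b.+1) f m.+1 - \sum_(0 <= m < p - b.+1) f m.+1.
Proof.
move=> /andP[bp pq].
rewrite (@big_cat_nat _ _ _ (p - b.+1) 0 (q - b.+1)) ?leq_sub2r //= addrAC subrr add0r.
rewrite -{1}(subnK bp) big_addn.
by apply: eq_big_nat => c _; congr f; lia.
Qed.

Lemma pre_reflect (f : nat -> K) p q A : (p <= q <= A)%N ->
  \sum_(p <= c < q) f (A - c)%N =
  \sum_(0 <= m < A - p) f m.+1 - \sum_(0 <= m < A - q) f m.+1.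
Proof.
move=> /andP[pq qA].
rewrite (@big_cat_nat _ _ _ (A - q) 0 (A - p)) ?leq_sub2l //= addrAC subrr add0r.
rewrite big_nat_rev /= -{1}[p]add0n big_addn -[X in \sum_(X <= _ < A - p) _]add0n [RHS]big_addn.
have -> : (A - p - (A - q) = q - p)%N by lia.
by apply: eq_big_nat => c cq; congr f; lia.
Qed.

(** The sum of 1/m over N - nu < m <= N plus that of 1/(m - t) over N < m <= N + nu: the discrepancy
    at the cut-off between prefix sums translated by [nu]. *)
Definition boundary nu : K := preS N - preS (N - nu) + preV (N + nu) - preV N.

(** A chain that meets both halves leaves no error. Within one half the error depends on the
    smallest m of the chain, which is b + 1 at its first point in the lower half and 2N - b' + 1 at
    its last point in the upper half. *)
Definition ptErr b b' : K :=
  if (b' <= N)%N then - boundary b.+1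
  else if (N <= b)%N then boundary (2 * N - b').+1 else 0.

Lemma pt_bracket b b' : (b < b' <= 2 * N)%N ->
  \sum_(b' <= c < 2 * N) ptD b c - \sum_(0 <= a < b) ptD a b'.-1 =
  \sum_(0 <= a < b.+1) ptY a + \sum_(b'.-1 <= c < 2 * N) ptX c + ptErr b b'.
Proof.
case: b' => // c /andP[bc cN]; rewrite /= /ptErr !ltnS in bc *.
have upX : \sum_(N <= a < 2 * N) ptX a = - preV N.
  rewrite (eq_big_nat _ _ (F2 := fun a => - V (2 * N - a)%N)); last first.
    by move=> a /andP[Na _]; rewrite /ptX ltnNge Na.
  rewrite sumrN pre_reflect; last lia.
  by rewrite subnn big_nil subr0 /preV; congr (- \sum_(_ <= _ < _) _); lia.
have loY i : (i <= N)%N -> \sum_(0 <= a < i) ptY a = preV i.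
  move=> iN; apply: eq_big_nat => a /andP[_ ai].
  by rewrite /ptY (leq_trans ai iN).
have hiX i : (N <= i <= 2 * N)%N -> \sum_(i <= a < 2 * N) ptX a = - preV (2 * N - i).
  move=> /andP[Ni iN].
  rewrite (eq_big_nat _ _ (F2 := fun a => - V (2 * N - a)%N)); last first.
    by move=> a /andP[ia _]; rewrite /ptX ltnNge (leq_trans Ni ia).
  by rewrite sumrN pre_reflect ?iN ?leqnn // subnn big_nil subr0.
have [cltN|Nc] := ltnP c N.
- rewrite loY; last by lia.
  rewrite (@big_cat_nat _ _ _ N c.+1) //=; last lia.
  rewrite [\sum_(c <= _ < _) _](@big_cat_nat _ _ _ N) //=; [|lia|lia].
  rewrite upX.
  rewrite (eq_big_nat _ _ (F2 := fun a => S (a - b)%N)); last first.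
    by move=> a /andP[_ aN]; rewrite /ptD aN.
  rewrite pre_unshift; last lia.
  rewrite [\sum_(N <= _ < _) _](eq_big_nat _ _ (F2 := fun a => - V (2 * N + b.+1 - a)%N)); last first.
    by move=> a /andP[Na _]; rewrite /ptD ltnNge Na /= ifF //; lia.
  rewrite sumrN pre_reflect; last lia.
  rewrite (@eq_big_nat _ _ _ 0 b _ (fun a => S (c - a)%N)); last first.
    by move=> a _; rewrite /ptD cltN.
  rewrite pre_reflect; last lia.
  rewrite [\sum_(c <= _ < _) _](eq_big_nat _ _ (F2 := fun a => S (a + 0).+1)); last first.
    by move=> a /andP[_ aN]; rewrite /ptX aN addn0.
  rewrite pre_shift; last lia.
  rewrite /boundary /preS /preV !addn0 subn0.
  have -> : (c.+1 - b.+1 = c - b)%N by lia.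
  have -> : (2 * N + b.+1 - N = N + b.+1)%N by lia.
  have -> : (2 * N + b.+1 - 2 * N = b.+1)%N by lia.
  by ring.
have [bN|Nb] := ltnP b N.
- rewrite loY // hiX; last lia.
  rewrite (eq_big_nat _ _ (F2 := fun a => - V (2 * N + b.+1 - a)%N)); last first.
    by move=> a ca; rewrite /ptD ifF //; lia.
  rewrite sumrN pre_reflect; last lia.
  rewrite (@eq_big_nat _ _ _ 0 b _ (fun a => - V (a + (2 * N - c)).+1)); last first.
    by move=> a ca; rewrite /ptD ifF; [congr (- V _); lia|lia].
  rewrite sumrN pre_shift // /preV.
  have -> : (2 * N + b.+1 - c.+1 = b + (2 * N - c))%N by lia.
  have -> : (2 * N + b.+1 - 2 * N = b.+1)%N by lia.
  by rewrite add0n; ring.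
rewrite hiX ?Nc 1?ltnW //.
rewrite (@big_cat_nat _ _ _ N 0 b.+1) //= ?loY //; last lia.
rewrite (eq_big_nat _ _ (F2 := fun a => S (a - b)%N)); last first.
  by move=> a ca; rewrite /ptD ifT //; lia.
rewrite pre_unshift; last lia.
rewrite (@big_cat_nat _ _ _ N 0 b) //=.
rewrite (@eq_big_nat _ _ _ 0 N _ (fun a => - V (a + (2 * N - c)).+1)); last first.
  by move=> a ca; rewrite /ptD ifF; [congr (- V _); lia|lia].
rewrite sumrN pre_shift //.
rewrite (@eq_big_nat _ _ _ N b _ (fun a => S (c - a)%N)); last first.
  by move=> a ca; rewrite /ptD ifT //; lia.
rewrite pre_reflect; last lia.
rewrite (@eq_big_nat _ _ _ N b.+1 _ (fun a => - S (2 * N - a)%N)); last first.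
  by move=> a ca; rewrite /ptY ifF //; lia.
rewrite sumrN pre_reflect; last lia.
rewrite /boundary /preS /preV.
have -> : (c.+1 - b.+1 = c - b)%N by lia.
have -> : ((2 * N - c.+1).+1 = 2 * N - c)%N by lia.
have -> : (N - (2 * N - c) = c - N)%N by lia.
have -> : (2 * N - N = N)%N by lia.
by rewrite add0n; ring.
Qed.

End TwoSidedPoints.

(** * The truncated cyclic sum formula *)

Lemma antidiagonal_exchange (K : nmodType) (n : nat) (f : nat -> nat -> K) :
  \sum_(l < n.+1) \sum_(m < (n - l).+1) f l m =
  \sum_(m < n.+1) \sum_(l < (n - m).+1) f l m.
Proof.
have E (g : nat -> nat -> K) : \sum_(l < n.+1) \sum_(m < (n - l).+1) g l m =
    \sum_(l < n.+1) \sum_(m < n.+1 | (l + m <= n)%N) g l m.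
  apply: eq_bigr => -[l ln] _ /=.
  rewrite (big_ord_widen n.+1 (g l)) ?ltnS ?leq_subr //.
  by apply: eq_bigl => m; rewrite ltnS leq_subRL.
rewrite E (E (fun m l => f l m)) (exchange_big_dep xpredT) //=.
by apply: eq_bigr => m _; apply: eq_bigl => l; rewrite addnC.
Qed.

(** * Expansion of the nested sums in powers of t *)

Section TruncatedGeometric.
Import Pdiv.Ring Pdiv.RingMonic.
Variable R : numFieldType.
Implicit Types (n m l k : nat).

Definition inv_succ (c : nat) : R := c.+1%:R^-1.
Local Notation recip := inv_succ.

(** The expansion of 1/(m + 1 - t) up to t^n; position m stands for the integer m + 1 throughout. *)
Definition geom n m : {poly R} := \poly_(l < n.+1) recip m ^+ l.+1.

Lemma hockey_stick k l : (\sum_(j < l.+1) 'C(k + j - 1, j) = 'C(k + l, l))%N.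
Proof.
elim: l => [|l IHl]; first by rewrite big_ord1 !bin0.
by rewrite big_ord_recr /= IHl addnS subn1 /= binS addnC.
Qed.

(** The expansion of (m + 1 - t)^(-k), the source of the binomial coefficients in the symmetric
    values. One more factor sums them along a diagonal, hence [hockey_stick]. *)
Lemma coef_geomX n m k l : (l <= n)%N ->
  (geom n m ^+ k)`_l = 'C(k + l - 1, l)%:R * recip m ^+ (k + l).
Proof.
elim: k l => [|k IHk] l ln.
  rewrite expr0 coef1 add0n; case: l ln => [|l] _; first by rewrite bin0 mulr1.
  by rewrite bin_small ?mul0r //; lia.
rewrite exprS coefM.
transitivity (\sum_(j < l.+1) 'C(k + j - 1, j)%:R * recip m ^+ (k.+1 + l)).
  rewrite (reindex_inj rev_ord_inj); apply: eq_bigr => -[j jl] _ /=.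
  rewrite subSS subKn // coef_poly IHk; last by lia.
  rewrite ifT; last by lia.
  rewrite mulrCA -exprD; congr (_ * _ ^+ _); lia.
by rewrite -mulr_suml -natr_sum hockey_stick addSn subn1.
Qed.

Lemma coef_rnest_geom n i N v (psi : nat -> {poly R}) : (i <= n)%N ->
  (rnest (geom n) N v psi)`_i =
  \sum_(l < i.+1) tadic v (fun u => rnest recip N u (fun c => (psi c)`_l)) (i - l).
Proof.
elim: v N i => [|k v IHv] N i ni /=.
  rewrite big_ord_recr /= subnn mul1r big1 ?add0r // => -[l li] _ /=.
  by rewrite subn_eq0 leqNgt li mul0r.
rewrite coef_sum.
pose f c l m := 'C(k + l - 1, l)%:R * recip c ^+ (k + l) *
  tadic v (fun u => rnest recip c u (fun d => (psi d)`_m)) (i - l - m).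
transitivity (\sum_(0 <= c < N) \sum_(m < i.+1) \sum_(l < (i - m).+1) f c l m).
  apply: eq_bigr => c _; rewrite coefM -(antidiagonal_exchange i (f c)).
  apply: eq_bigr => l _.
  rewrite coef_geomX; last by rewrite (leq_trans _ ni) // -ltnS.
  by rewrite IHv ?mulr_sumr // (leq_trans (leq_subr _ _)).
rewrite exchange_big; apply: eq_bigr => m _.
rewrite exchange_big; apply: eq_bigr => l _ /=.
rewrite tadic_sum mulr_sumr; apply: eq_bigr => c _.
by rewrite tadicZ mulrA /f subnAC.
Qed.

Lemma coef_in_qpoly n (p : {poly R}) i : (i <= n)%N ->
  (in_qpoly ('X^(n.+1)) p : {poly R})`_i = p`_i.
Proof.
move=> ni; rewrite /= mk_monic_Xn /=.
rewrite -{1}(poly_take_drop n.+1 p) addrC rmodp_addl_mul_small ?monicXn //.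
  by rewrite coef_take_poly ltnS ni.
by rewrite size_polyXn ltnS size_take_poly.
Qed.

Section Instance.
Variables (n N : nat).

Local Notation K := {poly %/ ('X^(n.+1) : {poly R})}.
Local Notation phi := (in_qpoly ('X^(n.+1) : {poly R})).

Definition qS (m : nat) : K := phi (m%:R^-1)%:P.
Definition qV (m : nat) : K := phi (geom n m.-1).
Definition qt : K := phi 'X.

Lemma phi_nat m : phi m%:R = m%:R.
Proof. exact: rmorph_nat. Qed.

Lemma qS_inv m : (0 < m)%N -> qS m * m%:R = 1.
Proof.
move=> m0; rewrite -phi_nat -rmorphM /= -polyC_natr -polyCM mulVf ?rmorph1 //.
by rewrite pnatr_eq0 -lt0n.
Qed.

Lemma qt_nil : qt ^+ n.+1 = 0.
Proof.
rewrite -rmorphXn /=; apply/val_inj => /=.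
by rewrite mk_monic_Xn rmodpp // monicXn.
Qed.

Lemma qV_inv m : (0 < m)%N -> qV m * (m%:R - qt) = 1.
Proof.
case: m => // m _; rewrite -phi_nat -rmorphB -rmorphM /=.
have -> : geom n m * (m.+1%:R - 'X) = 1 - (recip m ^+ n.+1)%:P * 'X^(n.+1).
  rewrite -polyC_natr mulrBr; apply/polyP => i.
  rewrite !coefB coefMC coefMX coef1 coefCM coefXn !coef_poly.
  have rm : recip m * m.+1%:R = 1 by rewrite mulVf // pnatr_eq0.
  case: i => [|i] /=; first by rewrite expr1 rm mulr0 !subr0.
  rewrite !ltnS eqSS; case: ltngtP => [ni|ni|->]; last 2 first.
  - by rewrite mul0r mulr0 !subr0.
  - by rewrite mul0r mulr1.
  by rewrite exprSr -mulrA rm mulr1 subrr mulr0 subr0.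
have Xn0 : phi 'X^(n.+1) = 0 by rewrite rmorphXn; exact: qt_nil.
by rewrite rmorphB rmorphM /= Xn0 mulr0 subr0 rmorph1.
Qed.

Definition zetaN u : R := rnest recip N u (fun=> 1).

(** The coefficient of t^l in [boundary]; the part made of the 1/m is constant in t. *)
Definition boundary_coef l nu : R :=
  (l == 0)%N%:R * (\sum_(N - nu <= m < N) recip m) +
  \sum_(N <= m < N + nu) recip m ^+ l.+1.

Local Notation X := (ptX qS qV N).
Local Notation Q ks := (lnest X (2 * N) ks (fun=> 1) 0).

Lemma lower_points c : (c < N)%N -> X c = phi (recip c)%:P.
Proof. by rewrite /ptX => ->. Qed.

Lemma upper_points c : (c < N)%N -> X ((2 * N).-1 - c)%N = - phi (geom n c).
Proof.
move=> cN; rewrite /ptX ifF; last by lia.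
by rewrite /qV (_ : (2 * N - ((2 * N).-1 - c) = c.+1)%N) //; lia.
Qed.

Lemma lnest_lower (k : seq nat) (psi : nat -> {poly R}) a :
  lnest X N k (phi \o psi) a = phi (lnest (polyC \o recip) N k psi a).
Proof.
rewrite lnest_morph; apply: eq_lnest => // b /andP[_ bN].
exact: lower_points.
Qed.

Lemma lnest_upper (k : seq nat) (psi : nat -> {poly R}) :
  lnest X (2 * N) k (fun b => phi (psi (2 * N - b)%N)) N =
  phi ((-1) ^+ sumn k * rnest (geom n) N k psi).
Proof.
rewrite lnest_reflect; last by lia.
rewrite (_ : (2 * N - N = N)%N); last by lia.
rewrite -rnest_oppX rnest_morph; apply: eq_rnest => c cN /=.
  by rewrite upper_points // rmorphN.
by rewrite subKn //; lia.
Qed.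

(** Indices in the lower half contribute constants; those in the upper half contribute the
    expansions [geom], with sign and in reversed order. So the nested sums over the 2N points are
    the truncated symmetric values. *)
Lemma coef_Q (k : seq nat) i : (i <= n)%N -> (Q k : {poly R})`_i = symm_sum zetaN k i.
Proof.
move=> ni; rewrite (@lnest_deconcat _ _ N); last by lia.
rewrite raddf_sum coef_sum /symm_sum big_mkord; apply: eq_bigr => j _.
have -> : lnest X N (take j k) (fun=> 1) 0 = phi (zetaN (rev (take j k)))%:P.
  transitivity (lnest X N (take j k) (phi \o (fun=> 1)) 0).
    by apply: eq_lnest_weight => b /=; rewrite rmorph1.
  rewrite lnest_lower /zetaN rnest_rev1; congr (phi _).
  by rewrite -[in RHS]/(polyC _) lnest_morph; apply: eq_lnest_weight => b /=; rewrite rmorph1.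
have -> : lnest X (2 * N) (drop j k) (fun=> 1) N =
    phi ((-1) ^+ sumn (drop j k) * rnest (geom n) N (drop j k) (fun=> 1)).
  by rewrite -lnest_upper; apply: eq_lnest_weight => b; rewrite rmorph1.
rewrite -rmorphM coef_in_qpoly //.
have -> : (-1) ^+ sumn (drop j k) = ((-1) ^+ sumn (drop j k))%:P :> {poly R}.
  by rewrite polyC_exp polyCN polyC1.
rewrite coefCM coefCM mulrCA mulrA; congr (_ * _).
rewrite coef_rnest_geom // big_ord_recl big1 ?addr0 => [|l _].
  by rewrite subn0; apply: eq_tadic => u; apply: eq_rnest => // c _; rewrite coef1.
transitivity (tadic (drop j k) (fun=> 0 * 0) (i - lift ord0 l) : R).
  apply: eq_tadic => u; transitivity (rnest recip N u (fun=> 0 * 0) : R).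
    by apply: eq_rnest => // c _; rewrite coef1 mul0r.
  by rewrite rnestZ !mul0r.
by rewrite tadicZ mul0r.
Qed.

Definition boundary_sum (w : seq nat) (m : nat) : R :=
  (-1) ^+ sumn w *
    \sum_(l < m.+1) tadic w (fun u => rnest recip N u (fun c => boundary_coef l c.+1)) (m - l)
  - rnest recip N (rev w) (fun c => boundary_coef m c.+1).

Lemma coef_preS i : preS qS i = phi (\sum_(0 <= m < i) recip m)%:P.
Proof. by rewrite /preS !rmorph_sum. Qed.

Lemma coef_preV i : preV qV i = phi (\sum_(0 <= m < i) geom n m).
Proof. by rewrite /preV rmorph_sum. Qed.

Definition boundary_poly nu : {poly R} :=
  (\sum_(N - nu <= m < N) recip m)%:P + \sum_(N <= m < N + nu) geom n m.

Lemma boundaryE nu : boundary qS qV N nu = phi (boundary_poly nu).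
Proof.
rewrite /boundary !coef_preS !coef_preV -!rmorphB -rmorphD -rmorphB; congr (phi _).
rewrite /boundary_poly (@big_cat_nat _ _ _ (N - nu) 0 N) ?leq_subr //=.
rewrite [\sum_(0 <= _ < N + nu) _](@big_cat_nat _ _ _ N) ?leq_addr //= polyCD.
by ring.
Qed.

Lemma coef_boundary_poly l nu : (l <= n)%N -> (boundary_poly nu)`_l = boundary_coef l nu.
Proof.
move=> ln; rewrite coefD coefC coef_sum /boundary_coef; congr (_ + _).
  by case: eqP; rewrite (mul1r, mul0r).
by apply: eq_bigr => m _; rewrite coef_poly ltnS ln.
Qed.

(** Only chains within one half carry an error. In both halves its weight is a function of the
    smallest m, which is the argument of the weight in [rnest]. *)
Lemma coef_boundary w i : (i <= n)%N -> w <> [::] ->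
  (lnest2 X (2 * N) w (ptErr qS qV N) : {poly R})`_i = boundary_sum w i.
Proof.
move=> ni; case: w => // k w _ /=.
rewrite (@big_cat_nat _ _ _ N) //=; last by lia.
have -> : \sum_(0 <= b < N) X b ^+ k * lnest X (2 * N) w (ptErr qS qV N b) b.+1 =
    phi (- rnest (polyC \o recip) N (rev (k :: w)) (fun c => boundary_poly c.+1)).
  rewrite rnest_rev -sumrN rmorph_sum; apply: eq_big_nat => b /andP[_ bN].
  rewrite (@lnest_cut _ _ N _ _ _ (- boundary qS qV N b.+1)); first last.
  - by move=> c Nc; rewrite /ptErr leqNgt Nc /= leqNgt bN.
  - by move=> c cN; rewrite /ptErr cN.
  - by lia.
  rewrite lower_points // boundaryE.
  have -> : lnest X N w (fun=> 1) b.+1 = phi (lnest (polyC \o recip) N w (fun=> 1) b.+1).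
    by rewrite -lnest_lower; apply: eq_lnest_weight => c; rewrite /= rmorph1.
  by rewrite [RHS]rmorphN !rmorphM rmorphXn mulNr mulrN mulrA.
have -> : \sum_(N <= b < 2 * N) X b ^+ k * lnest X (2 * N) w (ptErr qS qV N b) b.+1 =
    lnest X (2 * N) (k :: w) (fun b => phi (boundary_poly (2 * N - b).+1)) N.
  apply: eq_big_nat => b /andP[Nb _]; congr (_ * _); apply: eq_lnest => // c bc.
  by rewrite /ptErr ifF; [rewrite Nb boundaryE|lia].
rewrite (lnest_upper _ (fun c => boundary_poly c.+1)) coefD !coef_in_qpoly // addrC coefN.
rewrite /boundary_sum; congr (_ - _).
  have -> : (-1) ^+ sumn (k :: w) = ((-1) ^+ sumn (k :: w))%:P :> {poly R}.
    by rewrite polyC_exp polyCN polyC1.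
  rewrite coefCM coef_rnest_geom //; congr (_ * _); apply: eq_bigr => l _.
  apply: eq_tadic => u; apply: eq_rnest => // c _.
  by rewrite coef_boundary_poly // (leq_trans _ ni) // -ltnS.
rewrite rnest_rev coef_sum rnest_rev; apply: eq_bigr => b _.
have -> : lnest (polyC \o recip) N w (fun=> 1) b.+1 = (lnest recip N w (fun=> 1) b.+1)%:P.
  by rewrite lnest_morph; apply: eq_lnest_weight => c; rewrite /= polyC1.
by rewrite coefMC /= -polyC_exp coefCM coef_boundary_poly.
Qed.

End Instance.
End TruncatedGeometric.

Section TruncatedCyclicSum.
Variable R : numFieldType.
Variables (n N : nat).

Local Notation K := {poly %/ ('X^(n.+1) : {poly R})}.

Lemma coef_qtXM j (q : K) : (j <= n)%N ->
  ((qt R n ^+ j * q : K) : {poly R})`_n = (q : {poly R})`_(n - j).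
Proof.
move=> jn; have -> : q = in_qpoly ('X^(n.+1)) (q : {poly R}).
  by apply/val_inj; symmetry; exact: in_qpoly_small (size_mk_monic q).
rewrite /qt -rmorphXn -rmorphM !coef_in_qpoly ?leq_subr //.
by rewrite coefXnM ltnNge jn.
Qed.

Local Notation SZ := (symm_sum (zetaN R N)).

Lemma truncated_cyclic_sum k : all (leq 1) k ->
  \sum_(i < size k) \sum_(j < (nth 0%N k i).-1)
    SZ ((j.+1 :: cyc_rest k i) ++ [:: (nth 0%N k i - j)%N]) n =
  \sum_(i < size k) \sum_(j < n.+1)
    (SZ ((nth 0%N k i + j + 1)%N :: cyc_rest k i) (n - j)%N +
     SZ ((j.+1 :: cyc_rest k i) ++ [:: nth 0%N k i]) (n - j)%N) +
  \sum_(i < size k) SZ (cyc_rest k i ++ [:: (nth 0%N k i).+1]) n +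
  \sum_(i < size k) boundary_sum R N (rot i k) n.
Proof.
move=> k1.
have := cyclic_sum (@ptD_eq _ _ _ _ N (@qS_inv R n) (@qV_inv R n))
  (@ptY_eq _ _ _ _ N n (@qS_inv R n) (@qV_inv R n) (@qt_nil R n))
  (@pt_bracket _ (qS R n) (qV R n) N) k1.
move=> /(congr1 (fun q : K => (q : {poly R})`_n)).
have cD (p q : K) : ((p + q : K) : {poly R})`_n = (p : {poly R})`_n + (q : {poly R})`_n.
  by rewrite raddfD coefD.
have cS (I : finType) (F : I -> K) : ((\sum_i F i : K) : {poly R})`_n = \sum_i (F i : {poly R})`_n.
  by rewrite raddf_sum coef_sum.
rewrite !cD !cS => e; transitivity (\sum_(i < size k) \sum_(j < (nth 0%N k i).-1)
  (lnest (ptX (qS R n) (qV R n) N) (2 * N) ((j.+1 :: cyc_rest k i) ++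
    [:: (nth 0%N k i - j)%N]) (fun=> 1) 0 : {poly R})`_n).
  by apply: eq_bigr => i _; apply: eq_bigr => j _; rewrite coef_Q.
under eq_bigr do rewrite -cS; rewrite e; congr (_ + _ + _); apply: eq_bigr => i _.
- rewrite cS; apply: eq_bigr => j _.
  have jn : (j <= n)%N by rewrite -ltnS.
  by rewrite coef_qtXM // raddfD coefD !coef_Q ?leq_subr.
- by rewrite coef_Q.
- by rewrite coef_boundary //; move/(congr1 size); rewrite size_rot; case: (size k) i => // -[].
Qed.

End TruncatedCyclicSum.

(** * Renormalization of truncated multiple zeta values *)

Section Shift.
Variable K : comNzRingType.
Implicit Types a b g : nat -> K.

Definition shift a (n : nat) : K := if n is m.+1 then a m else 0.

Lemma conv_shiftl a b n : convol (shift a) b n = shift (convol a b) n.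
Proof.
case: n => [|n]; first by rewrite /convol big_ord1 mul0r.
by rewrite /convol big_ord_recl /= mul0r add0r.
Qed.

Lemma conv_shiftr a b n : convol a (shift b) n = shift (convol a b) n.
Proof. by rewrite convC conv_shiftl; case: n => //= n; apply: convC. Qed.

Lemma convDr a b g n : convol g (fun k => a k + b k) n = convol g a n + convol g b n.
Proof. by rewrite convC convDl !(convC g). Qed.

Lemma convZl z a b n : convol (fun k => z * a k) b n = z * convol a b n.
Proof. by rewrite /convol mulr_sumr; apply: eq_bigr => i _; rewrite mulrA. Qed.

Lemma convZr z a b n : convol a (fun k => z * b k) n = z * convol a b n.
Proof. by rewrite convC convZl convC. Qed.

Lemma strip1_ones g (F : seq nat -> K) n core : head 0%N core != 1%N ->
  strip1 g F (nseq n 1%N ++ core) = convol g (fun j => F (nseq j 1%N ++ core)) n.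
Proof.
move=> hc; elim: n g => [|n IHn] g /=; last first.
  by rewrite mul1r IHn /convol [RHS]big_ord_recl.
rewrite /convol big_ord1 /=; case: core hc => [|k core] /= hc; first by rewrite addr0.
by rewrite (negPf hc) mul0r addr0.
Qed.

End Shift.

Definition ones (u : seq nat) : nat := find (predC1 1%N) u.

Lemma ones_split u : u = nseq (ones u) 1%N ++ drop (ones u) u.
Proof. by elim: u => //= k u IHu; case: eqP => //= ->; rewrite {1}IHu. Qed.

Lemma head_drop_ones u : head 0%N (drop (ones u) u) != 1%N.
Proof. by elim: u => //= k u IHu; have [->|k1] := eqVneq k 1%N; rewrite /= ?k1 ?(negPf k1). Qed.

Lemma ones_cat n core : head 0%N core != 1%N -> ones (nseq n 1%N ++ core) = n.
Proof.
move=> hc; rewrite /ones find_cat has_nseq /= andbF size_nseq.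
by case: core hc => [|k core] /= hc; rewrite ?hc addn0.
Qed.

Lemma drop_ones_cat n core : head 0%N core != 1%N ->
  drop (ones (nseq n 1%N ++ core)) (nseq n 1%N ++ core) = core.
Proof. by move=> hc; rewrite ones_cat // drop_size_cat ?size_nseq. Qed.

Section TruncatedZeta.
Variable R : numFieldType.
Implicit Types (n N c m : nat) (u v core : seq nat).
Local Notation recip := (inv_succ R).
Local Notation zetaN := (zetaN R).

Lemma zetaNS N k v : zetaN N.+1 (k :: v) = zetaN N (k :: v) + recip N ^+ k * zetaN N v.
Proof. by rewrite /zetaN /= big_nat_recr. Qed.

Lemma zetaN0 k v : zetaN 0 (k :: v) = 0.
Proof. by rewrite /zetaN /= big_nil. Qed.

Lemma zetaN_cons N k v : zetaN N (k :: v) = \sum_(0 <= c < N) recip c ^+ k * zetaN c v.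
Proof. by []. Qed.

Definition harmonic_sum N : R := \sum_(0 <= c < N) recip c.

(** The complete homogeneous symmetric polynomial of degree n in 1, 1/2, ..., 1/N. *)
Fixpoint hsym n N : R :=
  if n is m.+1 then \sum_(0 <= c < N) recip c * hsym m c.+1 else 1.

Definition elemsym N n : R := zetaN N (nseq n 1%N).

Definition signed_hsym N n : R := (-1) ^+ n * hsym n N.

Lemma elemsymS N n : elemsym N.+1 n = elemsym N n + recip N * shift (elemsym N) n.
Proof. by case: n => [|n]; rewrite /elemsym /= ?mulr0 ?addr0 // zetaNS expr1. Qed.

Lemma signed_hsymS N n :
  signed_hsym N n = signed_hsym N.+1 n + recip N * shift (signed_hsym N.+1) n.
Proof.
case: n => [|n]; rewrite /signed_hsym /= ?mulr0 ?addr0 //.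
by rewrite [in RHS]big_nat_recr //= exprS; ring.
Qed.

(** The generating functions are E_N(x), the product of the 1 + x/m over m <= N, and its inverse. *)
Lemma conv_elemsym_hsym N n : convol (elemsym N) (signed_hsym N) n = (n == 0)%N%:R.
Proof.
elim: N n => [|N IHN] n.
  rewrite /convol big_ord_recl big1 ?addr0 => [|i _]; last first.
    by rewrite /elemsym /= zetaN0 mul0r.
  rewrite /elemsym mul1r subn0 /signed_hsym; case: n => [|n] /=; first by rewrite mulr1.
  by rewrite big_nil mulr0.
rewrite -(IHN n).
rewrite (eq_conv (g' := fun i => elemsym N i + recip N * shift (elemsym N) i) (h' := signed_hsym N.+1)) //; last by move=> i _; apply: elemsymS.
rewrite [RHS](eq_conv (g' := elemsym N) (h' := fun i => signed_hsym N.+1 i + recip N * shift (signed_hsym N.+1) i)) //; last by move=> i _; apply: signed_hsymS.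
by rewrite convDl convDr convZl convZr conv_shiftl conv_shiftr.
Qed.

(* A truncation of the shuffle regularized value at the reversed index
   (1, ..., 1, core) with n ones. *)
Definition core_sum N core n : R :=
  if core is k :: v then
    (-1) ^+ n * \sum_(0 <= c < N) recip c ^+ k * zetaN c v * hsym n c.+1
  else (n == 0)%N%:R.

Definition fhatN N u : R := core_sum N (drop (ones u) u) (ones u).

Lemma core_sumS N k v n : core_sum N.+1 (k :: v) n =
  core_sum N (k :: v) n + recip N ^+ k * zetaN N v * signed_hsym N.+1 n.
Proof. by rewrite /core_sum /signed_hsym big_nat_recr //= mulrDr; ring. Qed.

(** If the largest index of the core is c + 1, the ones above it contribute the elementary symmetric
    sums of the 1/m with c + 1 < m <= N. Their generating function is E_N/E_(c+1), and expanding
    1/E_(c+1) gives the factor [hsym] of [core_sum]. This splits off the divergent factor E_N. *)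
Lemma zetaN_ones N n core :
  zetaN N (nseq n 1%N ++ core) = convol (elemsym N) (core_sum N core) n.
Proof.
case: core => [|k v].
  rewrite cats0 convC /convol big_ord_recl big1 ?addr0 ?mul1r ?subn0 //.
  by move=> i _; rewrite /= mul0r.
elim: N n => [|N IHN] n.
  rewrite /convol big1 => [|i _]; last by rewrite /= big_nil !mulr0.
  by case: n => [|n]; rewrite /= zetaN0.
rewrite (eq_conv (g' := elemsym N.+1) (h' := fun j => core_sum N (k :: v) j +
  recip N ^+ k * zetaN N v * signed_hsym N.+1 j)) //; last by move=> i _; apply: core_sumS.
rewrite convDr convZr conv_elemsym_hsym.
rewrite (eq_conv (g' := fun i => elemsym N i + recip N * shift (elemsym N) i) (h' := core_sum N (k :: v))) //; last by move=> i _; apply: elemsymS.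
rewrite convDl convZl conv_shiftl -IHN.
case: n => [|n] /=; first by rewrite zetaNS; ring.
by rewrite zetaNS -IHN; ring.
Qed.

Lemma zetaN_strip N u : zetaN N u = strip1 (elemsym N) (fhatN N) u.
Proof.
rewrite {1 2}(ones_split u) strip1_ones ?head_drop_ones // zetaN_ones.
apply: eq_conv => // i _; rewrite /fhatN drop_ones_cat ?head_drop_ones //.
by rewrite ones_cat // head_drop_ones.
Qed.

(* The terms of the harmonic product of z_1 and z_(rev u), as reversed indices. *)
Fixpoint hst u : seq (seq nat) :=
  if u is l :: v then [:: 1%N :: l :: v, l.+1 :: v & map (cons l) (hst v)]
  else [:: [:: 1%N]].

Lemma sum_hst_zetaN N u :
  \sum_(a <- hst u) zetaN N a = harmonic_sum N * zetaN N u.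
Proof.
elim: u N => [|l v IHv] N /=.
  by rewrite big_seq1 mulr1; apply: eq_bigr => c _; rewrite expr1 mulr1.
rewrite !big_cons big_map.
have -> : \sum_(j <- hst v) zetaN N (l :: j) =
    \sum_(0 <= c < N) recip c ^+ l * (harmonic_sum c * zetaN c v).
  by rewrite exchange_big; apply: eq_bigr => c _; rewrite /= -mulr_sumr IHv.
have -> : harmonic_sum N * zetaN N (l :: v) =
    \sum_(0 <= c < N) recip c * zetaN c.+1 (l :: v) +
    \sum_(0 <= c < N) recip c ^+ l * (harmonic_sum c * zetaN c v).
  rewrite -big_split; elim: N => [|N IHN]; first by rewrite zetaN0 mulr0 big_nil.
  rewrite big_nat_recr //= -IHN /harmonic_sum big_nat_recr //= zetaNS; ring.
rewrite addrA; congr (_ + _).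
rewrite zetaN_cons [X in _ + X]zetaN_cons -big_split; apply: eq_bigr => c _ /=.
by rewrite zetaNS expr1 exprS; ring.
Qed.

(** On the generating function of [g], the product with z_1 acts as multiplication by H_N plus d/dx;
    the derivative counts the j + 1 places of a new one in a block of j ones. *)
Lemma sum_hst_strip N g u : all (leq 1) u ->
  \sum_(a <- hst u) strip1 g (zetaN N) a =
  strip1 (fun j => harmonic_sum N * g j + j.+1%:R * g j.+1) (zetaN N) u.
Proof.
have split_strip (s : seq (seq nat)) : \sum_(a <- s) strip1 g (zetaN N) a =
    g 0%N * \sum_(a <- s) zetaN N a +
    \sum_(a <- s) (if a is k :: a' then (k == 1)%N%:R * strip1 (fun j => g j.+1) (zetaN N) a' else 0).
  by rewrite mulr_sumr -big_split; apply: eq_bigr => -[].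
elim: u g split_strip => [|l v IHv] g split_strip; rewrite split_strip sum_hst_zetaN.
  by move=> _; rewrite /= big_seq1 /= addr0 mul1r; ring.
case/andP=> l0 v1; rewrite [hst _]/= !big_cons big_map -mulr_sumr IHv // => [|s]; last first.
  by rewrite mulr_sumr -big_split; apply: eq_bigr => -[].
case: l l0 split_strip => [//|[|l]] _ split_strip; last by rewrite /=; ring.
rewrite /= !mul1r mul0r add0r.
rewrite [X in _ = _ + X](eq_strip1 (h := fun j => (harmonic_sum N * g j.+1 + j.+1%:R * g j.+2) + g j.+2) (G := zetaN N)) //; last first.
  by move=> j; rewrite -[j.+2%:R]natr1; ring.
by rewrite !strip1D; ring.
Qed.

(** The coefficients of exp(- x H_N), the solution of G' + H_N G = 0 with constant term 1. By
    [sum_hst_strip] this equation makes products with z_1 vanish, as the harmonic regularization at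
    T = 0 demands. *)
Definition exp_coef N j : R := (- harmonic_sum N) ^+ j / j`!%:R.

Lemma sum_hst_renormalized N u : all (leq 1) u ->
  \sum_(a <- hst u) strip1 (exp_coef N) (zetaN N) a = 0.
Proof.
move=> u1; rewrite sum_hst_strip // (eq_strip1 (h := fun=> 0 * 0) (G := zetaN N)) //; first by rewrite strip1Z mul0r.
move=> j; rewrite mul0r /exp_coef factS natrM exprS.
have j1 : j.+1%:R != 0 :> R by rewrite pnatr_eq0.
have jf : j`!%:R != 0 :> R by rewrite pnatr_eq0 -lt0n fact_gt0.
by field; rewrite jf nat1r j1.
Qed.

(* The coefficients of the generating function of [elemsym N] times
   exp(- x H_N), which converge because H_N only occurs in the first power sum. *)
Definition gammaN N := convol (exp_coef N) (elemsym N).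

Lemma renormalized_strip N u :
  strip1 (exp_coef N) (zetaN N) u = strip1 (gammaN N) (fhatN N) u.
Proof. by rewrite -strip1_comp; apply: eq_strip1 => // v; apply: zetaN_strip. Qed.

Definition power_coef N k : R := if k is j.+1 then (-1) ^+ j * zetaN N [:: k] else 0.

Lemma newton_elemsym N : newton (power_coef N) (elemsym N).
Proof.
elim: N => [|N IHN] n.
  rewrite /convol big1 => [|[[|i] _] _ //=]; last 2 first.
  - by rewrite mul0r.
  - by rewrite zetaN0 mulr0 mul0r.
  by case: n => [|n]; rewrite ?mul0r // /elemsym /= zetaN0 mulr0.
(* This is x times the logarithmic derivative of 1 + x/(N + 1), the factor that leads from E_N to
   E_(N+1). *)
pose lin k : R := if k is j.+1 then (-1) ^+ j * recip N ^+ k else 0.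
have nlin : newton lin (fun k => (k == 0)%N%:R + recip N * (k == 1)%N%:R).
  case=> [|[|m]]; rewrite /convol.
  - by rewrite big_ord1 !mul0r.
  - by rewrite big_ord_recl big_ord1 /= mul0r; ring.
  rewrite big_ord_recr big_ord_recr big1 => [|i _] /=; last first.
    have im := ltn_ord i; rewrite (_ : (_ == 0)%N = false); last lia.
    by rewrite (_ : (_ == 1)%N = false) ?mulr0 ?addr0 ?mulr0 //; lia.
  by rewrite subSnn subnn /= mulr0 !mulr1 addr0 add0r mulr0 !exprS; ring.
have E m : convol (elemsym N) (fun k => (k == 0)%N%:R + recip N * (k == 1)%N%:R) m = elemsym N.+1 m.
  rewrite elemsymS convDr convZr; congr (_ + _ * _).
    by rewrite convC /convol big_ord_recl big1 => [|i _]; rewrite /= ?subn0 ?mul0r // mul1r addr0.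
  case: m => [|m]; first by rewrite /convol big_ord1 mulr0.
  rewrite convC /convol !big_ord_recl big1 => [|i _]; rewrite /= ?mul0r //.
  by rewrite mul1r add0r addr0 subSS subn0.
rewrite -E (newton_conv IHN nlin); apply: eq_conv => // -[|j] _ /=; first by rewrite addr0.
by rewrite zetaNS mulr1 mulrDr.
Qed.

Lemma newton_exp_coef N : newton (fun k => - harmonic_sum N * (k == 1)%N%:R) (exp_coef N).
Proof.
case=> [|m]; first by rewrite /convol big_ord1 mulr0 !mul0r.
rewrite /convol big_ord_recl big_ord_recl big1 => [|i _] /=; last by rewrite mulr0 mul0r.
rewrite mulr0 mul0r add0r addr0 subSS subn0 mulr1 /exp_coef factS natrM exprS.
have j1 : m.+1%:R != 0 :> R by rewrite pnatr_eq0.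
have jf : m`!%:R != 0 :> R by rewrite pnatr_eq0 -lt0n fact_gt0.
by field; rewrite jf nat1r j1.
Qed.

Lemma newton_gammaN N :
  newton (fun k => if (k <= 1)%N then 0 else power_coef N k) (gammaN N).
Proof.
move=> n; rewrite (newton_conv (newton_exp_coef N) (newton_elemsym N)).
apply: eq_bigr => -[[|[|i]] _] _ //=; rewrite ?mulr0 ?addr0 ?add0r //.
by rewrite mulr1 expr0 mul1r /harmonic_sum /zetaN /=; under [X in _ + X]eq_bigr do rewrite expr1 mulr1; rewrite addNr.
Qed.

End TruncatedZeta.

(** * Insertion of a letter *)

(* Words are reversed, and [true] stands for the letter y. *)
Fixpoint rword (u : seq nat) : seq bool :=
  if u is k :: v then nseq k.-1 false ++ true :: rword v else [::].

(* The terms of the shuffle product of y and [rev w]. *)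
Fixpoint ysh (w : seq bool) : seq (seq bool) :=
  if w is a :: w' then (true :: a :: w') :: map (cons a) (ysh w') else [:: [:: true]].

Fixpoint stuffle (u : seq nat) : seq nat -> seq (seq nat) :=
  fix aux (v : seq nat) : seq (seq nat) :=
    match u, v with
    | [::], _ => [:: v]
    | _, [::] => [:: u]
    | k :: u', l :: v' =>
        map (cons k) (stuffle u' v) ++ map (cons l) (aux v') ++
        map (cons (k + l)%N) (stuffle u' v')
    end.

Section WordSums.
Variable R : numFieldType.
Implicit Types (n N c m : nat) (u v : seq nat) (w : seq bool).
Local Notation recip := (inv_succ R).
Local Notation zetaN := (zetaN R).
Local Notation hsym := (hsym R).

(* The coefficient of z^m in the multiple polylogarithm of the word [rev w]. *)
Fixpoint cw w m : R :=
  match w with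
  | [::] => (m == 0)%N%:R
  | true :: w' => (\sum_(0 <= a < m) cw w' a) / m%:R
  | false :: w' => cw w' m / m%:R
  end.

Lemma cw_ge0 w m : 0 <= cw w m.
Proof.
elim: w m => [|[] w IHw] m /=; first exact: ler0n.
- by rewrite divr_ge0 ?ler0n // sumr_ge0.
- by rewrite divr_ge0 ?ler0n.
Qed.

Lemma cw0 w : w != [::] -> cw w 0 = 0.
Proof. by case: w => // -[] w _ /=; rewrite invr0 mulr0. Qed.

Lemma cw_falseX j w m : cw (nseq j false ++ w) m = cw w m / m%:R ^+ j.
Proof.
elim: j => [|j IHj] /=; first by rewrite expr0 divr1.
by rewrite IHj exprSr invfM mulrA.
Qed.

Lemma cw_rword k v c : (0 < k)%N -> all (leq 1) v ->
  cw (rword (k :: v)) c.+1 = recip c ^+ k * zetaN c v.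
Proof.
case: k => // k _; elim: v k c => [|l v IHv] k c v1 /=; rewrite cw_falseX /=.
  rewrite big_nat_recl // big1 ?addr0; last by [].
  by rewrite /inv_succ mul1r mulr1 exprVn exprSr invfM mulrC.
case/andP: v1 => l0 v1; rewrite big_nat_recl //= -/(rword (l :: v)) cw0; last by case: l l0 => [|[|l]].
rewrite add0r; have -> : \sum_(0 <= i < c) cw (rword (l :: v)) i.+1 = zetaN c (l :: v).
  by rewrite zetaN_cons; apply: eq_bigr => d _; case: l l0 => // l _; apply: IHv.
by rewrite /inv_succ exprVn exprSr invfM; ring.
Qed.

Lemma ysh_neq0 w a : a \in ysh w -> a != [::].
Proof. by case: w => [|b w]; rewrite inE; [move/eqP->|case/orP => [/eqP->|/mapP[? _ ->]]]. Qed.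

(** The polylogarithm of y is - log(1 - z), the sum of the z^b/b, and shuffle products become
    products of power series: the right-hand side is a Cauchy product. The hypothesis says that the
    word [rev w] is empty or starts with y. *)
Lemma sum_ysh_cw w m : last true w ->
  \sum_(a <- ysh w) cw a m = \sum_(0 <= a < m) cw w a / (m - a)%:R.
Proof.
case: m => [|m].
  by rewrite big_nil big_seq big1 // => a aw; rewrite cw0 // (ysh_neq0 aw).
elim: w m => [|b v IHv] m gw.
  rewrite big_seq1 /= !big_nat_recl //= !big1 ?addr0 ?subn0 // => i _.
  by rewrite mul0r.
have m0 : m.+1%:R != 0 :> R by rewrite pnatr_eq0.
(* The product rule for z d/dz on coefficients: the degree m + 1 splits as a + (m + 1 - a). *)
have ma a : (a < m.+1)%N -> 1 + a%:R / (m.+1 - a)%:R = m.+1%:R / (m.+1 - a)%:R :> R.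
  move=> am; have d0 : (m.+1 - a)%:R != 0 :> R by rewrite pnatr_eq0; lia.
  by apply: (mulIf d0); rewrite mulrDl !mulfVK // mul1r -natrD subnK // ltnW.
have cwE (f : nat -> R) : (forall a, (a < m.+1)%N -> f a = a%:R * cw (b :: v) a) ->
    (\sum_(0 <= a < m.+1) cw (b :: v) a + \sum_(0 <= a < m.+1) f a / (m.+1 - a)%:R) / m.+1%:R =
    \sum_(0 <= a < m.+1) cw (b :: v) a / (m.+1 - a)%:R.
  move=> fE; rewrite -big_split mulr_suml; apply: eq_big_nat => a /andP[_ am] /=.
  apply: (mulIf m0); rewrite mulfVK // fE // -[RHS]mulrA [_^-1 * _]mulrC -ma //.
  by rewrite mulrDr mulr1; congr (_ + _); rewrite mulrC mulrA [_^-1 * _]mulrC mulrC.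
rewrite [ysh _]/= big_cons big_map.
case: b gw cwE => gw cwE; last first.
  have v0 : v != [::] by case: v gw {IHv cwE}.
  under [X in _ + X]eq_bigr do rewrite /=.
  rewrite -mulr_suml IHv; last by case: v gw v0 {IHv cwE}.
  rewrite [cw (true :: _) _]/= -mulrDl -(cwE (cw v)) // => -[|a] am /=.
    by rewrite cw0 // mul0r.
  by rewrite mulrCA mulfV ?mulr1 // pnatr_eq0.
under [X in _ + X]eq_bigr do rewrite /=.
rewrite -mulr_suml exchange_big [cw _ _]/= -mulrDl /=.
rewrite -(cwE (fun a => \sum_(0 <= d < a) cw v d)); last first.
  move=> [|a] am /=; first by rewrite big_nil mul0r.
  by rewrite mulrCA mulfV ?mulr1 // pnatr_eq0.
congr ((_ + _) / _).
transitivity (\sum_(0 <= a < m.+1) \sum_(0 <= d < a) cw v d / (a - d)%:R).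
  apply: eq_big_nat => -[|a] /andP[_ am]; last exact: IHv.
  by rewrite big_nil big_seq big1 // => a aw; rewrite cw0 // (ysh_neq0 aw).
rewrite -triangular_exchange [RHS](eq_bigr (fun a => \sum_(0 <= d < a) cw v d / (m.+1 - a)%:R)); last first.
  by move=> a _; rewrite mulr_suml.
rewrite -triangular_exchange; apply: eq_big_nat => d /andP[_ dm].
rewrite big_nat_rev /=; apply: eq_big_nat => a /andP[da am].
by congr (_ / _%:R); lia.
Qed.

Lemma sum_stuffle_zetaN N u v :
  \sum_(a <- stuffle u v) zetaN N a = zetaN N u * zetaN N v.
Proof.
elim: u v N => [|k u IHu] v N; first by case: v => [|l v]; rewrite big_seq1 mul1r.
elim: v N => [|l v IHv] N; first by rewrite big_seq1 mulr1.
rewrite [stuffle _ _]/= -/(stuffle (k :: u)) !big_cat !big_map /=.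
have expand M j (s : seq (seq nat)) : \sum_(a <- s) zetaN M (j :: a) =
    \sum_(0 <= c < M) recip c ^+ j * \sum_(a <- s) zetaN c a.
  by rewrite exchange_big; apply: eq_bigr => c _; rewrite mulr_sumr.
rewrite !expand -!big_split /=.
elim: N {expand} => [|N IHN]; first by rewrite big_nil zetaN0 mul0r.
rewrite big_nat_recr //= {}IHN !IHu IHv !zetaNS exprD; ring.
Qed.

End WordSums.

(** * Recursions for the quotients [hq] *)

Section ConnectedSums.
Variable R : numFieldType.
Local Notation recip := (inv_succ R).
Local Notation hsym := (hsym R).

(* The generating function of [hq n a] over n is a! / (a * (1 - x) ... (a - x)). *)
Definition hq n a : R := hsym n a / a%:R.

Lemma hsymS n a : hsym n.+1 a.+1 = hsym n.+1 a + recip a * hsym n a.+1.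
Proof. by rewrite /= big_nat_recr. Qed.

(** With Q_a for the generating function of [hq] over n, this reads (a + 1 - x) Q_(a+1) = a Q_a. *)
Lemma hqS n a : (0 < a)%N ->
  a.+1%:R * hq n.+1 a.+1 - hq n a.+1 = a%:R * hq n.+1 a.
Proof.
move=> a0; rewrite /hq hsymS /inv_succ.
have a1 : a%:R != 0 :> R by rewrite pnatr_eq0 -lt0n.
have a2 : a.+1%:R != 0 :> R by rewrite pnatr_eq0.
rewrite [X in X - _]mulrC mulfVK // [RHS]mulrC mulfVK //; ring.
Qed.

Definition hq_partial n B a : R := \sum_(1 <= b < B.+1) hq n (a + b) / b%:R.

(** With P_a for the generating function of [hq_partial], (a + 1 - x) P_(a+1) = a P_a + Q_(a+1) -
    Q_(a+B+1). When B grows the last term disappears, and what remains is the relation that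
    differentiating [hqS] gives for Q_a'. *)
Lemma hq_partialS n B a :
  a.+1%:R * hq_partial n.+1 B a.+1 - hq_partial n B a.+1 =
  a%:R * hq_partial n.+1 B a + hq n.+1 a.+1 - hq n.+1 (a + B).+1.
Proof.
elim: B => [|B IHB]; first by rewrite /hq_partial !big_geq // !mulr0 addn0; ring.
have b0 : B.+1%:R != 0 :> R by rewrite pnatr_eq0.
rewrite /hq_partial !(big_nat_recr B.+1) //= -/(hq_partial _ _ _).
rewrite -/(hq_partial n.+1 B a.+1) -/(hq_partial n B a.+1) -/(hq_partial n.+1 B a).
have step : a.+1%:R * hq n.+1 (a.+1 + B.+1) - hq n (a.+1 + B.+1) =
    a%:R * hq n.+1 (a + B.+1) + B.+1%:R * hq n.+1 (a + B).+1 - B.+1%:R * hq n.+1 (a + B.+1).+1.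
  have := @hqS n (a + B.+1); rewrite addnS => /(_ isT).
  rewrite addSnnS !addnS => e.
  have -> : a.+1%:R = (a + B).+2%:R - B.+1%:R :> R by rewrite -addnS -addSn natrD addrK.
  have -> : a%:R = (a + B).+1%:R - B.+1%:R :> R by rewrite -addnS natrD addrK.
  rewrite mulrBl mulrBl -e; ring.
move: IHB; set p := hq_partial _ _ _; set q := hq_partial _ _ _; set r := hq_partial _ _ _.
move=> IHB; transitivity (a.+1%:R * p - q +
  (a.+1%:R * hq n.+1 (a.+1 + B.+1) - hq n (a.+1 + B.+1)) / B.+1%:R); first by ring.
rewrite IHB step addnS; field.
by rewrite nat1r.
Qed.

End ConnectedSums.

(** * Growth and convergence *)

Section Bounds.
Variable R : realType.
Implicit Types (n N c m r : nat) (u v : seq nat).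
Local Notation recip := (inv_succ R).
Local Notation zetaN := (zetaN R).
Local Notation hsym := (hsym R).

Lemma recip_gt0 c : 0 < recip c.
Proof. by rewrite invr_gt0 ltr0n. Qed.
Hint Resolve recip_gt0 : core.

Lemma recip_ge0 c : 0 <= recip c. Proof. exact: ltW. Qed.
Hint Resolve recip_ge0 : core.

Lemma recip_le1 c : recip c <= 1.
Proof. by rewrite invf_le1 ?ltr0n // ler1n. Qed.

Lemma recip_pow k c : (0 < k)%N -> recip c ^+ k <= recip c.
Proof.
by case: k => // k _; rewrite exprS ger_pMr // exprn_ile1 // recip_le1.
Qed.

Lemma recip_pow2 k c : (1 < k)%N -> recip c ^+ k <= recip c ^+ 2.
Proof.
case: k => // k k1; rewrite exprS expr2 ler_pM2l //; exact: recip_pow.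
Qed.

Lemma recip_sub c : recip c * recip c.+1 = recip c - recip c.+1.
Proof.
have c1 : c.+1%:R != 0 :> R by rewrite pnatr_eq0.
have c2 : c.+2%:R != 0 :> R by rewrite pnatr_eq0.
have e : c.+2%:R = c.+1%:R + 1 :> R by rewrite natr1.
by move: c1 c2; rewrite /inv_succ e; move: (c.+1%:R : R) => z z0 z1; field; rewrite ?z0 ?z1.
Qed.

Lemma recip_dbl c : recip c <= 2%:R * recip c.+1.
Proof.
rewrite /inv_succ ler_pdivlMr ?ltr0n // mulrC ler_pdivrMr ?ltr0n //.
by rewrite -natrM ler_nat; lia.
Qed.

Definition logb N : R := 1 + harmonic_sum R N.

Lemma logbS N : logb N.+1 = logb N + recip N.
Proof. by rewrite /logb /harmonic_sum big_nat_recr //= addrA. Qed.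

Lemma logb_homo : {homo logb : a b / (a <= b)%N >-> a <= b}.
Proof.
move=> a b /subnK <-; elim: (b - a)%N => // d IHd.
by rewrite addSn logbS (le_trans IHd) // lerDl.
Qed.

Lemma logb_ge1 N : 1 <= logb N.
Proof. by rewrite lerDl sumr_ge0. Qed.

Lemma logb_ge0 N : 0 <= logb N.
Proof. exact: le_trans (logb_ge1 N). Qed.
Hint Resolve logb_ge0 : core.

Lemma logbX_homo r a b : (a <= b)%N -> logb a ^+ r <= logb b ^+ r.
Proof. by move=> ab; rewrite lerXn2r ?nnegrE // logb_homo. Qed.

Lemma harmonic_le_logb N : harmonic_sum R N <= logb N.
Proof. by rewrite lerDr. Qed.

Lemma harmonic_sum_ge0 N : 0 <= harmonic_sum R N.
Proof. by rewrite sumr_ge0. Qed.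

Lemma zetaN_ge0 N u : 0 <= zetaN N u.
Proof.
elim: u N => [|k u IHu] N; first exact: ler01.
by rewrite zetaN_cons sumr_ge0 // => c _; rewrite mulr_ge0 // exprn_ge0.
Qed.

Lemma hsym_ge0 n N : 0 <= hsym n N.
Proof.
elim: n N => [|n IHn] N /=; first exact: ler01.
by rewrite sumr_ge0 // => c _; rewrite mulr_ge0.
Qed.

Lemma zetaN_le N v : all (leq 1) v -> zetaN N v <= logb N ^+ size v.
Proof.
elim: v N => [|k v IHv] N //= /andP[k0 v1].
rewrite zetaN_cons exprS (@le_trans _ _ (\sum_(0 <= c < N) recip c * logb N ^+ size v)) //.
  apply: ler_sum_nat => c /andP[_ cN].
  rewrite ler_pM ?exprn_ge0 ?zetaN_ge0 ?recip_pow //.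
  by apply: le_trans (IHv _ v1) (logbX_homo _ (ltnW cN)).
by rewrite -mulr_suml ler_wpM2r ?exprn_ge0 ?harmonic_le_logb.
Qed.

Lemma hsym_le n N : hsym n N <= logb N ^+ n.
Proof.
elim: n N => [|n IHn] N //=.
rewrite exprS (@le_trans _ _ (\sum_(0 <= c < N) recip c * logb N ^+ n)) //.
  apply: ler_sum_nat => c /andP[_ cN].
  by rewrite ler_wpM2l // (le_trans (IHn _)) // logbX_homo.
by rewrite -mulr_suml ler_wpM2r ?exprn_ge0 ?harmonic_le_logb.
Qed.

Definition logsum r N : R := \sum_(0 <= c < N) recip c * recip c.+1 * logb c.+1 ^+ r.

(** Summation by parts, based on 1/((c + 1)(c + 2)) = 1/(c + 1) - 1/(c + 2). *)
Lemma logsum_abel r N : logsum r N + recip N * logb N ^+ r =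
  1 + \sum_(0 <= c < N) recip c * (logb c.+1 ^+ r - logb c ^+ r).
Proof.
elim: N => [|N IHN].
  rewrite /logsum !big_nil /logb /harmonic_sum big_nil addr0 expr1n.
  by rewrite /inv_succ invr1 mulr1 add0r.
rewrite /logsum !big_nat_recr //= -/(logsum r N) addrA -IHN recip_sub; ring.
Qed.

(** Induction on the power: the increment of [logb ^+ r.+1] is at most (r + 1)/(c + 1) times an r-th
    power, so summation by parts reduces to [logsum r]. The factor 2 comes from 1/(c + 1) <= 2/(c +
    2). *)
Lemma logsum_bounded r : exists C, forall N, logsum r N <= C.
Proof.
elim: r => [|r [C IHr]].
  exists 1 => N; have -> : 1 = 1 + \sum_(0 <= c < N) recip c * (logb c.+1 ^+ 0 - logb c ^+ 0) :> R.
    by rewrite big1 ?addr0 // => c _; rewrite !expr0 subrr mulr0.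
  by rewrite -logsum_abel expr0 mulr1 lerDl.
exists (1 + 2%:R * r.+1%:R * C) => N.
rewrite (@le_trans _ _ (1 + \sum_(0 <= c < N) recip c * (logb c.+1 ^+ r.+1 - logb c ^+ r.+1))) //.
  by rewrite -logsum_abel lerDl mulr_ge0 // exprn_ge0.
rewrite lerD2l (@le_trans _ _ (2%:R * r.+1%:R * logsum r N)) //; last first.
  by rewrite ler_wpM2l // mulr_ge0 ?ler0n.
rewrite /logsum mulr_sumr; apply: ler_sum => c _.
have -> : logb c.+1 ^+ r.+1 - logb c ^+ r.+1 =
    recip c * \sum_(i < r.+1) logb c.+1 ^+ (r - i) * logb c ^+ i.
  by rewrite subrXX logbS addrAC subrr add0r.
have sle : \sum_(i < r.+1) logb c.+1 ^+ (r - i) * logb c ^+ i <= r.+1%:R * logb c.+1 ^+ r.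
  rewrite mulr_natl -[X in _ *+ X](card_ord r.+1) -sumr_const; apply: ler_sum => i _.
  rewrite -[X in _ <= _ ^+ X](subnK (ltnSE (ltn_ord i))) exprD ler_wpM2l ?exprn_ge0 //.
  by rewrite logbX_homo.
have := ler_wpM2l (recip_ge0 c) (ler_wpM2l (recip_ge0 c) sle) => /le_trans; apply.
rewrite [leRHS](_ : _ = recip c * (2%:R * recip c.+1 * (r.+1%:R * logb c.+1 ^+ r))); last by ring.
by rewrite ler_wpM2l // ler_wpM2r ?recip_dbl // mulr_ge0 ?ler0n ?exprn_ge0.
Qed.

Lemma logsum_cvg r : cvgn (logsum r).
Proof.
have [C Cb] := logsum_bounded r.
apply: nondecreasing_is_cvgn; last by exists C => _ [N _ <-].
apply/nondecreasing_seqP => N; rewrite /logsum big_nat_recr //= lerDl.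
by rewrite !mulr_ge0 // exprn_ge0.
Qed.

Lemma recip_cvg0 : recip c @[c --> \oo] --> 0.
Proof. exact: cvg_harmonic. Qed.

(** The terms 1/((c + 1)(c + 2)) from c = N on add up to 1/(N + 1), so the quantity is at most the
    tail of the convergent series [logsum r]. *)
Lemma recip_logb_cvg0 r : recip N * logb N ^+ r @[N --> \oo] --> 0.
Proof.
have ndT : nondecreasing_seq (logsum r).
  apply/nondecreasing_seqP => N; rewrite /logsum big_nat_recr //= lerDl.
  by rewrite !mulr_ge0 // exprn_ge0.
apply: (@squeeze_cvgr _ _ _ _ (fun=> 0) (fun N => limn (logsum r) - logsum r N)).
- near=> N; rewrite mulr_ge0 ?exprn_ge0 //=.
  have lim1 : (recip N - recip M) * logb N ^+ r @[M --> \oo] --> recip N * logb N ^+ r.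
    have -> : recip N * logb N ^+ r = (recip N - 0) * logb N ^+ r by rewrite subr0.
    by apply: cvgM; [apply: cvgB; [exact: cvg_cst|exact: recip_cvg0]|exact: cvg_cst].
  apply: (ler_cvg_to lim1 (cvg_cst _)).
  near=> M; have NM : (N <= M)%N by near: M; exact: nbhs_infty_ge.
  apply: (@le_trans _ _ (logsum r M - logsum r N)); last first.
    by rewrite lerD2r; apply: nondecreasing_cvgn_le => //; exact: logsum_cvg.
  rewrite /logsum (@big_cat_nat _ _ _ N 0 M) //= addrAC subrr add0r.
  have -> : (recip N - recip M) * logb N ^+ r =
      \sum_(N <= c < M) recip c * recip c.+1 * logb N ^+ r.
    rewrite -mulr_suml; congr (_ * _).
    rewrite (eq_bigr (fun c => - recip c.+1 - (- recip c))); last first.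
      by move=> c _; rewrite recip_sub opprK addrC.
    by rewrite telescope_sumr // opprK addrC.
  apply: ler_sum_nat => c /andP[Nc _].
  by rewrite ler_wpM2l ?mulr_ge0 // logbX_homo // leqW.
- exact: cvg_cst.
- have : limn (logsum r) - logsum r N @[N --> \oo] --> limn (logsum r) - limn (logsum r).
    by apply: cvgB; [exact: cvg_cst|exact: logsum_cvg].
  by rewrite subrr.
Unshelve. all: by end_near. Qed.

Lemma core_summable k v n : (1 < k)%N -> all (leq 1) v ->
  cvgn (fun N => \sum_(0 <= c < N) recip c ^+ k * zetaN c v * hsym n c.+1).
Proof.
move=> k1 v1.
have ge0 c : 0 <= recip c ^+ k * zetaN c v * hsym n c.+1.
  by rewrite !mulr_ge0 ?exprn_ge0 ?zetaN_ge0 ?hsym_ge0.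
have [C Cb] := logsum_bounded (size v + n).
apply: nondecreasing_is_cvgn.
  by apply/nondecreasing_seqP => N; rewrite big_nat_recr //= lerDl.
exists (2%:R * C) => _ [N _ <-].
rewrite (@le_trans _ _ (2%:R * logsum (size v + n) N)) ?ler_wpM2l //.
rewrite /logsum mulr_sumr; apply: ler_sum => c _.
have -> : 2%:R * (recip c * recip c.+1 * logb c.+1 ^+ (size v + n)) =
   recip c * (2%:R * recip c.+1) * logb c.+1 ^+ size v * logb c.+1 ^+ n.
  by rewrite exprD; ring.
rewrite !ler_pM ?mulr_ge0 ?exprn_ge0 ?zetaN_ge0 ?hsym_ge0 //.
- by rewrite (le_trans (recip_pow2 _ k1)) // expr2 ler_wpM2l // recip_dbl.
- by rewrite (le_trans (zetaN_le _ v1)) // logbX_homo.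
- exact: hsym_le.
Qed.

(* Tannery's theorem for increasing sums. *)
Lemma cvg_sum_dominated (x y : nat -> R) (z : nat -> nat -> R) (S : R) :
  (forall a, 0 <= x a) -> (forall N a, (a < N)%N -> 0 <= z N a <= y a) ->
  (forall a, z N a @[N --> \oo] --> y a) ->
  \sum_(0 <= a < N) x a * y a @[N --> \oo] --> S ->
  \sum_(0 <= a < N) x a * z N a @[N --> \oo] --> S.
Proof.
move=> x0 zy zlim xyS.
have y0 a : 0 <= y a by have /andP[/le_trans] := zy a.+1 a (ltnSn a); apply.
have nd : nondecreasing_seq (fun N => \sum_(0 <= a < N) x a * y a).
  by apply/nondecreasing_seqP => N; rewrite big_nat_recr //= lerDl mulr_ge0.
have upper N : \sum_(0 <= a < N) x a * y a <= S.
  have cv : cvgn (fun N => \sum_(0 <= a < N) x a * y a) by apply/cvg_ex; exists S.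
  by have := nondecreasing_cvgn_le nd cv N; rewrite (cvg_lim (@norm_hausdorff _ _) xyS).
apply/cvgrPdist_le => e e0.
have e2 : 0 < e / 2 by rewrite divr_gt0.
have /cvgrPdist_le /(_ _ e2) [A _ HA] := xyS.
have partial : \sum_(0 <= a < A) x a * z N a @[N --> \oo] --> \sum_(0 <= a < A) x a * y a.
  elim: A {HA} => [|A IHA].
    by under eq_fun do rewrite big_nil; rewrite big_nil; exact: cvg_cst.
  under eq_fun do rewrite big_nat_recr //=; rewrite big_nat_recr //=.
  by apply: cvgD => //; apply: cvgM => //; exact: cvg_cst.
have /cvgrPdist_le /(_ _ e2) close := partial.
near=> N.
have AN : (A <= N)%N by near: N; exact: nbhs_infty_ge.
have up : \sum_(0 <= a < N) x a * z N a <= S.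
  apply: le_trans (upper N); 
  by apply: ler_sum_nat => a /andP[_ aN]; rewrite ler_wpM2l //; case/andP: (zy _ _ aN).
have low : \sum_(0 <= a < A) x a * z N a <= \sum_(0 <= a < N) x a * z N a.
  rewrite (@big_cat_nat _ _ _ A 0 N) //= lerDl big_nat sumr_ge0 // => a /andP[_ aN].
  by rewrite mulr_ge0 //; case/andP: (zy _ _ aN).
have d1 : S - \sum_(0 <= a < A) x a * y a <= e / 2.
  exact: le_trans (ler_norm _) (HA A (leqnn A)).
have d2 : \sum_(0 <= a < A) x a * y a - \sum_(0 <= a < A) x a * z N a <= e / 2.
  by apply: le_trans (ler_norm _) _; near: N.
rewrite ger0_norm ?subr_ge0 //.
by lra.
Unshelve. all: by end_near. Qed.

End Bounds.

(** * Multiple zeta values as limits of truncated sums *)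

Fixpoint increasing_seqs (N r : nat) : seq (seq nat) :=
  if r is r'.+1 then [seq rcons s c.+1 | c <- iota 0 N, s <- increasing_seqs c r']
  else [:: [::]].

Lemma mem_increasing_seqs N r s :
  (s \in increasing_seqs N r) = [&& size s == r, path ltn 0%N s & (last 0 s <= N)%N].
Proof.
elim: r N s => [|r IHr] N s; first by case: s => [|x s]; rewrite inE.
case/lastP: s => [|s x] /=.
  apply/negbTE/negP => /allpairsPdep[c [s [_ _]]] /(congr1 size).
  by rewrite size_rcons.
rewrite size_rcons eqSS rcons_path last_rcons.
apply/allpairsPdep/idP => [[c [s' [cN s'c]]]|/and3P[sr /andP[ps xs] xN]].
  move=> /eqP; rewrite eqseq_rcons => /andP[/eqP-> /eqP->].
  move: s'c cN; rewrite IHr mem_iota add0n /= => /and3P[-> -> lc] cN.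
  by rewrite /= ltnS lc.
case: x xs xN => // x xs xN; exists x, s; split => //; first by rewrite mem_iota.
by rewrite IHr sr ps.
Qed.

Lemma uniq_increasing_seqs N r : uniq (increasing_seqs N r).
Proof.
elim: r N => // r IHr N /=; apply: allpairs_uniq_dep; first exact: iota_uniq.
- by move=> c _; apply: IHr.
- move=> [c s] [d t] _ _ /= /eqP; rewrite eqseq_rcons => /andP[/eqP-> /eqP[->]].
  by [].
Qed.

Section MzvLimit.
Variable R : realType.
Local Notation recip := (inv_succ R).
Local Notation zetaN := (zetaN R).

Definition mzv_term (k n : seq nat) : R :=
  \prod_(i < size k) (nth 0%N n i)%:R ^- nth 0%N k i.

Lemma mzv_term_ge0 k n : 0 <= mzv_term k n.
Proof. by apply: prodr_ge0 => i _; rewrite invr_ge0 exprn_ge0. Qed.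

Lemma mzv_term_rcons k l n m : size n = size k ->
  mzv_term (rcons k l) (rcons n m) = m%:R ^- l * mzv_term k n.
Proof.
move=> nk; rewrite /mzv_term size_rcons big_ord_recr /= mulrC; congr (_ * _).
  by rewrite !nth_rcons nk ltnn eqxx.
by apply: eq_bigr => i _; rewrite !nth_rcons nk !ltn_ord.
Qed.

Lemma sum_increasing_seqs N k :
  \sum_(n <- increasing_seqs N (size k)) mzv_term k n = zetaN N (rev k).
Proof.
elim/last_ind: k N => [|k l IHk] N.
  by rewrite big_seq1 /mzv_term big_ord0.
rewrite size_rcons rev_rcons zetaN_cons /= big_allpairs_dep /index_iota subn0.
apply: eq_bigr => c _; rewrite -IHk mulr_sumr big_seq [RHS]big_seq.
apply: eq_bigr => n; rewrite mem_increasing_seqs => /and3P[/eqP nk _ _].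
by rewrite mzv_term_rcons // exprVn.
Qed.

Lemma zetaN_homo u : nondecreasing_seq (fun N => zetaN N u).
Proof.
apply/nondecreasing_seqP => N; case: u => // k v.
by rewrite zetaNS lerDl mulr_ge0 ?zetaN_ge0 // exprn_ge0 // recip_ge0.
Qed.

(** Every finite set of increasing sequences lies among those bounded by some N, and the terms of
    the latter add up to [zetaN]; this matches the unordered sum with the limit. *)
Lemma mzv_lim k : cvgn (fun N => zetaN N (rev k)) ->
  mzv R k = limn (fun N => zetaN N (rev k)).
Proof.
move=> cv; rewrite /mzv; set I := [set n | _].
set l := limn _; suff -> : \esum_(n in I) (mzv_term k n)%:E = l%:E by [].
pose J N := [set` increasing_seqs N (size k)].
have JI N : J N `<=` I.
  by move=> n; rewrite /J /I /= mem_increasing_seqs => /and3P[/eqP].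
have finJ N : finite_set (J N) by apply/finite_seqP; exists (increasing_seqs N (size k)).
have sumJ N : (\sum_(n \in J N) (mzv_term k n)%:E = (zetaN N (rev k))%:E)%E.
  by rewrite -fsbig_seq ?uniq_increasing_seqs // sumEFin sum_increasing_seqs.
apply/eqP; rewrite eq_le; apply/andP; split.
  apply: ge_ereal_sup => _ [A [finA AI] <-].
  have [s As] := (finite_seqP A).1 finA.
  pose N := (\max_(n <- s) last 0 n)%N.
  apply: (@le_trans _ _ (zetaN N (rev k))%:E); last first.
    by rewrite lee_fin; apply: (nondecreasing_cvgn_le (@zetaN_homo (rev k))).
  rewrite -sumJ; apply: lee_fsum_nneg_subset => //; last first.
    by move=> n _; rewrite lee_fin mzv_term_ge0.
  move=> n; rewrite !inE => An; have [sn pn] := AI _ An.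
  rewrite /J /= mem_increasing_seqs sn eqxx pn /=.
  by apply: (leq_bigmax_seq (F := last 0%N)) => //; move: An; rewrite As.
have low N : ((zetaN N (rev k))%:E <= \esum_(n in I) (mzv_term k n)%:E)%E.
  by rewrite -sumJ; apply: esum_ge; exists (J N).
have := low 0%N; case: esum low => [x| |] low; last 2 first.
- by rewrite !leey.
- by rewrite !leeNy_eq.
move=> _; rewrite lee_fin; apply: limr_le => //.
by near=> N; have := low N; rewrite lee_fin.
Unshelve. all: by end_near. Qed.

Definition adm u := all (leq 1) u && (1 < head 2 u)%N.

Lemma adm_rev k : adm (rev k) = admissible k.
Proof.
rewrite /adm /admissible /is_index all_rev; congr (_ && (_ < _)%N).
by case/lastP: k => // k l; rewrite rev_rcons last_rcons.
Qed.

Lemma zetaN_cvg u : adm u -> cvgn (fun N => zetaN N u).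
Proof.
case: u => [|k v] /andP[]; first by move=> _ _; exact: is_cvg_cst.
move=> /andP[_ v1] k1; have := @core_summable R k v 0 k1 v1.
by under eq_fun do under eq_bigr do rewrite mulr1.
Qed.

Lemma zetaN_cvg_mzv k : admissible k -> zetaN N (rev k) @[N --> \oo] --> mzv R k.
Proof.
by move=> ak; rewrite mzv_lim; apply: zetaN_cvg; rewrite adm_rev.
Qed.

End MzvLimit.

(** * The algebra of multiple zeta values *)

Section Span.
Variable R : realType.
Local Notation recip := (inv_succ R).
Local Notation zetaN := (zetaN R).
Local Notation Z := (@mzv_span R).

Lemma span_lin (c : rat) a b : Z a -> Z b -> Z (ratr c * a + b).
Proof.
move=> [s sa ->] [s' s'a ->].
exists ([seq (c * p.1, p.2) | p <- s] ++ s').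
  by rewrite all_cat s'a andbT all_map; apply: sub_all sa.
rewrite big_cat big_map mulr_sumr; congr (_ + _); apply: eq_bigr => p _.
by rewrite rmorphM mulrA.
Qed.

Lemma span0 : Z 0. Proof. by exists [::] => //; rewrite big_nil. Qed.

Lemma span_mzv k : admissible k -> Z (mzv R k).
Proof.
by move=> ak; exists [:: (1, k)] => /=; rewrite ?ak // big_seq1 /= rmorph1 mul1r.
Qed.

Lemma spanZ (c : rat) a : Z a -> Z (ratr c * a).
Proof. by move=> Za; rewrite -[_ * a]addr0; apply: span_lin => //; exact: span0. Qed.

Lemma spanD a b : Z a -> Z b -> Z (a + b).
Proof. by move=> Za Zb; rewrite -[a]mul1r -(rmorph1 (@ratr R)); apply: span_lin. Qed.

Lemma spanN a : Z a -> Z (- a).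
Proof. by move=> Za; rewrite -mulN1r -(rmorphN1 (@ratr R)); apply: spanZ. Qed.

Lemma span_sum (I : Type) (r : seq I) (P : pred I) (F : I -> R) :
  (forall i, P i -> Z (F i)) -> Z (\sum_(i <- r | P i) F i).
Proof. by move=> ZF; elim/big_ind: _ => //; [exact: span0|exact: spanD]. Qed.

Lemma span_sum_seq (I : eqType) (r : seq I) (F : I -> R) :
  (forall i, i \in r -> Z (F i)) -> Z (\sum_(i <- r) F i).
Proof. by move=> ZF; rewrite big_seq; apply: span_sum. Qed.

Lemma spanMn n a : Z a -> Z (n%:R * a).
Proof. by move=> Za; rewrite -(ratr_nat R); apply: spanZ. Qed.

Lemma spanMsign n a : Z a -> Z ((-1) ^+ n * a).
Proof. by move=> Za; rewrite -signr_odd; case: odd; rewrite ?mul1r // mulN1r; apply: spanN. Qed.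

Lemma spanVn n a : Z (n.+1%:R * a) -> Z a.
Proof.
move=> Za; have n0 : n.+1%:R != 0 :> R by rewrite pnatr_eq0.
have -> : a = ratr (n.+1%:R^-1) * (n.+1%:R * a) by rewrite fmorphV rmorph_nat mulKf.
exact: spanZ.
Qed.

Lemma mzv_nil : mzv R [::] = 1.
Proof. by rewrite mzv_lim /=; [apply: lim_cst|exact: is_cvg_cst]. Qed.

Lemma span1 : Z 1.
Proof. by rewrite -mzv_nil; apply: span_mzv. Qed.

Lemma stuffle_index u v : all (leq 1) u -> all (leq 1) v ->
  all (all (leq 1)) (stuffle u v).
Proof.
elim: u v => [|k u IHu] v; first by case: v => [|l v] //= _ ->.
elim: v => [|l v IHv] ku; first by move=> _; rewrite [stuffle _ _]/= all_seq1 ku.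
move=> /andP[l0 v1]; have /andP[k0 u1] := ku.
rewrite [stuffle _ _]/= -/(stuffle (k :: u)) !all_cat !all_map; apply/and3P; split.
- by apply: sub_all (IHu (l :: v) u1 _) => [a a1 /=|/=]; rewrite ?k0 ?l0 ?v1.
- by apply: sub_all (IHv ku v1) => a a1 /=; rewrite l0.
- by apply: sub_all (IHu v u1 v1) => a a1 /=; rewrite addn_gt0 k0.
Qed.

Lemma stuffle_adm u v : adm u -> adm v -> all adm (stuffle u v).
Proof.
move=> /andP[u1 hu] /andP[v1 hv].
have hd : all (fun a => 1 < head 2 a)%N (stuffle u v).
  case: u u1 hu => [|k u] u1 hu; first by case: v v1 hv => [|l v] //= _ ->.
  case: v v1 hv => [|l v] v1 hv; first by rewrite /= hu.
  rewrite [stuffle _ _]/= !all_cat !all_map /=; apply/and3P; split; apply/allP => a _ //=.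
  by rewrite (leq_trans hu) // leq_addr.
by apply/allP => a aS; rewrite /adm (allP hd) // (allP (stuffle_index u1 v1)).
Qed.

Lemma cvg_sum_seq (I : eqType) (s : seq I) (F : I -> nat -> R) (l : I -> R) :
  (forall i, i \in s -> F i N @[N --> \oo] --> l i) ->
  \sum_(i <- s) F i N @[N --> \oo] --> \sum_(i <- s) l i.
Proof.
elim: s => [|i s IHs] Fl.
  by under eq_fun do rewrite big_nil; rewrite big_nil; exact: cvg_cst.
under eq_fun do rewrite big_cons; rewrite big_cons.
apply: cvgD; first by apply: Fl; rewrite inE eqxx.
by apply: IHs => j js; apply: Fl; rewrite inE js orbT.
Qed.

Lemma adm_cvg u : adm u -> zetaN N u @[N --> \oo] --> mzv R (rev u).
Proof. by move=> au; rewrite -[u in X in X --> _]revK; apply: zetaN_cvg_mzv; rewrite -adm_rev revK. Qed.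

Lemma span_adm u : adm u -> Z (mzv R (rev u)).
Proof. by move=> au; apply: span_mzv; rewrite -adm_rev revK. Qed.

Lemma mzvM k l : admissible k -> admissible l -> Z (mzv R k * mzv R l).
Proof.
move=> ak al.
have ak' : adm (rev k) by rewrite adm_rev.
have al' : adm (rev l) by rewrite adm_rev.
have st := stuffle_adm ak' al'.
rewrite (_ : _ * _ = \sum_(a <- stuffle (rev k) (rev l)) mzv R (rev a)); last first.
  have l1 : zetaN N (rev k) * zetaN N (rev l) @[N --> \oo] --> mzv R k * mzv R l.
    by apply: cvgM; apply: zetaN_cvg_mzv.
  have l2 : \sum_(a <- stuffle (rev k) (rev l)) zetaN N a @[N --> \oo] -->
      \sum_(a <- stuffle (rev k) (rev l)) mzv R (rev a).
    by apply: cvg_sum_seq => a aS; apply: adm_cvg; apply: (allP st).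
  apply: (@cvg_unique _ (@norm_hausdorff _ R) _ _ _ _ l1); move: l2.
  by under eq_fun do rewrite sum_stuffle_zetaN.
by apply: span_sum_seq => a aS; apply: span_adm; apply: (allP st).
Qed.

Lemma spanM a b : Z a -> Z b -> Z (a * b).
Proof.
move=> [s sa ->] [s' s'a ->]; rewrite mulr_suml; apply: span_sum_seq => p ps.
rewrite mulr_sumr; apply: span_sum_seq => q qs.
rewrite mulrACA -rmorphM; apply: spanZ; apply: mzvM.
  exact: (allP sa _ ps).
exact: (allP s'a _ qs).
Qed.

End Span.

(** * Shuffle regularized values as limits *)

Section InsertionLimit.
Variable R : realType.
Implicit Types (n N a : nat) (u v : seq nat) (w : seq bool).
Local Notation recip := (inv_succ R).
Local Notation zetaN := (zetaN R).
Local Notation hsym := (hsym R).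
Local Notation hq := (hq R).
Local Notation cw := (cw R).

Lemma cvgnMl (z : R) (f : nat -> R) (l : R) :
  f N @[N --> \oo] --> l -> z * f N @[N --> \oo] --> z * l.
Proof. by move=> fl; apply: cvgM => //; exact: cvg_cst. Qed.

Lemma cvgn_shift (f : nat -> R) (l : R) k :
  f N @[N --> \oo] --> l -> f (k + N)%N @[N --> \oo] --> l.
Proof. by rewrite -(cvg_shiftn k); under eq_fun do rewrite addnC. Qed.

Lemma hq_cvg0 n : hq n N.+1 @[N --> \oo] --> 0.
Proof.
apply: (@squeeze_cvgr _ _ _ _ (fun=> 0) (fun N => 2%:R * (recip N.+1 * logb R N.+1 ^+ n))).
- near=> N; rewrite /hq divr_ge0 ?hsym_ge0 ?ler0n //= mulrA.
  rewrite mulrC ler_pM ?hsym_ge0 ?hsym_le ?recip_ge0 //; exact: recip_dbl.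
- exact: cvg_cst.
- rewrite -(mulr0 2%:R); apply: cvgnMl.
  by apply: (@cvgn_shift _ _ 1%N (@recip_logb_cvg0 R n)).
Unshelve. all: by end_near. Qed.

Lemma hq_partial0S B a :
  a.+1%:R * hq_partial R 0 B a.+1 = a%:R * hq_partial R 0 B a + hq 0 a.+1 - hq 0 (a + B).+1.
Proof.
elim: B => [|B IHB]; first by rewrite /hq_partial !big_geq // !mulr0 addn0; ring.
rewrite /hq_partial !(big_nat_recr B.+1) //= !mulrDr.
rewrite -/(hq_partial R 0 B a.+1) -/(hq_partial R 0 B a) IHB /hq /=.
rewrite addSn addnS.
have b0 : B.+1%:R != 0 :> R by rewrite pnatr_eq0.
have b1 : (a + B).+1%:R != 0 :> R by rewrite pnatr_eq0.
have b2 : (a + B).+2%:R != 0 :> R by rewrite pnatr_eq0.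
have e1 : (a + B).+1%:R = a%:R + B.+1%:R :> R by rewrite -natrD addnS.
have e2 : (a + B).+2%:R = a%:R + B.+1%:R + 1 :> R by rewrite -natrD natr1 addnS.
have a1 : a.+1%:R != 0 :> R by rewrite pnatr_eq0.
move: a1 b0 b1 b2; rewrite e1 e2 -[a.+1%:R]natr1.
move: (B.+1%:R : R) (a%:R : R) => y x a1 b0 b1 b2.
have b2' : x + 1 + y != 0 by rewrite addrAC.
by field; rewrite ?a1 ?b0 ?b1 ?b2 ?b2'.
Qed.

Lemma hsym_recur n a : a.+1%:R * hq n.+1 a.+1 = a%:R * hq n.+1 a + hq n a.+1.
Proof.
case: a => [|a]; last by rewrite -(@hqS R n a.+1) // subrK.
by rewrite mul0r add0r mul1r /hq hsymS [hsym _ 0]/= big_nil add0r /inv_succ invr1 mul1r.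
Qed.

(** In generating functions, the sum of Q_(a+b)/b over b >= 1 is the derivative of Q_a. Both sides
    obey the same recursion in a, which needs no initial value because the term with a = 0 is
    multiplied by 0. *)
Lemma hq_partial_cvg n a : (0 < a)%N ->
  hq_partial R n B a @[B --> \oo] --> n.+1%:R * hq n.+1 a.
Proof.
have hq0 m b : hq m (b + B).+1 @[B --> \oo] --> 0.
  by have := @cvgn_shift _ _ b (hq_cvg0 m).
have divide m b : b.+1%:R * hq_partial R m B b.+1 @[B --> \oo] -->
      b.+1%:R * (m.+1%:R * hq m.+1 b.+1) ->
    hq_partial R m B b.+1 @[B --> \oo] --> m.+1%:R * hq m.+1 b.+1.
  have b0 : b.+1%:R != 0 :> R by rewrite pnatr_eq0.
  move/(@cvgnMl b.+1%:R^-1); rewrite mulKf //.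
  by under eq_fun do rewrite mulKf //.
elim: n a => [|n IHn] a.
  elim: a => // a IHa _; apply: divide.
  under eq_fun do rewrite hq_partial0S.
  have -> : a.+1%:R * (1%:R * hq 1 a.+1) = a%:R * hq 1 a + hq 0 a.+1 - 0.
    by rewrite mul1r hsym_recur subr0.
  apply: cvgB; last exact: hq0.
  apply: cvgD; last exact: cvg_cst.
  case: a IHa => [_|a IHa]; last first.
    by apply: cvgnMl; have := IHa isT; rewrite mul1r.
  by under eq_fun do rewrite mul0r; rewrite mul0r; exact: cvg_cst.
elim: a => // a IHa _; apply: divide.
have step B : a.+1%:R * hq_partial R n.+1 B a.+1 = hq_partial R n B a.+1 +
    (a%:R * hq_partial R n.+1 B a + hq n.+1 a.+1 - hq n.+1 (a + B).+1).
  by rewrite -hq_partialS; ring.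
under eq_fun do rewrite step.
have -> : a.+1%:R * (n.+2%:R * hq n.+2 a.+1) = n.+1%:R * hq n.+1 a.+1 +
    (a%:R * (n.+2%:R * hq n.+2 a) + hq n.+1 a.+1 - 0).
  by rewrite mulrCA hsym_recur -[n.+2%:R]natr1; ring.
apply: cvgD; first exact: IHn.
apply: cvgB; last exact: hq0.
apply: cvgD; last exact: cvg_cst.
case: a IHa {step} => [_|a IHa]; last by apply: cvgnMl; apply: IHa.
by under eq_fun do rewrite mul0r; rewrite mul0r; exact: cvg_cst.
Qed.

Lemma hq_ge0 n a : 0 <= hq n a.
Proof. by rewrite divr_ge0 ?hsym_ge0 ?ler0n. Qed.

Lemma hq_partial_le n B a : (0 < a)%N -> 0 <= hq_partial R n B a <= n.+1%:R * hq n.+1 a.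
Proof.
move=> a0; apply/andP; split.
  by rewrite sumr_ge0 // => b _; rewrite divr_ge0 ?hq_ge0 ?ler0n.
have nd : nondecreasing_seq (fun B => hq_partial R n B a).
  apply/nondecreasing_seqP => b; rewrite /hq_partial [leRHS]big_nat_recr //= lerDl.
  by rewrite divr_ge0 ?hq_ge0 ?ler0n.
have lim := @hq_partial_cvg n a a0.
have cv : cvgn (fun B => hq_partial R n B a) by apply/cvg_ex; eexists; exact: lim.
by have := nondecreasing_cvgn_le nd cv B; rewrite (cvg_lim (@norm_hausdorff _ _) lim).
Qed.

Definition word_sum w n N : R := \sum_(0 <= c < N) cw w c.+1 * hsym n c.+1.

Lemma sum_ysh_word_sum w n N : w != [::] -> last true w ->
  \sum_(b <- ysh w) word_sum (false :: b) n N =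
  \sum_(0 <= a < N) cw w a.+1 * hq_partial R n (N.-1 - a) a.+1.
Proof.
move=> w0 gw; rewrite exchange_big /=.
transitivity (\sum_(0 <= c < N) \sum_(0 <= a < c) cw w a.+1 * (hq n c.+1 / (c - a)%:R)).
  apply: eq_bigr => c _; rewrite -mulr_suml -mulr_suml sum_ysh_cw //.
  rewrite big_nat_recl // cw0 // mul0r add0r mulr_suml mulr_suml.
  by apply: eq_bigr => a _; rewrite subSS /hq; ring.
rewrite -triangular_exchange; apply: eq_big_nat => a /andP[_ aN].
rewrite -mulr_sumr; congr (_ * _).
rewrite -[a.+1 in LHS]add1n big_addn /hq_partial.
have -> : ((N.-1 - a).+1 = N - a)%N by lia.
by apply: eq_bigr => b _; rewrite addnK addSn addnC.
Qed.

(** Inserting y at every place before the final letter of the word is differentiation of the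
    generating function over n: the coefficients of the word are paired with partial sums that
    increase to the derivative, so Tannery's theorem applies. *)
Lemma ysh_word_sum_cvg w n (l : R) : w != [::] -> last true w ->
  word_sum (false :: w) n.+1 N @[N --> \oo] --> l ->
  \sum_(b <- ysh w) word_sum (false :: b) n N @[N --> \oo] --> n.+1%:R * l.
Proof.
move=> w0 gw wl; under eq_fun do rewrite sum_ysh_word_sum //.
apply: (@cvg_sum_dominated R (fun a => cw w a.+1) (fun a => n.+1%:R * hq n.+1 a.+1)).
- by move=> a; apply: cw_ge0.
- by move=> N a _; apply: hq_partial_le.
- move=> a; rewrite -(cvg_shiftn a.+1).
  apply: cvg_trans (@hq_partial_cvg n a.+1 isT); apply: near_eq_cvg; near=> N.
  by rewrite /= addnS /= addnK.
move: wl => /(@cvgnMl n.+1%:R); apply: cvg_trans; apply: near_eq_cvg; near=> N.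
rewrite /word_sum mulr_sumr; apply: eq_bigr => a _.
by rewrite /hq [cw (false :: w) _]/=; ring.
Unshelve. all: by end_near. Qed.

End InsertionLimit.

Lemma rword_rev_word_index n w : last true w -> (w != [::]) || (n == 0)%N ->
  rword (rev_word_index n w) = nseq n false ++ w.
Proof.
elim: w n => [|[] w IHw] n /=; first by case: n.
  by move=> gw _; rewrite IHw ?orbT.
move=> gw _; rewrite IHw /=; last by case: w gw {IHw}.
  by elim: n => //= n ->.
by case: w gw {IHw}.
Qed.

Lemma rev_word_index_pos n w : all (leq 1) (rev_word_index n w).
Proof. by elim: w n => [|[] w IHw] n //=. Qed.

Lemma rev_word_index_head n w : last true w -> w != [::] ->
  exists k v, rev_word_index n w = k :: v /\ (n < k)%N.
Proof.
elim: w n => [//|[] w IHw] n /= gw _; first by exists n.+1, (rev_word_index 0 w).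
have w0 : w != [::] by case: w gw {IHw}.
have gw' : last true w by case: w gw w0 {IHw}.
have [k [v [-> nk]]] := IHw n.+1 gw' w0.
by exists k, v; split => //; exact: ltnW.
Qed.

Lemma rev_word_index_false j w : rev_word_index 0 (nseq j false ++ w) = rev_word_index j w.
Proof.
rewrite -[j in RHS]add0n; elim: j 0%N => [|j IHj] m /=; first by rewrite addn0.
by rewrite IHj addSnnS.
Qed.

Lemma rev_word_index_rword u : all (leq 1) u -> rev_word_index 0 (rword u) = u.
Proof.
elim: u => //= k u IHu /andP[k0 u1].
by rewrite rev_word_index_false /= IHu // prednK.
Qed.

Lemma last_rword u : last true (rword u).
Proof. by elim: u => //= k u IHu; rewrite last_cat. Qed.

Lemma rword_adm k v : adm (k :: v) ->
  exists w, [/\ rword (k :: v) = false :: w, w != [::] & last true w].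
Proof.
case/andP => _ k1; exists (nseq k.-2 false ++ true :: rword v).
case: k k1 => [|[|k]] //= _; split => //; first by case: k.
by rewrite last_cat /= last_rword.
Qed.

Lemma last_ysh w b : last true w -> b \in ysh w -> last true b.
Proof.
elim: w b => [|a w IHw] b gw; first by rewrite inE => /eqP->.
rewrite inE => /orP[/eqP->//|/mapP[d dw ->]] /=.
have [w0|w0] := eqVneq w [::]; first by move: dw; rewrite w0 inE => /eqP->.
have gw' : last true w by case: w gw w0 {IHw dw}.
have := IHw d gw' dw; case: d dw => // /ysh_neq0.
by [].
Qed.

Lemma adm_ysh w b : last true w -> b \in ysh w ->
  rword (rev_word_index 0 (false :: b)) = false :: b /\ adm (rev_word_index 0 (false :: b)).
Proof.
move=> gw bw; have b0 := ysh_neq0 bw; have gb := last_ysh gw bw.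
split; first by rewrite rword_rev_word_index //=; case: b gb b0 {bw}.
rewrite /adm rev_word_index_pos /=.
by have [k [v [-> /= k1]]] := rev_word_index_head 1 gb b0.
Qed.

Section CoreLimit.
Variable R : realType.
Local Notation recip := (inv_succ R).
Local Notation zetaN := (zetaN R).
Local Notation Z := (@mzv_span R).

Definition corelim (core : seq nat) (n : nat) : R :=
  limn (fun N => core_sum R N core n).

Lemma core_sum_cvg core n : adm core ->
  core_sum R N core n @[N --> \oo] --> corelim core n.
Proof.
case: core => [|k v] /andP[i1 k1].
  rewrite /corelim /core_sum lim_cst //; exact: cvg_cst.
have /andP[_ v1] := i1.
have cv : cvgn (fun N => core_sum R N (k :: v) n).
  rewrite /core_sum; apply: is_cvgM; first exact: is_cvg_cst.
  exact: core_summable.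
exact: cv.
Qed.

Lemma core_sum_word N k v n : adm (k :: v) ->
  core_sum R N (k :: v) n = (-1) ^+ n * word_sum R (rword (k :: v)) n N.
Proof.
case/andP=> /andP[k0 v1] _; rewrite /core_sum /word_sum; congr (_ * _).
by apply: eq_bigr => c _; rewrite cw_rword.
Qed.

Lemma word_sum_cvg k v n : adm (k :: v) ->
  word_sum R (rword (k :: v)) n N @[N --> \oo] --> (-1) ^+ n * corelim (k :: v) n.
Proof.
move=> av; have /(@cvgnMl R ((-1) ^+ n)) := @core_sum_cvg (k :: v) n av.
by under eq_fun do rewrite core_sum_word // mulrA -signr_odd -expr2 sqrr_sign mul1r.
Qed.

(** The recursion of the shuffle regularization at T = 0: in the product of y with the core followed
    by n ones, n + 1 equal terms lengthen the block of ones and the others insert y into the core.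
    The sign in [core_sum] accounts for the minus. *)
Lemma corelimS k v w n : adm (k :: v) -> rword (k :: v) = false :: w ->
  n.+1%:R * corelim (k :: v) n.+1 =
  - \sum_(b <- ysh w) corelim (rev_word_index 0 (false :: b)) n.
Proof.
move=> av ew; have [w' [ew' w0 gw]] := rword_adm av.
have ww : w' = w by move: ew'; rewrite ew => -[].
move: w0 gw; rewrite ww => w0 gw.
have := @word_sum_cvg k v n.+1 av; rewrite ew => /(ysh_word_sum_cvg w0 gw) l1.
have l2 : \sum_(b <- ysh w) word_sum R (false :: b) n N @[N --> \oo] -->
    \sum_(b <- ysh w) (-1) ^+ n * corelim (rev_word_index 0 (false :: b)) n.
  apply: cvg_sum_seq => b bw; have [eb ab] := adm_ysh gw bw.
  have [k' [v' [e _]]] := rev_word_index_head 1 (last_ysh gw bw) (ysh_neq0 bw).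
  have e' : rev_word_index 0 (false :: b) = k' :: v' := e.
  by rewrite e' in eb ab *; rewrite -eb; apply: word_sum_cvg.
have := @cvg_unique _ (@norm_hausdorff _ R) _ _ _ _ l1 l2.
rewrite -mulr_sumr => e.
have s1 : (-1) ^+ n * (-1) ^+ n = 1 :> R by rewrite -exprD -signr_odd addnn odd_double.
transitivity (- ((-1) ^+ n * (n.+1%:R * ((-1) ^+ n.+1 * corelim (k :: v) n.+1)))).
  by rewrite exprS -[LHS]mul1r -[X in X * _ = _]s1; ring.
by rewrite e mulrA s1 mul1r.
Qed.

Lemma corelim0 core : adm core -> corelim core 0 = mzv R (rev core).
Proof.
move=> ac; rewrite /corelim mzv_lim revK; last exact: zetaN_cvg.
congr (limn _); apply/funext => N.
by have := zetaN_ones R N 0 core; rewrite /convol big_ord1 /elemsym mul1r.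
Qed.

Lemma span_corelim core n : adm core -> Z (corelim core n).
Proof.
elim: n core => [|n IHn] core ac; first by rewrite corelim0 //; apply: span_adm.
case: core ac => [|k v] av.
  by rewrite /corelim /core_sum lim_cst //; apply: span0.
have [w [ew w0 gw]] := rword_adm av.
apply: (@spanVn R n); rewrite (corelimS n av ew); apply: spanN.
by apply: span_sum_seq => b bw; apply: IHn; case: (adm_ysh gw bw).
Qed.

(* The shuffle regularized value at [rev u], see [reg0_shuffle]. *)
Definition fhat u : R := corelim (drop (ones u) u) (ones u).

Lemma adm_core u : all (leq 1) u -> adm (drop (ones u) u).
Proof.
move=> u1; apply/andP; split; first by apply/allP => k /mem_drop; apply: (allP u1).
have := head_drop_ones u; case e: (drop _ _) => [|k v] //= k1.
have : (1 <= k)%N by apply: (allP u1); rewrite (@mem_drop (ones u)) // e inE eqxx.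
by move: k1; lia.
Qed.

Lemma fhatN_cvg u : all (leq 1) u -> fhatN R N u @[N --> \oo] --> fhat u.
Proof. by move=> u1; apply: core_sum_cvg; apply: adm_core. Qed.

Lemma span_fhat u : all (leq 1) u -> Z (fhat u).
Proof. by move=> u1; apply: span_corelim; apply: adm_core. Qed.

Lemma fhat_ones n core : adm core -> fhat (nseq n 1%N ++ core) = corelim core n.
Proof.
move=> /andP[_ hc]; have h : head 0%N core != 1%N by case: core hc => [|[|[]]].
by rewrite /fhat drop_ones_cat // ones_cat.
Qed.

Lemma ysh_nseq p : ysh (nseq p true) = nseq p.+1 (nseq p.+1 true).
Proof. by elim: p => //= p ->; rewrite /= map_nseq. Qed.

Lemma adm2 j : adm (2%N :: nseq j 1%N).
Proof. by rewrite /adm /= all_nseq orbT. Qed.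

Lemma rword2 j : rword (2%N :: nseq j 1%N) = false :: nseq j.+1 true.
Proof. by rewrite /=; congr (_ :: _ :: _); elim: j => //= j ->. Qed.

(** The factor is (-1)^n binomial(n + j + 1, n), cleared of denominators. General j is forced by the
    induction, since each step of [corelimS] moves a one into the core. *)
Lemma corelim2 n j : n`!%:R * (j.+1)`!%:R * corelim (2%N :: nseq j 1%N) n =
  (-1) ^+ n * (n + j).+1`!%:R * mzv R (rev (2%N :: nseq (n + j) 1%N)).
Proof.
elim: n j => [|n IHn] j; first by rewrite corelim0 ?adm2 // expr0 !mul1r.
have step := corelimS n (adm2 j) (rword2 j).
have e : \sum_(b <- ysh (nseq j.+1 true)) corelim (rev_word_index 0 (false :: b)) n =
    j.+2%:R * corelim (2%N :: nseq j.+1 1%N) n.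
  rewrite ysh_nseq big_nseq -[iter _ _ _]/(iter j.+2 (+%R _) 0) iter_addr_0 mulr_natl.
  congr (corelim _ _ *+ _).
  rewrite (_ : false :: _ = rword (2%N :: nseq j.+1 1%N)); last by rewrite rword2.
  by rewrite rev_word_index_rword //=; have /andP[] := adm2 j.+1.
rewrite factS natrM.
have -> : n.+1%:R * n`!%:R * (j.+1)`!%:R * corelim (2%N :: nseq j 1%N) n.+1 =
  - (n`!%:R * (j.+2)`!%:R * corelim (2%N :: nseq j.+1 1%N) n).
  rewrite [(j.+2)`!]factS natrM.
  transitivity (n`!%:R * (j.+1)`!%:R * (n.+1%:R * corelim (2%N :: nseq j 1%N) n.+1)); first by ring.
  by rewrite step e; ring.
by rewrite IHn !addnS addSn exprS; ring.
Qed.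

Lemma fhat_ones2 q : fhat (nseq q 1%N ++ [:: 2%N]) = (-1) ^+ q * q.+1%:R * mzv R (rev (2%N :: nseq q 1%N)).
Proof.
rewrite fhat_ones; last exact: (adm2 0).
have q0 : q`!%:R != 0 :> R by rewrite pnatr_eq0 -lt0n fact_gt0.
apply: (mulfI q0); have := corelim2 q 0.
rewrite addn0 [q.+1`!]factS natrM (_ : 1`!%:R = 1 :> R) // mulr1 => ->; ring.
Qed.

End CoreLimit.

(** * Vanishing of the boundary terms *)

Lemma all2_leq_index v u : size u = size v -> all2 leq v u -> all (leq 1) v -> all (leq 1) u.
Proof.
elim: v u => [|k v IHv] [|l u] //= [su] /andP[kl vu] /andP[k0 v1].
by rewrite (leq_trans k0 kl) (IHv u su vu v1).
Qed.

Lemma index_size_sumn u : all (leq 1) u -> (size u <= sumn u)%N.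
Proof. by elim: u => //= k u IHu /andP[k0 /IHu]; lia. Qed.

Lemma index_has_gt1 u : all (leq 1) u -> (size u < sumn u)%N -> has (leq 2) u.
Proof.
elim: u => //= k u IHu /andP[k0 u1] h; case: (leqP 2 k) => //= k2.
by apply: IHu => //; lia.
Qed.

Section BoundaryLimit.
Variable R : realType.
Local Notation recip := (inv_succ R).
Local Notation zetaN := (zetaN R).
Local Notation logb := (logb R).
Local Notation bc := (boundary_coef R).

Lemma recip_homo a b : (a <= b)%N -> recip b <= recip a.
Proof. by move=> ab; rewrite lef_pV2 ?posrE ?ltr0n // ler_nat. Qed.

Lemma tadic_cvg (F : nat -> seq nat -> R) (G : seq nat -> R) v n :
  (forall u, size u = size v -> all2 leq v u -> sumn u = (sumn v + n)%N ->
    F N u @[N --> \oo] --> G u) ->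
  tadic v (F N) n @[N --> \oo] --> tadic v G n.
Proof.
elim: v F G n => [|k v IHv] F G n FG.
  rewrite /=; case: n FG => [|n] FG /=; first by apply: cvgnMl; apply: FG.
  by under eq_fun do rewrite mul0r; rewrite mul0r; exact: cvg_cst.
rewrite /=; apply: cvg_sum_seq => l _; apply: cvgnMl; apply: IHv => u su lu eu.
apply: FG => /=; rewrite ?su ?leq_addr //.
by rewrite eu; have := ltn_ord l; lia.
Qed.

Lemma boundary_coef_ge0 N l nu : 0 <= bc N l nu.
Proof.
by rewrite addr_ge0 ?mulr_ge0 ?ler0n ?sumr_ge0 // => m _; rewrite ?exprn_ge0 // recip_ge0.
Qed.

(** Each of the two sums has at most c + 1 terms, none larger than [recip (N.-1 - c)]. *)
Lemma boundary_coef0_le N c : (c < N)%N -> bc N 0 c.+1 <= 2%:R * c.+1%:R * recip (N.-1 - c).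
Proof.
move=> cN; rewrite /boundary_coef mul1r.
have bound p q : (N.-1 - c <= p)%N -> \sum_(p <= m < q) recip m <= (q - p)%:R * recip (N.-1 - c).
  move=> h; rewrite mulr_natl -sumr_const_nat; apply: ler_sum_nat => m /andP[pm _].
  by apply: recip_homo; exact: leq_trans h pm.
rewrite -mulrA mulr_natl mulr2n; apply: lerD.
  apply: le_trans (bound _ _ _) _; first by lia.
  by rewrite ler_wpM2r ?recip_ge0 // ler_nat; lia.
under eq_bigr do rewrite expr1.
apply: le_trans (bound _ _ _) _; first by lia.
by rewrite ler_wpM2r ?recip_ge0 // ler_nat; lia.
Qed.

Lemma boundary_coefS_le N l nu : bc N l.+1 nu <= nu%:R * recip N ^+ 2.
Proof.
rewrite /boundary_coef mul0r add0r -{2}[nu](addKn N) mulr_natl -sumr_const_nat.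
apply: ler_sum_nat => m /andP[Nm _]; apply: (@le_trans _ _ (recip m ^+ 2)).
  by rewrite recip_pow2.
by rewrite lerXn2r ?nnegrE ?recip_ge0 // recip_homo.
Qed.

Lemma boundary_sum0_le N :
  \sum_(0 <= c < N) recip c ^+ 2 * bc N 0 c.+1 <= 4%:R * (recip N * logb N ^+ 1).
Proof.
(* By the previous bound a term is at most 2/(x y) with x = c + 1 and y = N - c. As x + y = N + 1,
   this is 2/(N + 1) times 1/x + 1/y. *)
apply: (@le_trans _ _ (\sum_(0 <= c < N) 2%:R * recip N * (recip c + recip (N.-1 - c)))).
  apply: ler_sum_nat => c /andP[_ cN].
  apply: (le_trans (ler_wpM2l _ (boundary_coef0_le cN))); first by rewrite exprn_ge0 // recip_ge0.
  have c0 : c.+1%:R != 0 :> R by rewrite pnatr_eq0.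
  have n0 : (N.-1 - c).+1%:R != 0 :> R by rewrite pnatr_eq0.
  have e : N.+1%:R = c.+1%:R + (N.-1 - c).+1%:R :> R by rewrite -natrD; congr (_%:R); lia.
  have N0 : N.+1%:R != 0 :> R by rewrite pnatr_eq0.
  rewrite /inv_succ; move: N0; rewrite e; move: c0 n0.
  move: (c.+1%:R : R) ((N.-1 - c).+1%:R : R) => x y x0 y0 xy0.
  by rewrite le_eqVlt; apply/orP; left; apply/eqP; field; rewrite ?x0 ?y0 ?xy0.
rewrite -mulr_sumr big_split /= [X in _ + X]big_nat_rev /=.
have -> : \sum_(0 <= i < N) recip (N.-1 - (0 + N - i.+1)) = harmonic_sum R N.
  by apply: eq_big_nat => i /andP[_ iN]; congr recip; lia.
rewrite -/(harmonic_sum R N) expr1.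
have := harmonic_le_logb R N; have := recip_ge0 R N.
have := harmonic_sum_ge0 R N; nra.
Qed.

Lemma lnest_ge0 N ks a : 0 <= lnest recip N ks (fun=> 1) a.
Proof.
elim: ks a => [|k ks IHks] a //=.
by rewrite sumr_ge0 // => b _; rewrite mulr_ge0 // exprn_ge0 // recip_ge0.
Qed.

Lemma harmonic_tail_le N a z : 0 <= z -> \sum_(a <= b < N) recip b * z <= logb N * z.
Proof.
move=> z0; rewrite -mulr_suml ler_wpM2r // (le_trans _ (harmonic_le_logb _ _)) //.
case: (leqP a N) => aN; last by rewrite big_geq ?harmonic_sum_ge0 // ltnW.
by rewrite /harmonic_sum [leRHS](@big_cat_nat _ _ _ a) //= lerDr sumr_ge0 // => b _; apply: recip_ge0.
Qed.

Lemma lnest_le N ks a : all (leq 1) ks ->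
  lnest recip N ks (fun=> 1) a <= logb N ^+ size ks.
Proof.
elim: ks a => [|k ks IHks] a //= /andP[k0 ks1]; rewrite exprS.
apply: le_trans (harmonic_tail_le N a (exprn_ge0 _ (logb_ge0 R N))).
by apply: ler_sum_nat => b _; rewrite ler_pM ?exprn_ge0 ?lnest_ge0 ?recip_pow ?IHks ?recip_ge0.
Qed.

(** One factor 1/(b + 1) of an entry that is at least 2 is bounded by [recip a]; the rest is bounded
    by powers of the logarithm as in [lnest_le]. *)
Lemma lnest_le_gt1 N ks a : all (leq 1) ks -> has (leq 2) ks ->
  lnest recip N ks (fun=> 1) a.+1 <= recip a * logb N ^+ size ks.
Proof.
elim: ks a => [|k ks IHks] a //= /andP[k0 ks1] h; rewrite exprS mulrCA.
have z0 : 0 <= recip a * logb N ^+ size ks by rewrite mulr_ge0 ?recip_ge0 ?exprn_ge0 ?logb_ge0.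
apply: le_trans (harmonic_tail_le N a.+1 z0).
apply: ler_sum_nat => b /andP[ab _].
case/orP: h => [k2|h].
  rewrite mulrA ler_pM ?exprn_ge0 ?lnest_ge0 ?recip_ge0 ?lnest_le //.
  by rewrite (le_trans (recip_pow2 _ _ k2)) // expr2 ler_wpM2l ?recip_ge0 ?recip_homo // ltnW.
rewrite ler_pM ?exprn_ge0 ?lnest_ge0 ?recip_pow ?recip_ge0 //.
by rewrite (le_trans (IHks b ks1 h)) // ler_wpM2r ?exprn_ge0 ?logb_ge0 // recip_homo // ltnW.
Qed.

(** For l > 0 the weight is at most (c + 1)/(N + 1)^2, which is small enough. For l = 0 it is of
    order (c + 1)/(N - c), so a second factor 1/(c + 1) is needed at the smallest index; an entry
    that is at least 2 supplies it, directly or through [lnest_le_gt1]. *)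
Lemma rnest_boundary_cvg0 u l : all (leq 1) u -> u != [::] ->
  (0 < l)%N || has (leq 2) u ->
  rnest recip N u (fun c => bc N l c.+1) @[N --> \oo] --> 0.
Proof.
move=> u1 u0 hl; rewrite -[u]revK.
have : all (leq 1) (rev u) by rewrite all_rev.
have : (0 < l)%N || has (leq 2) (rev u) by rewrite has_rev.
have : rev u != [::] by rewrite -size_eq0 size_rev size_eq0.
case: (rev u) => // k ks _ {u1 u0}hl /andP[k0 ks1] /=.
apply: (@squeeze_cvgr _ _ _ _ (fun=> 0) (fun N => 4%:R * (recip N * logb N ^+ (size ks).+1))).
- near=> N; rewrite rnest_rev sumr_ge0 /=; last first.
    by move=> b _; rewrite !mulr_ge0 ?exprn_ge0 ?recip_ge0 ?lnest_ge0 ?boundary_coef_ge0.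
  case: l hl => [|l] /= hl; last first.
    apply: (@le_trans _ _ (\sum_(0 <= b < N) recip N ^+ 2 * logb N ^+ size ks)).
      apply: ler_sum_nat => b _.
      rewrite ler_pM ?mulr_ge0 ?exprn_ge0 ?recip_ge0 ?lnest_ge0 ?lnest_le ?boundary_coef_ge0 //.
      apply: le_trans (ler_pM _ _ (recip_pow _ _ k0) (boundary_coefS_le N l b.+1)) _; rewrite ?exprn_ge0 ?recip_ge0 ?boundary_coef_ge0 //.
      by rewrite mulrA mulVf ?mul1r // pnatr_eq0.
    rewrite sumr_const_nat subn0 -mulr_natl expr2.
    have N1 : N%:R * recip N <= 1.
      by rewrite ler_pdivrMr ?ltr0n // mul1r ler_nat.
    have := recip_ge0 R N; have := logb_ge1 R N; have Lp := exprn_ge0 (size ks) (logb_ge0 R N).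
    rewrite exprS => L1 r0; move: Lp N1; set L := logb N ^+ size ks => Lp N1.
    have : recip N * L <= recip N * (logb N * L) by rewrite ler_wpM2l // ler_peMl.
    have rL : 0 <= recip N * L by rewrite mulr_ge0.
    have : N%:R * recip N * (recip N * L) <= recip N * L by rewrite ler_piMl.
    nra.
  apply: (@le_trans _ _ (\sum_(0 <= b < N) recip b ^+ 2 * bc N 0 b.+1 * logb N ^+ size ks)); last first.
    rewrite -mulr_suml exprS [recip N * _]mulrA [4%:R * _]mulrA.
    rewrite ler_wpM2r ?exprn_ge0 ?logb_ge0 //.
    by have := boundary_sum0_le N; rewrite expr1.
  apply: ler_sum_nat => b _; rewrite mulrAC [leRHS]mulrAC ler_wpM2r ?boundary_coef_ge0 //.
  case/orP: hl => [k2|h].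
    by rewrite ler_pM ?exprn_ge0 ?recip_ge0 ?lnest_ge0 ?recip_pow2 ?lnest_le.
  rewrite expr2 -mulrA ler_pM ?exprn_ge0 ?recip_ge0 ?lnest_ge0 ?recip_pow //.
  exact: lnest_le_gt1.
- exact: cvg_cst.
- rewrite -(mulr0 4%:R); apply: cvgnMl; exact: recip_logb_cvg0.
Unshelve. all: by end_near. Qed.

(** When the weight takes t^0, the entries of u have the sum [sumn w + m], which exceeds their
    number, so one of them is at least 2. *)
Lemma boundary_sum_cvg0 w m : all (leq 1) w -> w != [::] ->
  (size w < sumn w + m)%N -> boundary_sum R N w m @[N --> \oo] --> 0.
Proof.
move=> w1 w0 hw.
have h : boundary_sum R N w m @[N --> \oo] -->
    ((-1) ^+ sumn w * (\sum_(l < m.+1) tadic w (fun=> 0 * 0) (m - l)) - 0 : R); last first.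
  by move: h; rewrite subr0 big1 => [|l _]; [rewrite mulr0|rewrite tadicZ mul0r].
apply: cvgB; last first.
  apply: rnest_boundary_cvg0; first by rewrite all_rev.
    by rewrite -size_eq0 size_rev size_eq0.
  rewrite has_rev; case: m hw => // hw /=; apply: index_has_gt1 => //.
  by move: hw; rewrite addn0.
apply: cvgnMl; apply: cvg_sum_seq => l _; apply: tadic_cvg => u su wu eu.
rewrite mul0r; have u1 := all2_leq_index su wu w1.
apply: rnest_boundary_cvg0 => //; first by rewrite -size_eq0 su size_eq0.
case: (posnP l) => // l0; rewrite /=; apply: index_has_gt1 => //.
by rewrite su eu l0 subn0.
Qed.

End BoundaryLimit.

(** * Even zeta values *)

Section EvenZeta.
Variable R : realType.
Local Notation recip := (inv_succ R).
Local Notation zetaN := (zetaN R).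
Local Notation bc := (boundary_coef R).
Local Notation Z := (@mzv_span R).

Lemma zetaN1 N k : zetaN N [:: k] = \sum_(0 <= c < N) recip c ^+ k.
Proof. by apply: eq_bigr => c _; rewrite mulr1. Qed.

(* Equal to 1 / ((b + 1)^2 - (a + 1)^2), and to 0 when a = b. *)
Definition sqdiff a b : R := recip a ^+ 2 * recip b ^+ 2 / (recip a ^+ 2 - recip b ^+ 2).

Lemma sqdiffC a b : sqdiff b a = - sqdiff a b.
Proof. by rewrite /sqdiff -opprB invrN mulrN [recip b ^+ 2 * _]mulrC. Qed.

Lemma sqdiff_lt a b : (a < b)%N ->
  sqdiff a b = recip a / 2 * (((b - a)%:R)^-1 - recip (b + a).+1).
Proof.
move=> ab; rewrite /sqdiff /inv_succ.
have e1 : (b - a)%:R = b.+1%:R - a.+1%:R :> R by rewrite -natrB ?subSS // ltnW.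
have e2 : (b + a).+2%:R = b.+1%:R + a.+1%:R :> R by rewrite -natrD addSn addnS.
have d0 : b.+1%:R - a.+1%:R != 0 :> R by rewrite -e1 pnatr_eq0; lia.
have s0 : b.+1%:R + a.+1%:R != 0 :> R by rewrite -e2 pnatr_eq0.
have a0 : a.+1%:R != 0 :> R by rewrite pnatr_eq0.
have b0 : b.+1%:R != 0 :> R by rewrite pnatr_eq0.
rewrite e1 e2; move: d0 s0 a0 b0; move: (b.+1%:R : R) (a.+1%:R : R) => y x d0 s0 x0 y0.
have -> : x^-1 ^+ 2 - y^-1 ^+ 2 = (y - x) * (y + x) / (x ^+ 2 * y ^+ 2) by field; rewrite x0 y0.
by field; rewrite ?d0 ?s0 ?x0 ?y0.
Qed.

Lemma sqdiff_gt a b : (b < a)%N ->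
  sqdiff a b = recip a / 2 * (- ((a - b)%:R)^-1 - recip (b + a).+1).
Proof.
move=> ba; rewrite sqdiffC sqdiff_lt // /inv_succ.
have e1 : (a - b)%:R = a.+1%:R - b.+1%:R :> R by rewrite -natrB ?subSS // ltnW.
have e2 : (a + b).+2%:R = b.+1%:R + a.+1%:R :> R by rewrite -natrD addSn addnS addnC.
rewrite [(b + a)%N]addnC.
have d0 : a.+1%:R - b.+1%:R != 0 :> R by rewrite -e1 pnatr_eq0; lia.
have s0 : b.+1%:R + a.+1%:R != 0 :> R by rewrite -e2 pnatr_eq0.
have a0 : a.+1%:R != 0 :> R by rewrite pnatr_eq0.
have b0 : b.+1%:R != 0 :> R by rewrite pnatr_eq0.
rewrite e1 e2; move: d0 s0 a0 b0; move: (b.+1%:R : R) (a.+1%:R : R) => y x d0 s0 x0 y0.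
by field; rewrite ?d0 ?s0 ?x0 ?y0.
Qed.

(** The classical value 3/(4 A^2) of the sum of 1/(B^2 - A^2) over B different from A, with the
    error of the cut-off. This error is the boundary weight of the cyclic sum again, so
    [rnest_boundary_cvg0] disposes of it too. *)
Lemma sum_sqdiff N a : (a < N)%N ->
  \sum_(0 <= b < N) sqdiff a b = 3 / 4 * recip a ^+ 2 - recip a / 2 * bc N 0 a.+1.
Proof.
move=> aN; rewrite (@big_cat_nat _ _ _ a) //=; last exact: ltnW.
rewrite [\sum_(a <= _ < _) _]big_ltn // {2}/sqdiff subrr invr0 mulr0 add0r.
pose f m : R := m%:R^-1.
have -> : \sum_(0 <= b < a) sqdiff a b =
    recip a / 2 * (- \sum_(0 <= b < a) f (a - b)%N - \sum_(0 <= b < a) f (b + a.+1).+1).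
  rewrite -sumrN -sumrB mulr_sumr; apply: eq_big_nat => b /andP[_ ba].
  by rewrite sqdiff_gt // addnS.
have -> : \sum_(a.+1 <= b < N) sqdiff a b =
    recip a / 2 * (\sum_(a.+1 <= b < N) f (b - a)%N - \sum_(a.+1 <= b < N) f (b + a.+1).+1).
  rewrite -sumrB mulr_sumr; apply: eq_big_nat => b /andP[ab _].
  by rewrite sqdiff_lt // addnS.
rewrite pre_reflect ?leqnn ?andbT // pre_unshift ?ltnSn ?aN // !pre_shift //.
rewrite subnn subSS subnn subn0 add0n.
rewrite /boundary_coef mul1r.
have H m : \sum_(0 <= i < m) f i.+1 = harmonic_sum R m by rewrite /f.
have B p q : (p <= q)%N -> \sum_(p <= m < q) recip m = harmonic_sum R q - harmonic_sum R p.
  by move=> pq; rewrite /harmonic_sum (@big_cat_nat _ _ _ p 0 q) //= addrAC subrr add0r.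
under [\sum_(N <= _ < _) _]eq_bigr do rewrite expr1.
have h0 : harmonic_sum R 0 = 0 by rewrite /harmonic_sum big_geq.
rewrite !H !B ?leq_addr ?leq_subr // ?h0.
have -> : harmonic_sum R (a + a.+1) = harmonic_sum R (a.+1 + a.+1) - recip a / 2.
  rewrite addSn {2}/harmonic_sum big_nat_recr //= -/(harmonic_sum R _).
  rewrite /inv_succ addnS (_ : (a + a).+2 = 2 * a.+1)%N; last by lia.
  by rewrite natrM invfM; ring.
have -> : harmonic_sum R a.+1 = harmonic_sum R a + recip a.
  by rewrite /harmonic_sum big_nat_recr.
by field.
Qed.

(** Euler's recurrence, truncated. The diagonal gives (n - 1) zeta(2n); off the diagonal, partial
    fractions in the squares and [sum_sqdiff] give 2 * 3/4 more copies, together n + 1/2. *)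
Lemma sum_products N n : (1 < n)%N ->
  \sum_(1 <= k < n) zetaN N [:: (2 * k)%N] * zetaN N [:: (2 * (n - k))%N] =
  (n%:R + 1 / 2) * zetaN N [:: (2 * n)%N] -
  rnest recip N [:: (2 * n).-1] (fun c => bc N 0 c.+1).
Proof.
move=> n1.
pose S a b := \sum_(1 <= k < n) (recip a ^+ 2) ^+ k * (recip b ^+ 2) ^+ (n - k).
have -> : \sum_(1 <= k < n) zetaN N [:: (2 * k)%N] * zetaN N [:: (2 * (n - k))%N] =
    \sum_(0 <= a < N) \sum_(0 <= b < N) S a b.
  under eq_bigr do rewrite !zetaN1 mulr_suml.
  rewrite exchange_big; apply: eq_bigr => a _ /=.
  under eq_bigr do rewrite mulr_sumr.
  rewrite exchange_big; apply: eq_bigr => b _ /=.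
  by apply: eq_bigr => k _; rewrite !exprM.
have SE a b : (recip a ^+ 2 - recip b ^+ 2) * S a b =
    recip a ^+ 2 * recip b ^+ 2 * ((recip a ^+ 2) ^+ n.-1 - (recip b ^+ 2) ^+ n.-1).
  rewrite [in RHS]subrXX mulrCA; congr (_ * _); rewrite mulr_sumr /S big_add1 big_mkord.
  rewrite (reindex_inj rev_ord_inj); apply: eq_bigr => -[i ni] _ /=.
  by rewrite mulrACA -!exprS; congr (_ ^+ _ * _ ^+ _); lia.
have diag a : S a a = n.-1%:R * recip a ^+ (2 * n).
  rewrite /S (eq_big_nat _ _ (F2 := fun=> recip a ^+ (2 * n))); last first.
    by move=> k /andP[_ kn]; rewrite -exprD -exprM subnKC // ltnW.
  by rewrite sumr_const_nat mulr_natl subn1.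
have off a b : a != b ->
    S a b = ((recip a ^+ 2) ^+ n.-1 - (recip b ^+ 2) ^+ n.-1) * sqdiff a b.
  move=> ab; have d0 : recip a ^+ 2 - recip b ^+ 2 != 0.
    rewrite subr_eq0 eqrXn2 ?recip_ge0 // (inj_eq invr_inj) eqr_nat eqSS //.
  apply: (mulfI d0); rewrite SE /sqdiff; field; exact: d0.
have E a : (a < N)%N -> \sum_(0 <= b < N) S a b = n.-1%:R * recip a ^+ (2 * n) +
    \sum_(0 <= b < N) ((recip a ^+ 2) ^+ n.-1 - (recip b ^+ 2) ^+ n.-1) * sqdiff a b.
  move=> aN; have mem : a \in index_iota 0 N by rewrite mem_index_iota.
  rewrite !(bigD1_seq a) ?iota_uniq //= diag subrr mul0r add0r; congr (_ + _).
  by apply: eq_bigr => b ba; rewrite off // eq_sym.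
rewrite (eq_big_nat _ _ (F2 := fun a => n.-1%:R * recip a ^+ (2 * n) +
    \sum_(0 <= b < N) ((recip a ^+ 2) ^+ n.-1 - (recip b ^+ 2) ^+ n.-1) * sqdiff a b)); last first.
  by move=> a /andP[_ aN]; apply: E.
rewrite big_split /= -mulr_sumr -zetaN1.
have -> : \sum_(0 <= a < N) \sum_(0 <= b < N)
      ((recip a ^+ 2) ^+ n.-1 - (recip b ^+ 2) ^+ n.-1) * sqdiff a b =
    2 * \sum_(0 <= a < N) (recip a ^+ 2) ^+ n.-1 * \sum_(0 <= b < N) sqdiff a b.
  under eq_bigr do under eq_bigr do rewrite mulrBl.
  under eq_bigr do rewrite sumrB.
  rewrite sumrB [X in _ - X]exchange_big /= -sumrB mulr_sumr; apply: eq_bigr => a _.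
  rewrite -[X in X - _]mulr_sumr [X in _ - X](eq_bigr (fun b => - ((recip a ^+ 2) ^+ n.-1 * sqdiff a b))); last first.
    by move=> b _; rewrite sqdiffC mulrN.
  by rewrite sumrN -mulr_sumr; ring.
rewrite mulr_sumr (eq_big_nat _ _ (F2 := fun a => 3 / 2 * recip a ^+ (2 * n) -
    recip a ^+ (2 * n).-1 * bc N 0 a.+1)); last first.
  move=> a /andP[_ aN]; rewrite sum_sqdiff // -exprM.
  have -> : recip a ^+ (2 * n) = recip a ^+ (2 * n.-1) * recip a ^+ 2.
    by rewrite -exprD; congr (_ ^+ _); lia.
  have -> : recip a ^+ (2 * n).-1 = recip a ^+ (2 * n.-1) * recip a.
    by rewrite -exprSr; congr (_ ^+ _); lia.
  by field.
rewrite sumrB -mulr_sumr -zetaN1 /=.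
have -> : n%:R = n.-1%:R + 1 :> R by rewrite natr1 prednK // ltnW.
by field.
Qed.

Lemma adm1 k : (1 < k)%N -> adm [:: k].
Proof. by move=> k1; rewrite /adm /= k1 (ltnW k1). Qed.

Lemma zeta_even_recurrence n : (1 < n)%N ->
  \sum_(1 <= k < n) mzv R [:: (2 * k)%N] * mzv R [:: (2 * (n - k))%N] =
  (n%:R + 1 / 2) * mzv R [:: (2 * n)%N].
Proof.
move=> n1.
have zc k : (0 < k)%N -> zetaN N [:: (2 * k)%N] @[N --> \oo] --> mzv R [:: (2 * k)%N].
  by move=> k0; apply: (@adm_cvg R [:: _]); apply: adm1; lia.
have l1 : \sum_(1 <= k < n) zetaN N [:: (2 * k)%N] * zetaN N [:: (2 * (n - k))%N] @[N --> \oo] -->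
    \sum_(1 <= k < n) mzv R [:: (2 * k)%N] * mzv R [:: (2 * (n - k))%N].
  apply: cvg_sum_seq => k; rewrite mem_index_iota => /andP[k1 kn].
  by apply: cvgM; apply: zc => //; rewrite subn_gt0.
have l2 : (n%:R + 1 / 2) * zetaN N [:: (2 * n)%N] -
      rnest recip N [:: (2 * n).-1] (fun c => bc N 0 c.+1) @[N --> \oo] -->
    (n%:R + 1 / 2) * mzv R [:: (2 * n)%N] - 0.
  apply: cvgB; first by apply: cvgnMl; apply: zc; lia.
  by apply: rnest_boundary_cvg0 => //=; lia.
rewrite subr0 in l2; apply: (@cvg_unique _ (@norm_hausdorff _ R) _ _ _ _ _ l2).
by move: l1; under eq_fun do rewrite sum_products //.
Qed.

Definition zeta2_ideal (a : R) := exists2 c, Z c & a = mzv R [:: 2%N] * c.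

Lemma zeta2_ideal_span a : zeta2_ideal a -> Z a.
Proof. by move=> [c Zc ->]; apply: spanM => //; apply: span_mzv. Qed.

Lemma zeta2_ideal0 : zeta2_ideal 0.
Proof. by exists 0; [exact: span0|rewrite mulr0]. Qed.

Lemma zeta2_idealD a b : zeta2_ideal a -> zeta2_ideal b -> zeta2_ideal (a + b).
Proof.
move=> [c Zc ->] [d Zd ->]; exists (c + d); first exact: spanD.
by rewrite mulrDr.
Qed.

Lemma zeta2_idealM a b : Z a -> zeta2_ideal b -> zeta2_ideal (a * b).
Proof.
move=> Za [d Zd ->]; exists (a * d); first exact: spanM.
by rewrite mulrCA.
Qed.

Lemma zeta2_idealN a : zeta2_ideal a -> zeta2_ideal (- a).
Proof. by move=> ia; rewrite -mulN1r; apply: zeta2_idealM => //; apply/spanN/span1. Qed.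

Lemma zeta2_idealMr a b : zeta2_ideal a -> Z b -> zeta2_ideal (a * b).
Proof. by move=> ia Zb; rewrite mulrC; apply: zeta2_idealM. Qed.

Lemma zeta2_ideal_sum_seq (I : eqType) (r : seq I) (F : I -> R) :
  (forall i, i \in r -> zeta2_ideal (F i)) -> zeta2_ideal (\sum_(i <- r) F i).
Proof.
move=> H; rewrite big_seq; elim/big_ind: _ => //; first exact: zeta2_ideal0.
exact: zeta2_idealD.
Qed.

Lemma zeta2_idealVn n a : zeta2_ideal (n.+1%:R * a) -> zeta2_ideal a.
Proof.
move=> [c Zc e]; have n0 : n.+1%:R != 0 :> R by rewrite pnatr_eq0.
exists (n.+1%:R^-1 * c); last by apply: (mulfI n0); rewrite e mulrCA mulVKf.
by apply: (@spanVn R n); rewrite mulVKf.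
Qed.

Lemma zeta_even n : (0 < n)%N -> zeta2_ideal (mzv R [:: (2 * n)%N]).
Proof.
elim/ltn_ind: n => n IHn n0; case: (leqP n 1) => n1.
  have -> : n = 1%N by lia.
  by exists 1; [exact: span1|rewrite mulr1].
apply: (@zeta2_idealVn (2 * n)).
have -> : (2 * n).+1%:R * mzv R [:: (2 * n)%N] = 2 * ((n%:R + 1 / 2) * mzv R [:: (2 * n)%N]).
  by rewrite -natr1 natrM; field.
rewrite -zeta_even_recurrence //; apply: zeta2_idealM; first by rewrite -[2]mulr1; apply/spanMn/span1.
apply: zeta2_ideal_sum_seq => k; rewrite mem_index_iota => /andP[k1 kn].
apply: zeta2_idealMr; first exact: IHn.
by apply: span_mzv; rewrite /admissible /is_index /=; lia.
Qed.

End EvenZeta.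

(** * Duality in height one *)

Section HeightOneDuality.
Variable R : realType.
Local Notation recip := (inv_succ R).
Local Notation zetaN := (zetaN R).
Local Notation cw := (cw R).

(* The connector a! c! / (a + c)! of Seki and Yamamoto. *)
Definition connector a c : R := ('C(a + c, a)%:R)^-1.

Lemma connectorC a c : connector a c = connector c a.
Proof. by rewrite /connector -[in RHS](bin_sub (leq_addr a c)) addKn addnC. Qed.

Lemma connector0 c : connector 0 c = 1.
Proof. by rewrite /connector bin0 invr1. Qed.

Lemma connector_ge0 a c : 0 <= connector a c.
Proof. by rewrite invr_ge0. Qed.

(** The transport relation: a factor 1/(a + 1) is traded for a difference in a, which telescopes,
    and a factor 1/(c + 1). *)
Lemma connectorS a c :
  connector a.+1 c.+1 * recip a = (connector a c.+1 - connector a.+1 c.+1) * recip c.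
Proof.
rewrite /connector /inv_succ.
have e : a.+1%:R * 'C(a.+1 + c.+1, a.+1)%:R = (a.+1%:R + c.+1%:R) * 'C(a + c.+1, a)%:R :> R.
  by rewrite -natrD -!natrM addSn -mul_bin_diag.
have p0 : 'C(a + c.+1, a)%:R != 0 :> R by rewrite pnatr_eq0 -lt0n bin_gt0 leq_addr.
have q0 : 'C(a.+1 + c.+1, a.+1)%:R != 0 :> R by rewrite pnatr_eq0 -lt0n bin_gt0 leq_addr.
have a0 : a.+1%:R != 0 :> R by rewrite pnatr_eq0.
have c0 : c.+1%:R != 0 :> R by rewrite pnatr_eq0.
move: e p0 q0 a0 c0; move: ('C(_, _)%:R : R) ('C(_, _)%:R : R) (a.+1%:R : R) (c.+1%:R : R).
move=> p q x y e p0 q0 x0 y0.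
apply: (mulIf y0); rewrite mulfVK //; apply: (mulIf (mulf_neq0 (mulf_neq0 x0 q0) p0)).
transitivity (y * p); first by field; rewrite x0 q0.
transitivity (x * q - x * p); last by field; rewrite p0 q0.
by rewrite e; ring.
Qed.

Lemma connector_le_recip a c : connector a c.+1 <= recip a.
Proof.
rewrite /connector lef_pV2 ?posrE ?ltr0n ?bin_gt0 ?leq_addr // ler_nat.
by rewrite -[leqLHS](binSn a) leq_bin2l // addnS ltnS leq_addr.
Qed.

Lemma connector_homo c : {homo connector^~ c.+1 : a b / (a <= b)%N >-> b <= a}.
Proof.
move=> a b /subnK <-; elim: (b - a)%N => // d; rewrite addSn => /(le_trans _); apply.
have c0 : 0 < recip c by apply: recip_gt0.
rewrite -subr_ge0 -(pmulr_lge0 _ c0) -connectorS.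
by rewrite mulr_ge0 ?connector_ge0 ?recip_ge0.
Qed.

Lemma connector_cvg0 c : connector N c.+1 @[N --> \oo] --> 0.
Proof.
apply: (@squeeze_cvgr _ _ _ _ (fun=> 0) recip).
- by near=> N; rewrite connector_ge0 connector_le_recip.
- exact: cvg_cst.
- exact: recip_cvg0.
Unshelve. all: by end_near. Qed.

Lemma sum_connector a c M : (a < M)%N ->
  \sum_(a.+1 <= m < M) connector m c.+1 / m%:R =
  (connector a c.+1 - connector M.-1 c.+1) * recip c.
Proof.
move=> aM; rewrite big_add1.
rewrite (eq_bigr (fun m => (- (connector m.+1 c.+1 * recip c)) - (- (connector m c.+1 * recip c)))); last first.
  by move=> m _; rewrite -/(inv_succ R m) connectorS; ring.
by rewrite telescope_sumr; [ring|lia].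
Qed.

(** Each letter y crosses the connector and turns into a factor 1/(c + 1), because the sum over its
    index telescopes by [sum_connector]. *)
Lemma connected_sum_cvg p c :
  \sum_(0 <= m < M) cw (nseq p true) m * connector m c.+1 @[M --> \oo] --> recip c ^+ p.
Proof.
elim: p => [|p IHp].
  apply: cvg_near_cst; near=> M.
  have M0 : (0 < M)%N by near: M; exact: nbhs_infty_gt.
  rewrite -(prednK M0) big_nat_recl // big1 => [|i _]; last by rewrite mul0r.
  by rewrite /= connector0 mulr1 addr0.
have e M : \sum_(0 <= m < M) cw (nseq p.+1 true) m * connector m c.+1 =
    \sum_(0 <= a < M) cw (nseq p true) a *
      ((connector a c.+1 - connector M.-1 c.+1) * recip c).
  rewrite (eq_bigr (fun m => \sum_(0 <= a < m) cw (nseq p true) a * (connector m c.+1 / m%:R))).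
    rewrite -triangular_exchange; apply: eq_big_nat => a /andP[_ aM].
    by rewrite -mulr_sumr sum_connector.
  by move=> m _; rewrite /= -!mulr_suml; ring.
under eq_fun do rewrite e.
apply: (@cvg_sum_dominated R (cw (nseq p true)) (fun a => connector a c.+1 * recip c)).
- by move=> a; apply: cw_ge0.
- move=> N a aN; have c0 := recip_ge0 R c.
  rewrite mulr_ge0 ?subr_ge0 //=; last by apply: connector_homo; lia.
  by rewrite ler_wpM2r // lerBlDr lerDl connector_ge0.
- move=> a; rewrite -[connector a c.+1 in X in _ --> X]subr0.
  apply: cvgM; last exact: cvg_cst.
  apply: cvgB; first exact: cvg_cst.
  by rewrite -(cvg_shiftS (fun N => connector N.-1 c.+1)); apply: connector_cvg0.
rewrite exprSr; have : (\sum_(0 <= m < M) cw (nseq p true) m * connector m c.+1) * recip c @[M --> \oo] --> recip c ^+ p * recip c.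
  by apply: cvgM => //; exact: cvg_cst.
by under eq_fun do [rewrite mulr_suml; under eq_bigr do rewrite -mulrA].
Unshelve. all: by end_near. Qed.

(** The double sum [s M] is evaluated in both orders. Summing over c first telescopes the connector
    and leaves the nested sum; summing over m first gives 1/c^(q+1) by [connected_sum_cvg], hence
    zeta(q + 2). *)
Lemma height_one_duality q : mzv R (rev (2%N :: nseq q 1%N)) = mzv R [:: q.+2].
Proof.
pose y m := cw (nseq q.+1 true) m.
have y0 : y 0%N = 0 by rewrite /y cw0.
pose s M := \sum_(0 <= m < M.+1) y m * \sum_(1 <= c < M.+1) connector m c / c%:R.
have l1 : s M @[M --> \oo] --> mzv R (rev (2%N :: nseq q 1%N)).
  have := @adm_cvg R _ (adm2 q).
  have e N : zetaN N (2%N :: nseq q 1%N) = \sum_(0 <= m < N) y m.+1 * recip m.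
    rewrite zetaN_cons; apply: eq_bigr => c _.
    rewrite -cw_rword //; first by rewrite rword2.
    by rewrite all_nseq orbT.
  have e' M : s M = \sum_(0 <= m < M) y m.+1 * ((1 - connector M m.+1) * recip m).
    rewrite /s big_nat_recl // y0 mul0r add0r; apply: eq_bigr => m _.
    congr (_ * _); have := @sum_connector 0 m M.+1 isT; rewrite connector0 /= => <-.
    by apply: eq_bigr => c _; rewrite connectorC.
  under eq_fun do rewrite e; rewrite (funext e' : s = _).
  apply: cvg_sum_dominated => [m|N m mN|m]; first exact: cw_ge0.
    have m0 := recip_ge0 R m; have le1 : connector N m.+1 <= 1.
      by rewrite (le_trans (connector_le_recip _ _)) // recip_le1.
    rewrite mulr_ge0 ?subr_ge0 //= ler_piMl // lerBlDr lerDl; exact: connector_ge0.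
  rewrite -[recip m in X in _ --> X]mul1r -[1 in X in _ --> X]subr0.
  by apply: cvgM; [apply: cvgB; [exact: cvg_cst|exact: connector_cvg0]|exact: cvg_cst].
have l2 : s M @[M --> \oo] --> mzv R [:: q.+2].
  have := @adm_cvg R [:: q.+2] (@adm1 q.+2 isT).
  have e N : zetaN N [:: q.+2] = \sum_(0 <= c < N) recip c * recip c ^+ q.+1.
    by rewrite zetaN1; apply: eq_bigr => c _; rewrite exprS.
  have e' M : s M = \sum_(0 <= c < M) recip c * \sum_(0 <= m < M.+1) y m * connector m c.+1.
    rewrite /s; under eq_bigr do rewrite mulr_sumr.
    rewrite exchange_big big_add1; apply: eq_bigr => c _.
    by rewrite mulr_sumr; apply: eq_bigr => m _; rewrite /inv_succ; ring.
  under eq_fun do rewrite e; rewrite (funext e' : s = _).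
  have lim c := @connected_sum_cvg q.+1 c.
  have nd c : nondecreasing_seq (fun M => \sum_(0 <= m < M) y m * connector m c.+1).
    apply/nondecreasing_seqP => M; rewrite [leRHS]big_nat_recr //= lerDl.
    by rewrite mulr_ge0 ?cw_ge0 ?connector_ge0.
  apply: cvg_sum_dominated => [c|N c cN|c]; first exact: recip_ge0.
    rewrite sumr_ge0 /= => [|m _]; last by rewrite mulr_ge0 ?cw_ge0 ?connector_ge0.
    have cv : cvgn (fun M => \sum_(0 <= m < M) y m * connector m c.+1).
      by apply/cvg_ex; eexists; exact: lim.
    by have := nondecreasing_cvgn_le (nd c) cv N.+1; rewrite (cvg_lim (@norm_hausdorff _ _) (lim c)).
  by have := lim c; rewrite -(cvg_shiftS (fun M => \sum_(0 <= m < M) cw (nseq q.+1 true) m * connector m c.+1)).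
exact: (@cvg_unique _ (@norm_hausdorff _ R) _ _ _ _ l1 l2).
Qed.

End HeightOneDuality.

(** * Harmonic regularized values as limits *)

Lemma newton_unique (R : numFieldType) (a g h : nat -> R) :
  a 0%N = 0 -> newton a g -> newton a h -> g 0%N = h 0%N -> g =1 h.
Proof.
move=> a0 ng nh gh0 n; elim/ltn_ind: n => -[//|n] IHn.
have n0 : n.+1%:R != 0 :> R by rewrite pnatr_eq0.
apply: (mulfI n0); rewrite ng nh /convol big_ord_recl [RHS]big_ord_recl a0 !mul0r !add0r.
by apply: eq_bigr => i _; rewrite IHn //= /bump; lia.
Qed.

Section RegularizedLimit.
Variable R : realType.
Local Notation recip := (inv_succ R).
Local Notation zetaN := (zetaN R).
Local Notation Z := (@mzv_span R).
Local Notation ideal := (@zeta2_ideal R).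

Definition gamma_coef N k : R := if (k <= 1)%N then 0 else power_coef R N k.

Lemma gammaN0 N : gammaN R N 0 = 1.
Proof. by rewrite /gammaN /convol big_ord1 /exp_coef expr0 fact0 divr1 mul1r. Qed.

(** The coefficients of exp(- gamma x)/Gamma(1 + x), with gamma Euler's constant. *)
Definition gamma_lim n : R := limn (fun N => gammaN R N n).

Definition gamma_coef_lim k : R :=
  if (k <= 1)%N then 0 else - ((-1) ^+ k * mzv R [:: k]).

Lemma gamma_coef_cvg k : gamma_coef N k @[N --> \oo] --> gamma_coef_lim k.
Proof.
rewrite /gamma_coef /gamma_coef_lim; case: leqP => k1; first exact: cvg_cst.
case: k k1 => // k k1; rewrite exprS mulN1r mulNr opprK; apply: cvgnMl.
by apply: (@adm_cvg R [:: _]); apply: adm1.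
Qed.

Lemma gammaN_cvg n : gammaN R N n @[N --> \oo] --> gamma_lim n.
Proof.
suff: cvgn (fun N => gammaN R N n) by [].
elim/ltn_ind: n => -[|n] IHn; first by under eq_fun do rewrite gammaN0; exact: is_cvg_cst.
have n0 : n.+1%:R != 0 :> R by rewrite pnatr_eq0.
have e N : gammaN R N n.+1 = n.+1%:R^-1 *
    \sum_(i < n.+1) gamma_coef N (lift ord0 i) * gammaN R N (n.+1 - lift ord0 i).
  apply: (mulfI n0); rewrite mulVKf // newton_gammaN /convol big_ord_recl mul0r add0r.
  by [].
under eq_fun do rewrite e.
apply: is_cvgM; first exact: is_cvg_cst.
apply/cvg_ex; exists (\sum_(i < n.+1) gamma_coef_lim (lift ord0 i) * gamma_lim (n.+1 - lift ord0 i)).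
apply: cvg_sum_seq => i _; apply: cvgM; first exact: gamma_coef_cvg.
by apply: IHn; rewrite /= /bump; lia.
Qed.

Lemma newton_gamma_lim : newton gamma_coef_lim gamma_lim.
Proof.
move=> n; have l1 : n%:R * gammaN R N n @[N --> \oo] --> n%:R * gamma_lim n.
  by apply: cvgnMl; exact: gammaN_cvg.
have l2 : convol (gamma_coef N) (gammaN R N) n @[N --> \oo] --> convol gamma_coef_lim gamma_lim n.
  by apply: cvg_sum_seq => i _; apply: cvgM; [exact: gamma_coef_cvg|exact: gammaN_cvg].
apply: (@cvg_unique _ (@norm_hausdorff _ R) _ _ _ _ _ l2).
by move: l1; under eq_fun do rewrite newton_gammaN.
Qed.

Lemma gamma_lim0 : gamma_lim 0 = 1.
Proof. by rewrite /gamma_lim; under eq_fun do rewrite gammaN0; exact: lim_cst. Qed.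

(** These are the coefficients of sin(pi x)/(pi x). Odd zeta values cancel in the logarithmic
    derivative and even ones lie in the ideal; Newton's identity passes this on to all coefficients
    of positive degree. *)
Lemma sigma_gamma_lim n : (0 < n)%N -> ideal (sigma gamma_lim n).
Proof.
have b_ideal k : ideal (gamma_coef_lim k + (-1) ^+ k * gamma_coef_lim k).
  rewrite /gamma_coef_lim; case: leqP => k1; first by rewrite mulr0 addr0; exact: zeta2_ideal0.
  rewrite mulrN mulrA -expr2 sqrr_sign mul1r -opprD; apply: zeta2_idealN.
  rewrite -signr_odd; case ok: (odd k).
    by rewrite expr1 mulN1r addNr; exact: zeta2_ideal0.
  rewrite expr0 mul1r.
  have ek : k = (2 * k./2)%N by rewrite mul2n -{1}(odd_double_half k) ok.
  by rewrite ek; apply: zeta2_idealD; apply: zeta_even; lia.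
elim/ltn_ind: n => -[//|n] IHn _; apply: (@zeta2_idealVn R n).
rewrite (newton_sigma newton_gamma_lim) /convol big_ord_recl /=.
rewrite {1 2}/gamma_coef_lim /= mulr0 addr0 mul0r add0r.
apply: zeta2_ideal_sum_seq => i _; apply: zeta2_idealMr; first exact: b_ideal.
have [->|i0] := posnP (n.+1 - bump 0 i)%N.
  by rewrite sigma0 gamma_lim0 mulr1; exact: span1.
by apply/zeta2_ideal_span/IHn => //; rewrite /bump; lia.
Qed.

(* The harmonic regularized value at [rev u], see [reg0_harmonic]. *)
Definition greg (u : seq nat) : R := strip1 gamma_lim (@fhat R) u.

(** The exact exchange of divergent for convergent coefficients: the logarithmic derivatives of the
    two generating functions differ only in degree 1, which disappears from G(x) G(-x), so both have
    the same [sigma]. *)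
Lemma symm_sum_zetaN N k n : all (leq 1) k ->
  symm_sum (zetaN N) k n = symm_sum (strip1 (gammaN R N) (fhatN R N)) k n.
Proof.
move=> k1; have sig : sigma (elemsym R N) =1 sigma (gammaN R N).
  apply: (newton_unique _ (newton_sigma (@newton_elemsym R N))).
  - by rewrite /= mulr0 addr0.
  - move=> m; rewrite (newton_sigma (@newton_gammaN R N)); apply: eq_bigr => -[i im] _ /=.
    by congr (_ * _); case: i im => [|[|i]] //= _; rewrite ?expr0 ?expr1; ring.
  - by rewrite !sigma0 gammaN0 /elemsym.
rewrite (eq_symm_sum _ _ (@zetaN_strip R N)) !symm_sum_strip //; apply: eq_bigr => s _; apply: eq_bigr => q _.
by rewrite sig.
Qed.

Lemma greg_cvg u : all (leq 1) u ->
  strip1 (gammaN R N) (fhatN R N) u @[N --> \oo] --> greg u.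
Proof.
move=> u1; rewrite /greg; under eq_fun do rewrite strip1E; rewrite strip1E.
apply: cvg_sum_seq => j _; apply: cvgM; last first.
  by apply: fhatN_cvg; apply/allP => k /mem_drop; apply: (allP u1).
by apply: cvgnMl; exact: gammaN_cvg.
Qed.

Lemma symm_sum_cvg (F : nat -> seq nat -> R) (G : seq nat -> R) k n :
  (forall u, all (leq 1) u -> F N u @[N --> \oo] --> G u) -> all (leq 1) k ->
  symm_sum (F N) k n @[N --> \oo] --> symm_sum G k n.
Proof.
move=> FG k1; apply: cvg_sum_seq => i _; apply: cvgM.
  apply: cvgnMl; apply: FG; rewrite all_rev.
  by apply/allP => x /mem_take; apply: (allP k1).
apply: tadic_cvg => u su du _; apply: FG; apply: all2_leq_index su du _.
by apply/allP => x /mem_drop; apply: (allP k1).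
Qed.

Lemma symm_sum_zetaN_cvg k n : all (leq 1) k ->
  symm_sum (zetaN N) k n @[N --> \oo] --> symm_sum greg k n.
Proof.
move=> k1; under eq_fun do rewrite symm_sum_zetaN //.
by apply: symm_sum_cvg => // u u1; exact: greg_cvg.
Qed.

Lemma span_tadic (F : seq nat -> R) v n : all (leq 1) v ->
  (forall u, all (leq 1) u -> Z (F u)) -> Z (tadic v F n).
Proof.
elim: v F n => [|k v IHv] F n /= v1 ZF.
  by case: n => [|n]; rewrite /= ?mul1r ?mul0r; [exact: ZF|exact: span0].
case/andP: v1 => k0 v1; apply: span_sum => l _; apply: spanMn; apply: IHv => // u u1.
by apply: ZF; rewrite /= u1 addn_gt0 k0.
Qed.

Lemma span_symm_term (F : seq nat -> R) k n q s : all (leq 1) k ->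
  (forall u, all (leq 1) u -> Z (F u)) ->
  Z ((-1) ^+ sumn (drop s k) * F (rev (take q k)) * tadic (drop s k) F n).
Proof.
move=> k1 ZF; rewrite -mulrA; apply: spanMsign; apply: spanM.
  by apply: ZF; rewrite all_rev; apply/allP => x /mem_take; apply: (allP k1).
by apply: span_tadic => //; apply/allP => x /mem_drop; apply: (allP k1).
Qed.

Lemma span_symm_sum (F : seq nat -> R) k n : all (leq 1) k ->
  (forall u, all (leq 1) u -> Z (F u)) -> Z (symm_sum F k n).
Proof. by move=> k1 ZF; apply: span_sum => i _; apply: span_symm_term. Qed.

(** In [symm_sum_strip] the terms with q = s carry [sigma gamma_lim 0], which is 1, and make up the
    shuffle sum. All other terms have a factor in the ideal. *)
Lemma symm_sum_greg_fhat k n : all (leq 1) k ->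
  ideal (symm_sum greg k n - symm_sum (@fhat R) k n).
Proof.
move=> k1; rewrite /greg (_ : symm_sum (fun u => _) k n = symm_sum (strip1 gamma_lim (@fhat R)) k n) //.
rewrite symm_sum_strip // /symm_sum -sumrB; apply: zeta2_ideal_sum_seq => s.
rewrite mem_index_iota => /andP[_ sk].
rewrite big_nat_recr //= subnn take0 sigma0 gamma_lim0 !mul1r addrK.
apply: zeta2_ideal_sum_seq => q; rewrite mem_index_iota => /andP[_ qs].
rewrite -mulrA; apply: zeta2_idealM; first by rewrite -[_%:R]mulr1; apply/spanMn/span1.
apply: zeta2_idealMr; first by apply: sigma_gamma_lim; rewrite subn_gt0.
by apply: span_symm_term => // u u1; apply: span_fhat.
Qed.

End RegularizedLimit.

(** * Words and regularizations *)

Lemma word_monomial w : word w = mkmalgU (FMonom w) 1.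
Proof.
elim: w => [|a w IHw]; first by rewrite /word big_nil -fmoneE.
rewrite /word big_cons -/(word w) IHw /letter malgM_def fgmulUU mulr1.
by rewrite /mmul /= fmuE fmmulE.
Qed.

Lemma word_cat v w : word (v ++ w) = word v * word w.
Proof. exact: big_cat. Qed.

Lemma word_rcons w a : word (rcons w a) = word w * letter a.
Proof. by rewrite -cats1 word_cat /word big_seq1. Qed.

Lemma z_word k : z_ k = word (true :: nseq k.-1 false).
Proof.
rewrite /word big_cons; congr (_ * _).
by elim: k.-1 => [|j IHj]; rewrite ?expr0 ?big_nil //= big_cons exprS IHj.
Qed.

Lemma zword_word k : zword k = word (rev (rword (rev k))).
Proof.
elim/last_ind: k => [|k l IHk]; first by rewrite /zword /word !big_nil.
rewrite rev_rcons /= rev_cat rev_cons /zword big_rcons -/(zword k) IHk z_word.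
by rewrite cat_rcons word_cat rev_nseq.
Qed.

Lemma zword_rcons k l : zword (rcons k l) = zword k * z_ l.
Proof. by rewrite /zword big_rcons. Qed.

Lemma bilinear_ext_word f v w : bilinear_ext f (word v) (word w) = f v w.
Proof.
rewrite /bilinear_ext !word_monomial !msuppU1 !big_seq_fset1 !mcoeffUU mulr1.
exact: scale1r.
Qed.

Lemma y_word : y_ = word [:: true].
Proof. by rewrite /word big_seq1. Qed.

Lemma word_index_rev w : word_index (rev w) = rev (rev_word_index 0 w).
Proof. by rewrite /word_index revK. Qed.

Lemma harmonic_rev_y u :
  harmonic_rev [:: 1%N] u = \sum_(a <- hst u) zword (rev a).
Proof.
have nil v : harmonic_rev [::] v = zword (rev v) by case: v.
have e a w : zword (rev (a :: w)) = zword (rev w) * z_ a by rewrite rev_cons zword_rcons.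
elim: u => [|l v IHv]; first by rewrite big_seq1.
have -> : harmonic_rev [:: 1%N] (l :: v) = harmonic_rev [::] (l :: v) * z_ 1 +
  harmonic_rev [:: 1%N] v * z_ l + harmonic_rev [::] v * z_ l.+1 by [].
rewrite [hst _]/= !big_cons big_map IHv !nil.
have -> : \sum_(j <- hst v) zword (rev (l :: j)) = (\sum_(j <- hst v) zword (rev j)) * z_ l.
  by rewrite mulr_suml; apply: eq_bigr => j _; rewrite e.
by rewrite (e 1%N (l :: v)) (e l.+1 v) [RHS]addrA; apply: addrAC.
Qed.

Lemma shuffle_rev_y w :
  shuffle_rev [:: true] w = \sum_(b <- ysh w) word (rev b).
Proof.
elim: w => [|a w IHw]; first by rewrite big_seq1.
have e d v : word (rev (d :: v)) = word (rev v) * letter d by rewrite rev_cons word_rcons.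
have -> : shuffle_rev [:: true] (a :: w) =
  word (rev (a :: w)) * letter true + shuffle_rev [:: true] w * letter a by [].
rewrite [ysh _]/= big_cons big_map IHw.
have -> : \sum_(j <- ysh w) word (rev (a :: j)) = (\sum_(j <- ysh w) word (rev j)) * letter a.
  by rewrite mulr_suml; apply: eq_bigr => j _; rewrite e.
by rewrite (e true (a :: w)).
Qed.

Lemma harmonic_prod_y u : all (leq 1) u ->
  Hprod Harmonic y_ (zword (rev u)) = \sum_(a <- hst u) zword (rev a).
Proof.
move=> u1; rewrite zword_word revK y_word /= /harmonic_prod bilinear_ext_word.
by rewrite word_index_rev revK rev_word_index_rword // harmonic_rev_y.
Qed.

Lemma shuffle_prod_y w :
  Hprod Shuffle y_ (word (rev w)) = \sum_(b <- ysh w) word (rev b).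
Proof. by rewrite y_word /= /shuffle_prod bilinear_ext_word revK shuffle_rev_y. Qed.

Lemma H1_zero : H1 0.
Proof. by exists 0, 0; rewrite scale0r mulr0 addr0. Qed.

Lemma H1_add p q : H1 p -> H1 q -> H1 (p + q).
Proof.
move=> [c [h ->]] [d [g ->]]; exists (c + d), (h + g).
by rewrite scalerDl mulrDr addrACA.
Qed.

Lemma H1_word w : head true w -> H1 (word w).
Proof.
case: w => [|[] w] // _.
  by exists 1, 0; rewrite /word big_nil scale1r mulr0 addr0.
by exists 0, (word w); rewrite /word big_cons scale0r add0r.
Qed.

Lemma H0_word w : head true w -> ~~ last false w -> H0 (word w).
Proof.
case: w => [|[] w] //; first by exists 1, 0; rewrite /word big_nil scale1r mulr0 mul0r addr0.
case/lastP: w => [|w []] //; first by rewrite /= last_rcons.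
by exists 0, (word w); rewrite -rcons_cons word_rcons scale0r add0r {1}/word big_cons.
Qed.

Lemma head_rev_word w : head true (rev w) = last true w.
Proof. by case/lastP: w => // w a; rewrite rev_rcons last_rcons. Qed.

Lemma H1_zword u : H1 (zword (rev u)).
Proof. by rewrite zword_word revK; apply: H1_word; rewrite head_rev_word last_rword. Qed.

Lemma H0_zword u : adm u -> H0 (zword (rev u)).
Proof.
move=> au; rewrite zword_word revK; apply: H0_word.
  by rewrite head_rev_word last_rword.
case: u au => // k v au.
by have [w [-> _ _]] := rword_adm au; rewrite rev_cons last_rcons.
Qed.

Section Regularization.
Variable R : realType.
Implicit Types (f : Halg -> {poly R}).

Lemma Zmap_zword u : all (leq 1) u -> Zmap R (zword (rev u)) = mzv R (rev u).
Proof.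
move=> u1; rewrite zword_word revK word_monomial /Zmap msuppU1 big_seq_fset1 mcoeffUU.
by rewrite rmorph1 mul1r word_index_rev rev_word_index_rword.
Qed.

Lemma regularization_sum b f (I : eqType) (r : seq I) (F : I -> Halg) :
  is_regularization b f -> (forall i, i \in r -> H1 (F i)) ->
  H1 (\sum_(i <- r) F i) /\ f (\sum_(i <- r) F i) = \sum_(i <- r) f (F i).
Proof.
case=> lin _ _ _ _; have fD p q : H1 p -> H1 q -> f (p + q) = f p + f q.
  by move=> Hp Hq; have := lin 1 p q Hp Hq; rewrite scale1r rmorph1 scale1r.
have f0 : f 0 = 0.
  by apply: (addrI (f 0)); rewrite -fD ?addr0 //; exact: H1_zero.
elim: r => [|i r IHr] H; first by rewrite !big_nil; split => //; exact: H1_zero.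
have Hi : H1 (F i) by apply: H; rewrite inE eqxx.
have [H1r fr] : H1 (\sum_(i <- r) F i) /\ f (\sum_(i <- r) F i) = \sum_(i <- r) f (F i).
  by apply: IHr => j jr; apply: H; rewrite inE jr orbT.
by rewrite !big_cons; split; [exact: H1_add|rewrite fD // fr].
Qed.

Definition reg0 f u : R := (f (zword (rev u))).[0].

Lemma reg0_adm b f u : is_regularization b f -> adm u -> reg0 f u = mzv R (rev u).
Proof.
move=> [_ _ _ fZ _] au; rewrite /reg0 fZ ?hornerC; last exact: H0_zword.
by rewrite Zmap_zword //; case/andP: au.
Qed.

(** The regularization sends the product with y to T times a polynomial, which vanishes at T = 0. *)
Lemma reg0_hst f u : is_regularization Harmonic f -> all (leq 1) u ->
  \sum_(a <- hst u) reg0 f a = 0.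
Proof.
move=> reg u1; rewrite /reg0 -horner_sum.
have [_ <-] := regularization_sum reg (fun a (_ : a \in hst u) => H1_zword a).
rewrite -harmonic_prod_y //; have [_ _ fM _ fy] := reg.
rewrite fM ?fy; first by rewrite hornerM hornerX mul0r.
  by rewrite y_word; apply: H1_word.
exact: H1_zword.
Qed.

Lemma reg0_ysh f w : is_regularization Shuffle f -> last true w ->
  \sum_(b <- ysh w) reg0 f (rev_word_index 0 b) = 0.
Proof.
move=> reg gw.
have e b : b \in ysh w -> zword (rev (rev_word_index 0 b)) = word (rev b).
  move=> bw; rewrite zword_word revK rword_rev_word_index //; first exact: last_ysh bw.
  by rewrite orbT.
rewrite /reg0 -horner_sum; have [_ <-] := regularization_sum reg (fun b (_ : b \in ysh w) => H1_zword (rev_word_index 0 b)).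
rewrite (eq_big_seq _ e) -shuffle_prod_y; have [_ _ fM _ fy] := reg.
rewrite fM ?fy; first by rewrite hornerM hornerX mul0r.
  by rewrite y_word; apply: H1_word.
by apply: H1_word; rewrite head_rev_word.
Qed.

End Regularization.

Lemma nseq_rcons (T : Type) n (a : T) s : nseq n a ++ a :: s = nseq n.+1 a ++ s.
Proof. by elim: n => //= n ->. Qed.

Lemma adm_head core : adm core -> head 0%N core != 1%N.
Proof. by case: core => [|[|[|k]] v] // /andP[]. Qed.

Lemma index_ones n core : adm core -> all (leq 1) (nseq n 1%N ++ core).
Proof. by move=> /andP[c1 _]; rewrite all_cat c1 andbT all_nseq orbT. Qed.

(** * Identification of the regularized values with the limits *)

Section Uniqueness.
Variable R : realType.

Lemma hst_index u a : all (leq 1) u -> a \in hst u -> all (leq 1) a.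
Proof.
elim: u a => [|l v IHv] a; first by rewrite inE => _ /eqP->.
move=> /= /andP[l1 v1]; rewrite !inE => /or3P[/eqP->|/eqP->|/mapP[c cv ->]] /=; rewrite ?l1 //.
exact: IHv.
Qed.

(** A one put into the block gives i + 1 equal terms; every other term has at most i + j leading
    ones, where D vanishes. The j ones in front collect those that the induction on i peels off. *)
Lemma sum_hst_ones (D : seq nat -> R) i j core : adm core ->
  (forall m c, (m <= i + j)%N -> adm c -> D (nseq m 1%N ++ c) = 0) ->
  \sum_(a <- hst (nseq i 1%N ++ core)) D (nseq j 1%N ++ a) =
  i.+1%:R * D (nseq (i + j).+1 1%N ++ core).
Proof.
move=> ac; elim: i j => [|i IHi] j D0.
  case: core ac => [|l v] ac; first by rewrite big_seq1 mul1r nseq_rcons.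
  rewrite /= !big_cons mul1r nseq_rcons big_map [X in _ + (X + _)]D0; last 2 first.
  - by [].
  - by move: ac; rewrite /adm /= => /andP[/andP[_ ->]]; case: l.
  rewrite add0r big_seq big1 ?addr0 // => a av; apply: D0 => //.
  move: ac => /andP[/= /andP[l1 v1] l2]; rewrite /adm /= l1 l2.
  by rewrite (hst_index v1 av).
have e : hst (nseq i.+1 1%N ++ core) = [:: nseq i.+2 1%N ++ core,
  2%N :: nseq i 1%N ++ core & map (cons 1%N) (hst (nseq i 1%N ++ core))] by [].
rewrite e !big_cons big_map [X in _ + (X + _)]D0; last 2 first.
- by lia.
- by rewrite /adm /= (index_ones i ac).
under eq_bigr do rewrite nseq_rcons.
rewrite IHi => [|m c mi ca]; last by apply: D0 => //; lia.
rewrite add0r catA -nseqD !addnS !addSn [(j + i)%N]addnC -[i.+2]add1n natrD mulrDl mul1r.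
by [].
Qed.

(** Induction on the number of leading ones: [sum_hst_ones], applied to the difference of F and G,
    isolates a nonzero multiple of the value with one more one. *)
Lemma hst_uniqueness (F G : seq nat -> R) :
  (forall u, adm u -> F u = G u) ->
  (forall u, all (leq 1) u -> \sum_(a <- hst u) F a = \sum_(a <- hst u) G a) ->
  forall u, all (leq 1) u -> F u = G u.
Proof.
move=> base step u u1; rewrite (ones_split u).
elim/ltn_ind: (ones u) (drop _ _) (adm_core u1) => -[|n] IHn core ac; first exact: base.
apply/eqP; rewrite -subr_eq0; apply/eqP; set D := fun v => F v - G v.
have := @sum_hst_ones D n 0 core ac; rewrite addn0 sumrB step ?subrr; last exact: index_ones.
move=> /(_ _)/esym/eqP; rewrite mulf_eq0 pnatr_eq0 /= => H; apply/eqP/H.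
by move=> m c mn ca; apply/eqP; rewrite subr_eq0; apply/eqP/IHn.
Qed.

Lemma sum_hst_greg u : all (leq 1) u -> \sum_(a <- hst u) @greg R a = 0.
Proof.
move=> u1; have l1 : \sum_(a <- hst u) strip1 (gammaN R N) (fhatN R N) a @[N --> \oo] -->
    \sum_(a <- hst u) @greg R a.
  by apply: cvg_sum_seq => a au; apply: greg_cvg; apply: hst_index au.
have l2 : \sum_(a <- hst u) strip1 (gammaN R N) (fhatN R N) a @[N --> \oo] --> (0 : R).
  under eq_fun do under eq_bigr do rewrite -renormalized_strip.
  under eq_fun do rewrite sum_hst_renormalized //.
  exact: cvg_cst.
exact: (cvg_unique _ l1 l2).
Qed.

Lemma greg_adm u : adm u -> @greg R u = mzv R (rev u).
Proof.
move=> au; rewrite /greg -[u]cat0s -[[::]]/(nseq 0 1%N) strip1_ones; last exact: adm_head.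
by rewrite /convol big_ord1 gamma_lim0 mul1r fhat_ones // corelim0.
Qed.

Lemma reg0_harmonic f u : is_regularization Harmonic f -> all (leq 1) u ->
  reg0 f u = @greg R u.
Proof.
move=> reg; apply: hst_uniqueness => v.
- by move=> av; rewrite (reg0_adm reg) // greg_adm.
- by move=> v1; rewrite reg0_hst // sum_hst_greg.
Qed.

Lemma sum_ysh_ones (F : seq nat -> R) i j w :
  \sum_(b <- ysh (nseq i true ++ w)) F (nseq j 1%N ++ rev_word_index 0 b) =
  i.+1%:R * F (nseq (i + j).+1 1%N ++ rev_word_index 0 w) +
  if w is a :: w' then
    \sum_(b <- ysh w') F (nseq (i + j) 1%N ++ rev_word_index 0 (a :: b))
  else 0.
Proof.
elim: i j => [|i IHi] j.
  case: w => [|a w]; first by rewrite big_seq1 mul1r nseq_rcons addr0.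
  by rewrite [ysh _]/= big_cons big_map mul1r /= nseq_rcons.
have e : ysh (nseq i.+1 true ++ w) =
  (nseq i.+2 true ++ w) :: map (cons true) (ysh (nseq i true ++ w)) by [].
rewrite e !big_cons big_map.
have h m : rev_word_index 0 (nseq m true ++ w) = nseq m 1%N ++ rev_word_index 0 w.
  by elim: m => //= m ->.
under [X in _ + X]eq_bigr do rewrite [rev_word_index 0 _]/= nseq_rcons.
by rewrite IHi h catA -nseqD !addnS !addSn [(j + i)%N]addnC addrA -[i.+2]add1n natrD mulrDl mul1r.
Qed.

(** Both sides obey the recursion of [corelimS]: the limits by that lemma, the regularization
    because its products with y vanish at T = 0. *)
Lemma reg0_shuffle f u : is_regularization Shuffle f -> all (leq 1) u ->
  reg0 f u = fhat R u.
Proof.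
move=> reg u1; rewrite /fhat {1}(ones_split u).
elim: (ones u) (drop _ _) (adm_core u1) => [|n IHn] core ac.
  by rewrite (reg0_adm reg) // corelim0.
have gw : last true (nseq n true ++ rword core).
  rewrite last_cat (_ : last true (nseq n true) = true); last by elim: n {IHn} => //= n; case: n.
  exact: last_rword.
have n0 : n.+1%:R != 0 :> R by rewrite pnatr_eq0.
apply: (mulfI n0); have := reg0_ysh reg gw.
rewrite (sum_ysh_ones (reg0 f) n 0) addn0 rev_word_index_rword; last by case/andP: ac.
case: core ac {gw} => [|k v] ac.
  rewrite addr0 => ->; rewrite /corelim /core_sum /=.
  by rewrite lim_cst ?mulr0 //; exact: norm_hausdorff.
have [w [ew w0 gw]] := rword_adm ac; rewrite (corelimS R n ac ew) ew.
move=> /eqP; rewrite addr_eq0 => /eqP->; congr (- _).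
by apply: eq_big_seq => b bw; have [_ ab] := adm_ysh gw bw; rewrite IHn.
Qed.

End Uniqueness.

(** * The symmetric multiple zeta values *)

Definition ffun_cons (A : finType) m (p : A * {ffun 'I_m -> A}) : {ffun 'I_m.+1 -> A} :=
  [ffun i => if unlift ord0 i is Some j then p.2 j else p.1].

Lemma ffun_cons0 (A : finType) m (p : A * {ffun 'I_m -> A}) : ffun_cons p ord0 = p.1.
Proof. by rewrite ffunE unlift_none. Qed.

Lemma ffun_consS (A : finType) m (p : A * {ffun 'I_m -> A}) j :
  ffun_cons p (lift ord0 j) = p.2 j.
Proof. by rewrite ffunE liftK. Qed.

Lemma ffun_cons_bij (A : finType) m : bijective (@ffun_cons A m).
Proof.
exists (fun f : {ffun 'I_m.+1 -> A} => (f ord0, [ffun j => f (lift ord0 j)])).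
  by move=> [a f]; rewrite ffun_cons0; congr (_, _); apply/ffunP => j; rewrite ffunE ffun_consS.
move=> f; apply/ffunP => i; case: (unliftP ord0 i) => [j ->|->].
  by rewrite ffun_consS ffunE.
by rewrite ffun_cons0.
Qed.

Section Symmetric.
Variable R : realType.
Local Notation ideal := (@zeta2_ideal R).
Local Notation Z := (@mzv_span R).

(** The bound M is kept apart from n because removing an entry lowers n but leaves the codomain of
    the functions [l] unchanged. *)
Lemma sum_ffun_tadic (F : seq nat -> R) v M n : (n <= M)%N ->
  \sum_(l : {ffun 'I_(size v) -> 'I_M.+1} | (\sum_j l j)%N == n)
    (\prod_(j < size v) 'C(nth 0%N v j + l j - 1, l j))%N%:R *
    F [seq (nth 0%N v j + l j)%N | j : 'I_(size v)] = tadic v F n.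
Proof.
elim: v F n => [|k v IHv] F n nM.
  rewrite /= (eq_bigr (fun=> F [::])) => [|l _]; last first.
    by rewrite big_ord0 mul1r; congr F; apply: size0nil; rewrite size_map size_enum_ord.
  rewrite (eq_bigl (fun=> n == 0%N)) => [|l]; last by rewrite big_ord0 eq_sym.
  case: (n == 0%N); last by rewrite big_pred0_eq /= mulr0n mul0r.
  by rewrite (eq_bigl (mem predT)) // sumr_const card_ffun !card_ord expn0 mul1r.
pose c := @ffun_cons 'I_M.+1 (size v).
rewrite (reindex c) /=; last exact: onW_bij (ffun_cons_bij _ _).
rewrite -(pair_big_dep xpredT (fun a l => (\sum_j c (a, l) j == n)%N) (fun a l =>
  (\prod_(j < (size v).+1) 'C(nth 0%N (k :: v) j + c (a, l) j - 1, c (a, l) j))%N%:R *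
    F [seq (nth 0%N (k :: v) j + c (a, l) j)%N | j : 'I_(size v).+1])) /=.
rewrite (big_ord_widen M.+1 (fun l => 'C(k + l - 1, l)%:R *
  tadic v (fun u => F ((k + l)%N :: u)) (n - l)%N)) // [RHS]big_mkcond /=.
apply: eq_bigr => a _; case: ltnP => an; last first.
  rewrite big_pred0 // => l; apply/eqP; rewrite big_ord_recl /c ffun_cons0 /=; lia.
rewrite -IHv; last by lia.
rewrite mulr_sumr; apply: eq_big => l.
  rewrite big_ord_recl /c ffun_cons0 /=.
  under eq_bigr do rewrite ffun_consS /=.
  by move: an; rewrite ltnS => an; apply/eqP/eqP; lia.
move=> _; rewrite big_ord_recl /c ffun_cons0 /= natrM -mulrA; congr (_ * (_ * _)).
  by congr (_%:R); apply: eq_bigr => j _; rewrite ffun_consS.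
rewrite /image_mem enum_ordSl /= ffun_cons0 /=; congr (F (_ :: _)).
by rewrite -map_comp; apply: eq_map => j /=; rewrite ffun_consS.
Qed.

Lemma smzv_symm_sum b k n :
  smzv R b k n = symm_sum (fun u => mzv_reg R b (rev u)) k n.
Proof.
rewrite /smzv /symm_sum big_mkord; apply: eq_bigr => i _ /=.
by rewrite (sum_ffun_tadic (fun u => mzv_reg R b (rev u))) // revK.
Qed.

Lemma mzv_reg_trivial b : (forall f, ~ @is_regularization R b f) ->
  forall k, mzv_reg R b k = 0.
Proof.
by move=> noreg k; rewrite /mzv_reg /Zreg xgetPN ?horner0.
Qed.

End Symmetric.

(** * The cyclic sum formula *)

Lemma cyc_rest_index k i : all (leq 1) k -> all (leq 1) (cyc_rest k i).
Proof.
move=> /allP k1; apply/allP => x; rewrite mem_cat.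
by case/orP => [/mem_drop|/mem_take]; apply: k1.
Qed.

Lemma index_ones_of_sumn k : all (leq 1) k -> (sumn k <= size k)%N -> k = nseq (size k) 1%N.
Proof.
elim: k => //= k v IHv /andP[k0 v1] h; have := index_size_sumn v1 => h'.
by rewrite -IHv //; [congr (_ :: _); lia|lia].
Qed.

Lemma cyc_rest_ones r i : (i < r.+1)%N -> cyc_rest (nseq r.+1 1%N) i = nseq r 1%N.
Proof.
move=> ir; rewrite /cyc_rest drop_nseq take_nseq; last exact: ltnW.
by rewrite -nseqD; congr (nseq _ _); lia.
Qed.

Section CyclicSides.
Variable R : realType.
Local Notation ideal := (@zeta2_ideal R).
Local Notation Z := (@mzv_span R).
Implicit Types (S : seq nat -> nat -> R).

Definition cyclic_lhs S k n : R :=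
  \sum_(i < size k) \sum_(j < (nth 0%N k i).-1)
    S ((j.+1 :: cyc_rest k i) ++ [:: (nth 0%N k i - j)%N]) n.

Definition cyclic_rhs S k n : R :=
  \sum_(i < size k) \sum_(j < n.+1)
    (S ((nth 0%N k i + j + 1)%N :: cyc_rest k i) (n - j)%N +
     S ((j.+1 :: cyc_rest k i) ++ [:: nth 0%N k i]) (n - j)%N) +
  \sum_(i < size k) S (cyc_rest k i ++ [:: (nth 0%N k i).+1]) n.

Lemma cyclic_sides_closed (P : R -> Prop) S k n :
  P 0 -> (forall a b, P a -> P b -> P (a + b)) ->
  (forall w m, all (leq 1) w -> P (S w m)) -> all (leq 1) k ->
  P (cyclic_lhs S k n) /\ P (cyclic_rhs S k n).
Proof.
move=> P0 PD PS k1; have r1 i := cyc_rest_index i k1.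
have n1 (i : 'I_(size k)) : (0 < nth 0%N k i)%N by apply: (allP k1); rewrite mem_nth.
have Psum (I : finType) (F : I -> R) : (forall i, P (F i)) -> P (\sum_i F i).
  by move=> PF; elim/big_ind: _.
split; last (apply: (PD); apply: (Psum) => i); last 2 first.
- apply: (Psum) => j; apply: (PD); apply: (PS) => /=.
    by rewrite r1 andbT; lia.
  by rewrite all_cat r1 /= n1.
- by apply: (PS); rewrite all_cat /= r1.
apply: (Psum) => i; apply: (Psum) => j; apply: (PS); rewrite all_cat /= r1 andbT.
by have := ltn_ord j; lia.
Qed.

Lemma cyclic_lhsB S T k n :
  cyclic_lhs (fun w m => S w m - T w m) k n = cyclic_lhs S k n - cyclic_lhs T k n.
Proof. by rewrite /cyclic_lhs -sumrB; apply: eq_bigr => i _; rewrite -sumrB. Qed.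

Lemma cyclic_rhsB S T k n :
  cyclic_rhs (fun w m => S w m - T w m) k n = cyclic_rhs S k n - cyclic_rhs T k n.
Proof.
rewrite /cyclic_rhs opprD addrACA -!sumrB; congr (_ + _); apply: eq_bigr => i _.
by rewrite -sumrB; apply: eq_bigr => j _; ring.
Qed.

Lemma cyclic_sides_congr S T k n :
  (forall w m, all (leq 1) w -> ideal (S w m - T w m)) -> all (leq 1) k ->
  ideal (cyclic_lhs S k n - cyclic_lhs T k n) /\ ideal (cyclic_rhs S k n - cyclic_rhs T k n).
Proof.
move=> ST k1; rewrite -cyclic_lhsB -cyclic_rhsB.
apply: cyclic_sides_closed => //; [exact: zeta2_ideal0|exact: zeta2_idealD].
Qed.

Lemma tadic0 (F : seq nat -> R) v : tadic v F 0 = F v.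
Proof.
elim: v F => [|k v IHv] F; first by rewrite /= mul1r.
by rewrite /= big_ord1 bin0 mul1r addn0 IHv.
Qed.

Lemma symm_sum0 (F : seq nat -> R) k : symm_sum F k 0 =
  \sum_(0 <= i < (size k).+1) (-1) ^+ sumn (drop i k) * F (rev (take i k)) * F (drop i k).
Proof. by apply: eq_bigr => i _; rewrite tadic0. Qed.

Lemma fhat_nseq j : fhat R (nseq j 1%N) = (j == 0%N)%:R.
Proof. by rewrite -[nseq _ _]cats0 fhat_ones // /corelim /core_sum lim_cst. Qed.

Lemma symm_sum_fhat_ones m : symm_sum (fhat R) (nseq m.+1 1%N) 0 = 0.
Proof.
rewrite symm_sum0 size_nseq big_nat big1 // => i /andP[_ im].
rewrite take_nseq // rev_nseq drop_nseq !fhat_nseq.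
by case: i im => [|i] im; rewrite /= ?mulr0 ?mul0r.
Qed.

Lemma sumn_ones m : sumn (nseq m 1%N) = m. Proof. by rewrite sumn_nseq mul1n. Qed.

(** The regularized values of (1, ..., 1) are 0, so only the cuts at the two ends contribute. *)
Lemma symm_sum_fhat_2ones r : symm_sum (fhat R) (2%N :: nseq r 1%N) 0 =
  (-1) ^+ r * fhat R (2%N :: nseq r 1%N) + fhat R (nseq r 1%N ++ [:: 2%N]).
Proof.
rewrite symm_sum0 /= size_nseq big_nat_recl // big_nat_recr //= big_nat big1 => [|i /andP[_ ir]].
  rewrite drop_oversize ?take_oversize ?size_nseq // (fhat_nseq 0) /= mulr1.
  by rewrite rev_cons rev_nseq -cats1 sumn_ones addnC !exprD sqrrN expr1n !mulr1 add0r mul1r.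
by rewrite drop_nseq fhat_nseq subn_eq0 leqNgt ir mulr0.
Qed.

Lemma symm_sum_fhat_ones2 r : symm_sum (fhat R) (nseq r 1%N ++ [:: 2%N]) 0 =
  (-1) ^+ r * fhat R (nseq r 1%N ++ [:: 2%N]) + fhat R (2%N :: nseq r 1%N).
Proof.
rewrite symm_sum0 size_cat size_nseq addn1 big_nat_recr // big_nat_recl //=.
rewrite big_nat big1 => [|i /andP[_ ir]]; last first.
  rewrite takel_cat ?size_nseq // take_nseq // rev_nseq fhat_nseq.
  by rewrite mulr0 mul0r.
rewrite drop0 take0 take_oversize ?drop_oversize ?size_cat ?size_nseq ?addn1 //.
rewrite (fhat_nseq 0) rev_cat rev_nseq sumn_cat sumn_ones addr0 mulr1 expr0 mul1r.
by rewrite mulr1 !exprD sqrrN expr1n expr0 !mulr1.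
Qed.

(** By duality the two extreme values are zeta(r + 2) and (-1)^r (r + 1) zeta(r + 2), so each i
    contributes (1 + (-1)^r)(r + 2) zeta(r + 2) to the right-hand side. This is 0 for odd r and a
    multiple of an even zeta value for even r. *)
Lemma cyclic_sum_ones r :
  ideal (cyclic_lhs (symm_sum (fhat R)) (nseq r.+1 1%N) 0 -
         cyclic_rhs (symm_sum (fhat R)) (nseq r.+1 1%N) 0).
Proof.
have e (i : 'I_(size (nseq r.+1 1%N))) : nth 0%N (nseq r.+1 1%N) i = 1%N /\
    cyc_rest (nseq r.+1 1%N) i = nseq r 1%N.
  have ir : (i < r.+1)%N by rewrite -[X in (_ < X)%N](size_nseq r.+1 1%N).
  by rewrite cyc_rest_ones // nth_nseq ir.
have -> : cyclic_lhs (symm_sum (fhat R)) (nseq r.+1 1%N) 0 = 0.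
  by rewrite /cyclic_lhs big1 // => i _; have [-> _] := e i; rewrite big_ord0.
have -> : cyclic_rhs (symm_sum (fhat R)) (nseq r.+1 1%N) 0 =
    r.+1%:R * ((1 + (-1) ^+ r) * (r.+2%:R * mzv R [:: r.+2])).
  rewrite /cyclic_rhs -big_split /=.
  transitivity (\sum_(i < size (nseq r.+1 1%N)) ((1 + (-1) ^+ r) * (r.+2%:R * mzv R [:: r.+2]))).
    apply: eq_bigr => i _; have [-> ->] := e i; rewrite big_ord1 /=.
    rewrite (_ : (1 :: nseq r 1 ++ [:: 1])%N = nseq r.+2 1%N); last first.
      by rewrite -[[:: 1%N]]/(nseq 1 1%N) -nseqD addn1.
    rewrite symm_sum_fhat_ones addr0 symm_sum_fhat_2ones symm_sum_fhat_ones2 fhat_ones2.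
    have -> : fhat R (2%N :: nseq r 1%N) = mzv R [:: r.+2].
      rewrite -[2 :: _]cat0s -[[::]]/(nseq 0 1%N) fhat_ones ?corelim0 ?height_one_duality //; exact: adm2.
    rewrite height_one_duality -signr_odd.
    by case: (odd r); rewrite /= ?expr1 ?expr0 -[r.+2]addn1 natrD; ring.
  by rewrite big_const_ord size_nseq iter_addr_0 [RHS]mulr_natl.
rewrite sub0r; apply: zeta2_idealN.
rewrite -signr_odd; case ro: (odd r).
  by rewrite /= expr1 subrr mul0r mulr0; exact: zeta2_ideal0.
have Zn m : Z m%:R by rewrite -[m%:R]mulr1; apply/spanMn/span1.
apply: zeta2_idealM => //; apply: zeta2_idealM; first by rewrite expr0; exact: (Zn 2%N).
apply: zeta2_idealM => //.
have -> : r.+2 = (2 * r./2.+1)%N by have := odd_double_half r; rewrite ro; lia.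
exact: zeta_even.
Qed.

End CyclicSides.

Section Conclusion.
Variable R : realType.
Local Notation ideal := (@zeta2_ideal R).
Local Notation Z := (@mzv_span R).

Lemma symm_sum_index (F G : seq nat -> R) k n :
  (forall u, all (leq 1) u -> F u = G u) -> all (leq 1) k ->
  symm_sum F k n = symm_sum G k n.
Proof.
move=> FG k1; have h i : all (leq 1) (take i k) /\ all (leq 1) (drop i k).
  by split; apply/allP => x; [move/mem_take|move/mem_drop]; apply: (allP k1).
apply: eq_bigr => i _; have [t1 d1] := h i; rewrite FG ?all_rev //; congr (_ * _).
by apply: eq_in_tadic => u su du; apply: FG; apply: all2_leq_index su du _.
Qed.

Lemma cvg_cyclic_sides (S : nat -> seq nat -> nat -> R) (T : seq nat -> nat -> R) k n :
  (forall w m, all (leq 1) w -> S N w m @[N --> \oo] --> T w m) -> all (leq 1) k ->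
  cyclic_lhs (S N) k n @[N --> \oo] --> cyclic_lhs T k n /\
  cyclic_rhs (S N) k n @[N --> \oo] --> cyclic_rhs T k n.
Proof.
move=> ST k1; have r1 i := cyc_rest_index i k1.
have n1 (i : 'I_(size k)) : (0 < nth 0%N k i)%N by apply: (allP k1); rewrite mem_nth.
split; last (apply: cvgD; apply: cvg_sum_seq => i _); last 2 first.
- apply: cvg_sum_seq => j _; apply: cvgD; apply: (ST).
    by rewrite /= r1 andbT; lia.
  by rewrite all_cat /= r1 n1.
- by apply: (ST); rewrite all_cat /= r1.
apply: cvg_sum_seq => i _; apply: cvg_sum_seq => j _; apply: (ST).
by rewrite all_cat /= r1 andbT; have := ltn_ord j; lia.
Qed.

(** An equality of real numbers, not only a congruence: both sides are limits of the truncated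
    formula, and the condition on [sumn k + n] makes the boundary terms vanish. *)
Lemma cyclic_sum_greg k n : all (leq 1) k -> (size k < sumn k + n)%N ->
  cyclic_lhs (symm_sum (@greg R)) k n = cyclic_rhs (symm_sum (@greg R)) k n.
Proof.
move=> k1 hk.
have [l1 l2] := cvg_cyclic_sides n (fun w m (w1 : all (leq 1) w) => @symm_sum_zetaN_cvg R _ m w1) k1.
have l3 : \sum_(i < size k) boundary_sum R N (rot i k) n @[N --> \oo] --> (\sum_(i < size k) 0 : R).
  apply: cvg_sum_seq => i _; apply: boundary_sum_cvg0.
  - by rewrite (eq_all_r (mem_rot i k)).
  - rewrite -size_eq0 size_rot; case: (size k) i => [[]|] //.
  - by rewrite size_rot sumn_rot.
have l4 := cvgD l2 l3; rewrite big1 // addr0 in l4.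
have e : (fun N => cyclic_lhs (symm_sum (zetaN R N)) k n) =
    (fun N => cyclic_rhs (symm_sum (zetaN R N)) k n) \+
    (fun N => \sum_(i < size k) boundary_sum R N (rot i k) n).
  by apply/funext => N; rewrite /cyclic_lhs truncated_cyclic_sum.
by rewrite e in l1; exact: (cvg_unique _ l1 (l4 _)).
Qed.

Lemma cyclic_sum_fhat k n : all (leq 1) k -> k != [::] ->
  ideal (cyclic_lhs (symm_sum (fhat R)) k n - cyclic_rhs (symm_sum (fhat R)) k n).
Proof.
move=> k1 k0; case: (ltnP (size k) (sumn k + n)) => hk.
  have [d1 d2] := cyclic_sides_congr n (fun w m (w1 : all (leq 1) w) => @symm_sum_greg_fhat R _ m w1) k1.
  rewrite (cyclic_sum_greg k1 hk) in d1.
  by have := zeta2_idealD d2 (zeta2_idealN d1); congr ideal; ring.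
have n0 : n = 0%N by have := index_size_sumn k1; lia.
have -> : k = nseq (size k).-1.+1 1%N.
  rewrite prednK ?lt0n ?size_eq0 //; apply: index_ones_of_sumn => //.
  by move: hk; rewrite n0 addn0.
by rewrite n0; exact: cyclic_sum_ones.
Qed.

Lemma smzv_congr b k n : (exists f, @is_regularization R b f) -> all (leq 1) k ->
  ideal (smzv R b k n - symm_sum (fhat R) k n).
Proof.
move=> [f freg] k1; have reg : is_regularization b (Zreg R b) by exact: (@xgetPex _ (fun=> 0) [set f | is_regularization b f] (ex_intro _ f freg)).
rewrite smzv_symm_sum; case: b reg {freg} => reg.
  rewrite (symm_sum_index (G := @greg R)) //; first exact: symm_sum_greg_fhat.
  by move=> u u1; rewrite -(reg0_harmonic reg).
rewrite (symm_sum_index (G := fhat R)) //; first by rewrite subrr; exact: zeta2_ideal0.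
by move=> u u1; rewrite -(reg0_shuffle reg).
Qed.

Lemma smzv_cyclic_sum b k n : all (leq 1) k -> k != [::] ->
  eqmod_zeta2 (cyclic_lhs (smzv R b) k n) (cyclic_rhs (smzv R b) k n).
Proof.
move=> k1 k0; have [reg|noreg] := pselect (exists f, @is_regularization R b f); last first.
  have z w m : smzv R b w m = 0.
    rewrite smzv_symm_sum /symm_sum big1 // => i _.
    by rewrite mzv_reg_trivial ?mulr0 ?mul0r // => f /(ex_intro _ f).
  have [-> ->] : cyclic_lhs (smzv R b) k n = 0 /\ cyclic_rhs (smzv R b) k n = 0.
    by apply: (@cyclic_sides_closed R (fun a => a = 0)) => // a c -> ->; rewrite addr0.
  by split; [exact: span0..|rewrite subrr; exact: zeta2_ideal0].
have d w m (w1 : all (leq 1) w) := smzv_congr m reg w1.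
have sp w m : all (leq 1) w -> Z (smzv R b w m).
  move=> w1; rewrite -(subrK (symm_sum (fhat R) w m) (smzv R b w m)).
  apply: spanD; first exact/zeta2_ideal_span/d.
  by apply: span_symm_sum => // u; exact: span_fhat.
have [s1 s2] := cyclic_sides_closed n (span0 R) (@spanD R) sp k1.
split => //; have [d1 d2] := cyclic_sides_congr n d k1.
have := zeta2_idealD (zeta2_idealD d1 (cyclic_sum_fhat n k1 k0)) (zeta2_idealN d2).
rewrite -/(ideal _); congr ideal; ring.
Qed.

End Conclusion.

Theorem theorem6p1 (R : realType) (b : product_kind) (k : seq nat)
  (hk : is_index k) (hk0 : k <> [::]) :
  series_eqmod_zeta2
    (\sum_(i < size k) \sum_(j < (nth 0%N k i).-1)
       smzv R b ((j.+1 :: cyc_rest k i) ++ [:: (nth 0%N k i - j)%N]))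
    (\sum_(i < size k)
       tsum (fun j : nat =>
         smzv R b ((nth 0%N k i + j + 1)%N :: cyc_rest k i) +
         smzv R b ((j.+1 :: cyc_rest k i) ++ [:: nth 0%N k i]))
     + \sum_(i < size k)
         smzv R b (cyc_rest k i ++ [:: (nth 0%N k i).+1])).
Proof.
move=> n; have := smzv_cyclic_sum R b n hk (introN eqP hk0).
congr eqmod_zeta2; first by rewrite fct_sumE; apply: eq_bigr => i _; rewrite fct_sumE.
rewrite /cyclic_rhs; symmetry; rewrite -[LHS]/(_ n + _ n) !fct_sumE; congr (_ + _).
Qed.
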